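(* For all $d,m\in\mathbb{N}$ there exists $\beta_0=\beta_0(d,m)>1$, and for each $r>0$ a constant $\mathrm{cst}(m,r)>0$ depending only on $m$ and $r$, such that: for every $n\ge m$, every polynomial map $p:\mathbb{R}^n\to\mathbb{R}^m$ with components of degree at most $d$, every $\Lambda=(\Lambda_1,\dots,\Lambda_m)\in\mathbb{R}^m_+$ and every $i=0,\dots,m$, $$V_i\big(p(C^\Lambda(p)\cap B_{\mathbb{R}^n}(r))\big)\le\mathrm{cst}(m,r)\,n^m\,\beta_0^n\,\Lambda_0\Lambda_1\cdots\Lambda_i,$$ where $\Lambda_0:=1$.
   Context: For a linear map $L:H\to\mathbb{R}^m$ on a Hilbert space with $\dim H\ge m$, the singular values are $\sigma_k(L)=\lambda_k(LL^\top)^{1/2}$, $k=1,\dots,m$, where $\lambda_1\ge\dots\ge\lambda_m$ are the eigenvalues of $LL^\top$. For a $C^1$ map $F:\mathbb{R}^n\to\mathbb{R}^m$, $n\ge m$, and $\Lambda\in\mathbb{R}^m_+$, $C^\Lambda(F)=\{x\in\mathbb{R}^n:\sigma_i(D_xF)\le\Lambda_i\ \forall i=1,\dots,m\}$. $B_{\mathbb{R}^n}(r)$ is the closed ball. Vitushkin variations of a bounded semialgebraic $A\subset\mathbb{R}^N$: $V_0(A)=b_0(A)$ is the number of connected components, and for $i=1,\dots,N$, $V_i(A)=c(N,i)\int_{G_i(\mathbb{R}^N)}\int_Z b_0(A\cap\pi_Z^{-1}(x))\,\mathcal{H}^i(dx)\,\gamma_{i,N}(dZ)$, where $G_i(\mathbb{R}^N)$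 is the Grassmannian of $i$-planes with its orthogonally invariant probability measure $\gamma_{i,N}$, $\pi_Z$ is orthogonal projection onto $Z$, $\mathcal{H}^i$ is $i$-dimensional Hausdorff measure, and $c(N,i)=\frac{\Gamma(1/2)\Gamma((N+1)/2)}{\Gamma((i+1)/2)\Gamma((N-i+1)/2)}$. *)

(* Defs.v *)
From HB Require Import structures.
From mathcomp Require Import all_boot all_order all_algebra.
From mathcomp Require Import all_classical all_reals all_analysis.
Set Implicit Arguments. Unset Strict Implicit. Unset Printing Implicit Defensive.
Import Order.TTheory GRing.Theory Num.Theory.
Import numFieldNormedType.Exports.
Local Open Scope classical_set_scope.
Local Open Scope ring_scope.

Definition poly_fun_deg {R : realType} (n d : nat) (f : 'rV[R]_n -> R) : Prop :=
  exists c : {ffun 'I_n -> 'I_d.+1} -> R,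
    (forall a : {ffun 'I_n -> 'I_d.+1}, (d < \sum_(j < n) (a j : nat))%N -> c a = 0) /\
    forall x : 'rV[R]_n,
      f x = \sum_(a : {ffun 'I_n -> 'I_d.+1}) c a * \prod_(j < n) x ord0 j ^+ a j.

Definition poly_map_deg {R : realType} (n m d : nat) (p : 'rV[R]_n -> 'rV[R]_m) : Prop :=
  forall k : 'I_m, poly_fun_deg d (fun x => p x ord0 k).

Definition jacobian {R : realType} (n m : nat) (p : 'rV[R]_n -> 'rV[R]_m)
  (x : 'rV[R]_n) : 'M[R]_(m, n) :=
  \matrix_(k < m, j < n) ('D_(delta_mx ord0 j) p x) ord0 k.

Definition sorted_spectrum {R : realType} (m : nat) (M : 'M[R]_m) (s : m.-tuple R) : Prop :=
  sorted >=%R s /\ char_poly M = \prod_(x <- s) ('X - x%:P).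

Definition sing_vals_le {R : realType} (m n : nat) (L : 'M[R]_(m, n)) (Lam : 'I_m -> R) : Prop :=
  exists s : m.-tuple R, sorted_spectrum (L *m L^T) s /\
    forall k : 'I_m, Num.sqrt (tnth s k) <= Lam k.

Definition CLam {R : realType} (n m : nat) (p : 'rV[R]_n -> 'rV[R]_m) (Lam : 'I_m -> R)
  : set 'rV[R]_n := [set x | sing_vals_le (jacobian p x) Lam].

Definition eball {R : realType} (n : nat) (r : R) : set 'rV[R]_n :=
  [set x | \sum_(j < n) x ord0 j ^+ 2 <= r ^+ 2].

Definition edist {R : realType} (N : nat) (x y : 'rV[R]_N) : R :=
  Num.sqrt (\sum_(j < N) (x ord0 j - y ord0 j) ^+ 2).

Definition ediam {R : realType} (N : nat) (C : set 'rV[R]_N) : \bar R :=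
  ereal_sup ([set 0%E] `|` [set z | exists x y, C x /\ C y /\ z = (edist x y)%:E]).

(* volume of the unit ball of R^s : pi^(s/2) / Gamma(s/2 + 1) *)
Fixpoint omega_ball {R : realType} (s : nat) : R :=
  match s with
  | 0%N => 1
  | 1%N => 2
  | (j.+2)%N => omega_ball j * (2 * pi) / (j.+2)%:R
  end.

Definition hausdorff_delta {R : realType} (N s : nat) (delta : R) (E : set 'rV[R]_N) : \bar R :=
  ereal_inf [set z | exists C : nat -> set 'rV[R]_N,
     E `<=` \bigcup_j C j /\ (forall j, (ediam (C j) <= delta%:E)%E) /\
     z = (\sum_(j <oo) ((@omega_ball R s)%:E * (ediam (C j) * (2^-1)%:E) ^+ s))%E].

(* s-dimensional Hausdorff (outer) measure on R^N, normalized so that H^s = Lebesgue on R^s *)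
Definition hausdorff {R : realType} (N s : nat) (E : set 'rV[R]_N) : \bar R :=
  ereal_sup [set z | exists delta : R, 0 < delta /\ z = hausdorff_delta s delta E].

(* integral of a nonnegative function over D w.r.t. a (outer) measure mu, in layer-cake form *)
Definition layer_int {R : realType} (T : Type) (mu : set T -> \bar R) (D : set T)
  (f : T -> \bar R) : \bar R :=
  (\int[@lebesgue_measure R]_(t in [set t : R | (0 <= t)%R])
      mu [set x | D x /\ (t%:E < f x)%E])%E.

Definition b0 {R : realType} (N : nat) (A : set 'rV[R]_N) : \bar R :=
  ereal_sup [set z | exists k : nat, z = (k%:R)%:E /\
     exists f : 'I_k -> 'rV[R]_N,
       (forall j, A (f j)) /\ injective (fun j => connected_component A (f j))].

(* ---------- Grassmannian G_i(R^N) as orthogonal projections, invariant measure ---------- *)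
Definition grass_proj {R : realType} (N i : nat) (P : 'M[R]_N) : Prop :=
  P^T = P /\ P *m P = P /\ \rank P = i.

Definition MBorel (R : realType) (N : nat) := g_sigma_algebraType (@open 'M[R]_N).

Definition orthogonal_mx {R : realType} (N : nat) (Q : 'M[R]_N) : Prop := Q *m Q^T = 1%:M.

Definition grass_invariant_prob {R : realType} (N i : nat) (gam : probability (MBorel R N) R)
  : Prop :=
  gam [set P | grass_proj i P] = 1%E /\
  forall Q : 'M[R]_N, orthogonal_mx Q ->
    forall B : set (MBorel R N), measurable B ->
      gam [set P | B (Q *m P *m Q^T)] = gam B.

(* Gamma(k/2) for k >= 1 *)
Fixpoint gamma_half {R : realType} (k : nat) : R :=
  match k with
  | 0%N => 0
  | 1%N => Num.sqrt pi
  | 2%N => 1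
  | (j.+2)%N => j%:R / 2 * gamma_half j
  end.

Definition cNi {R : realType} (N i : nat) : R :=
  (@gamma_half R 1) * gamma_half N.+1 / (gamma_half i.+1 * gamma_half (N - i).+1).

(* Z = range of P, pi_Z(a) = a P ; \int_Z b_0(A cap pi_Z^-1(x)) H^i(dx) *)
Definition fiber_int {R : realType} (N i : nat) (A : set 'rV[R]_N) (P : 'M[R]_N) : \bar R :=
  layer_int (@hausdorff R N i) [set x | x *m P = x]
    (fun x => b0 [set a | A a /\ a *m P = x]).

Definition vitushkin {R : realType} (N : nat) (gam : nat -> probability (MBorel R N) R)
  (i : nat) (A : set 'rV[R]_N) : \bar R :=
  if i == 0%N then b0 A
  else ((@cNi R N i)%:E * \int[gam i]_P fiber_int i A P)%E.

(* Main.v *)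
(** Each fibre of an orthogonal projection of [p @` (CLam p Lam `&` eball r)] is
    bounded in number of components, and the projection itself in Hausdorff
    measure; both bounds come from counting local minima of polynomials.

    Counting.  If [E >= 0] is a polynomial of degree at most [e], the critical
    points of [E + eps * \sum_j x_j ^ (2 e + 2)] solve equations
    [x_j ^ (2 e + 1) = (polynomial of degree <= 2 e)].  Modulo these, every
    polynomial reduces to monomials with all exponents at most [2 e], so there
    are at most [(2 e + 1) ^ N] solutions: a linear-algebra substitute for
    Bezout.  When the compact set [E = 0] splits into [q] pieces, the perturbed
    function has a local minimum near each, whence [q <= (2 e + 1) ^ N].  With
    eigenvalues and slack variables as extra unknowns, [CLam p Lam] in the ball
    is a projection of such a set.

    Measure.  For [t] in the projection onto an [i]-plane, choose as preimage of
    [t] a critical point [v] of a perturbation of [E + |p P - t|^2].  The pairs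
    [(v, t)] form an algebraic set of dimension [i]: any [i + 1] coordinates are
    algebraically dependent, so slices along a generic grid of mesh [eta] are
    empty beyond codimension [i], and counting the cells isolated by successive
    slices shows that only [O(eta ^ - i)] cells of mesh [eta] are visited.  On
    one cell [p] is affine up to [O(eta ^ 2)], and a frame of the plane adapted
    to the singular directions covers the image of the cell by
    [\prod_k (c Lam_k + O(eta)) / eta] cubes of side [eta ^ 2].  Let [eta] tend
    to [0]. *)
Require Import Defs.
From HB Require Import structures.
From mathcomp Require Import all_boot all_order all_algebra.
From mathcomp Require Import all_classical all_reals all_analysis.
From mathcomp Require Import perm measurable_realfun ring lra zify.
Set Implicit Arguments. Unset Strict Implicit. Unset Printing Implicit Defensive.
Import Order.TTheory GRing.Theory Num.Theory.
Import numFieldNormedType.Exports.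
Local Open Scope classical_set_scope.
Local Open Scope ring_scope.

(** * Polynomial functions *)

(** Uniformity shapes the argument. The perturbation parameter, hence the algebraic set whose cells
    are counted, changes with [eta], so a count may depend only on the number of variables and on
    the degree, never on the set itself. Choosing preimages by a critical equation is what cuts
    possibly large fibres down to dimension [i]. The scales [eta] and [eta ^ 2] match the Taylor
    remainder: a point may move by [eta] in the source while its image is tracked up to [eta ^ 2].
    Then [eta ^ - i] cells, [eta ^ - i] boxes per cell and the weight [eta ^ (2 * i)] of a box
    cancel. The constant has the following origin. The lift has [n] unknowns plus a number depending
    on [m], and a degree depending only on [d] and [m], so both counts are exponential in [n]. The
    grid contributes a factor [n ^ i], kept as [n ^ m]; the widths of the boxes contribute another
    one, absorbed into [beta0 ^ n] through [n <= 2 ^ n]. *)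

Inductive pf {R : realType} {N : nat} : nat -> ('rV[R]_N -> R) -> Prop :=
| pf_cst D c : pf D (fun=> c)
| pf_var D j : pf D.+1 (fun x => x ord0 j)
| pf_add D f g : pf D f -> pf D g -> pf D (fun x => f x + g x)
| pf_mul D E f g : pf D f -> pf E g -> pf (D + E) (fun x => f x * g x)
| pf_le D E f : (D <= E)%N -> pf D f -> pf E f.

Section PolynomialFunctions.
Variable R : realType.
Implicit Types (N D : nat).

Lemma eq_pf N D (f g : 'rV[R]_N -> R) : f =1 g -> pf D f -> pf D g.
Proof. by move=> /funext ->. Qed.

Lemma pf_scale N D c (f : 'rV[R]_N -> R) : pf D f -> pf D (fun x => c * f x).
Proof. by move=> hf; apply: (@pf_mul _ _ 0) => //; apply: pf_cst. Qed.

Lemma pf_opp N D (f : 'rV[R]_N -> R) : pf D f -> pf D (fun x => - f x).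
Proof. by move=> /(pf_scale (-1)); apply: eq_pf => x; rewrite mulN1r. Qed.

Lemma pf_sub N D (f g : 'rV[R]_N -> R) :
  pf D f -> pf D g -> pf D (fun x => f x - g x).
Proof. by move=> hf /pf_opp; apply: pf_add. Qed.

Lemma pf_exp N D (f : 'rV[R]_N -> R) k : pf D f -> pf (k * D) (fun x => f x ^+ k).
Proof.
move=> hf; elim: k => [|k IH].
  by apply: eq_pf (pf_cst _ 1) => x; rewrite expr0.
by rewrite mulSn; apply: eq_pf (pf_mul hf IH) => x; rewrite exprS.
Qed.

Lemma pf_sum N D (I : Type) (s : seq I) (P : pred I) (F : I -> 'rV[R]_N -> R) :
  (forall i, P i -> pf D (F i)) -> pf D (fun x => \sum_(i <- s | P i) F i x).
Proof.
move=> hF; elim: s => [|i s IH].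
  by apply: eq_pf (pf_cst _ 0) => x; rewrite big_nil.
case Pi: (P i); last by apply: eq_pf IH => x; rewrite big_cons Pi.
by apply: eq_pf (pf_add (hF i Pi) IH) => x; rewrite big_cons Pi.
Qed.

Lemma pf_prod N (I : Type) (s : seq I) (P : pred I) (d : I -> nat)
    (F : I -> 'rV[R]_N -> R) :
  (forall i, P i -> pf (d i) (F i)) ->
  pf (\sum_(i <- s | P i) d i) (fun x => \prod_(i <- s | P i) F i x).
Proof.
move=> hF; elim: s => [|i s IH].
  by apply: eq_pf (pf_cst _ 1) => x; rewrite big_nil.
rewrite big_cons; case Pi: (P i); last by apply: eq_pf IH => x; rewrite big_cons Pi.
by apply: eq_pf (pf_mul (hF i Pi) IH) => x; rewrite big_cons Pi.
Qed.

Lemma pf_comp N M D (f : 'rV[R]_N -> R) (phi : 'rV[R]_M -> 'rV[R]_N) :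
  (forall j, pf 1 (fun x => phi x ord0 j)) -> pf D f -> pf D (fun x => f (phi x)).
Proof.
move=> hphi; elim=> {D f}.
- by move=> D c; apply: pf_cst.
- by move=> D j; apply: pf_le (hphi j).
- by move=> D f g _ hf _ hg; apply: pf_add.
- by move=> D E f g _ hf _ hg; apply: pf_mul.
- by move=> D E f le_DE _; apply: pf_le.
Qed.

Definition mon N (e : 'I_N -> nat) (x : 'rV[R]_N) : R := \prod_j x ord0 j ^+ e j.

Lemma pf_mon N (e : 'I_N -> nat) : pf (\sum_j e j) (mon e).
Proof.
apply: pf_prod => j _; rewrite -[X in pf X]muln1.
by apply: (@pf_exp _ 1 (fun x => x ord0 j)); apply: pf_var.
Qed.

(** The passage from [pf] to explicit monomials, the form on which the rewriting below operates. *)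
Lemma pf_mon_sum N D (f : 'rV[R]_N -> R) : pf D f ->
  exists s : seq (R * ('I_N -> nat)),
    all (fun u => \sum_j u.2 j <= D)%N s /\
    forall x, f x = \sum_(u <- s) u.1 * mon u.2 x.
Proof.
elim=> {D f}.
- move=> D c; exists [:: (c, fun=> 0%N)]; split; first by rewrite /= big1.
  by move=> x; rewrite big_seq1 /mon big1 ?mulr1 // => j _; rewrite expr0.
- move=> D j; exists [:: (1, fun i => (i == j) : nat)]; split.
    by rewrite /= (bigD1 j) //= eqxx big1 // => i /negPf->.
  move=> x; rewrite big_seq1 /mon mul1r (bigD1 j) //= eqxx expr1 big1 ?mulr1 //.
  by move=> i /negPf->; rewrite expr0.
- move=> D f g _ [s [hs fs]] _ [t [ht gt]]; exists (s ++ t).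
  by rewrite all_cat hs ht; split=> // x; rewrite big_cat /= fs gt.
- move=> D E f g _ [s [hs fs]] _ [t [ht gt]].
  exists [seq (u.1 * v.1, fun j => (u.2 j + v.2 j)%N) | u <- s, v <- t]; split.
    elim: s hs {fs} => [//|u s IH] /= /andP[hu /IH hs]; rewrite all_cat hs andbT.
    rewrite all_map; apply: sub_all ht => v /= hv.
    by rewrite big_split /=; apply: leq_add.
  move=> x; rewrite fs gt big_allpairs_dep /= mulr_suml; apply: eq_bigr => u _.
  rewrite mulr_sumr; apply: eq_bigr => v _ /=.
  have -> : mon (fun j => (u.2 j + v.2 j)%N) x = mon u.2 x * mon v.2 x.
    by rewrite /mon -big_split /=; apply: eq_bigr => j _; rewrite exprD.
  by rewrite mulrACA.
- move=> D E f le_DE _ [s [hs fs]]; exists s; split=> //.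
  by apply: sub_all hs => u hu; apply: leq_trans le_DE.
Qed.

(* [relX] allows rewriting powers above [k] of the variables in [V], at the cost of
   lower total degree only. *)
Section Reduction.
Variables (N k D : nat) (V : pred 'I_N) (X : set 'rV[R]_N).
Variable h : 'I_N -> 'rV[R]_N -> R.
Hypothesis pfh : forall j, V j -> pf k (h j).
Hypothesis relX : forall x j, X x -> V j -> x ord0 j ^+ k.+1 = h j x.

Definition redexp := [set e : {ffun 'I_N -> 'I_(k + D).+1} |
  [forall j, (e j <= if V j then k else D)%N]]%SET.

Lemma card_redexp : (#|redexp| <= k.+1 ^ #|V| * D.+1 ^ #|predC V|)%N.
Proof.
pose F (j : 'I_N) := [pred a : 'I_(k + D).+1 | (a <= if V j then k else D)%N].
have -> : #|redexp| = #|family F|.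
  by apply: eq_card => e; rewrite inE; apply/forallP/familyP.
rewrite card_family foldrE big_map big_enum /= (bigID V) /=.
have cF j : (#|F j| <= (if V j then k else D).+1)%N.
  set b := if V j then k else D.
  rewrite -[X in (_ <= X)%N]card_ord.
  pose g (a : 'I_(k + D).+1) : 'I_b.+1 := inord a.
  rewrite -(@card_in_image _ _ g (F j)); first exact: max_card.
  move=> a a'; rewrite !inE -/b => la la' /(congr1 val) /=.
  by rewrite !inordK ?ltnS // => /val_inj.
apply: leq_mul.
  rewrite -prod_nat_const; apply: leq_prod => j Vj.
  by apply: leq_trans (cF j) _; rewrite Vj.
rewrite -prod_nat_const; apply: leq_prod => j /negPf Vj.
by apply: leq_trans (cF j) _; rewrite Vj.
Qed.

(** Strong induction on the degree: trading a factor [x_j ^ k.+1] for [h j], of degree at most [k],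
    lowers the total degree, so the rewriting stops. The degree never exceeds [D], which bounds the
    exponents of the variables outside [V]. *)
Lemma reduction d (f : 'rV[R]_N -> R) : (d <= D)%N -> pf d f ->
  exists c : {ffun 'I_N -> 'I_(k + D).+1} -> R, forall x, X x ->
    f x = \sum_(e in redexp) c e * mon (fun j => e j) x.
Proof.
elim/ltn_ind: d f => d IH f le_dD /pf_mon_sum [s [hs fs]].
suff [c hc] : exists c : {ffun 'I_N -> 'I_(k + D).+1} -> R, forall x, X x ->
    \sum_(u <- s) u.1 * mon u.2 x = \sum_(e in redexp) c e * mon (fun j => e j) x.
  by exists c => x Xx; rewrite fs hc.
elim: s hs {fs f} => [|u s IHs] /= => [_|/andP[hu hs]].
  by exists (fun=> 0) => x _; rewrite big_nil big1 // => e _; rewrite mul0r.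
have [c hc] := IHs hs.
suff [c' hc'] : exists c : {ffun 'I_N -> 'I_(k + D).+1} -> R, forall x, X x ->
    mon u.2 x = \sum_(e in redexp) c e * mon (fun j => e j) x.
  exists (fun e => u.1 * c' e + c e) => x Xx; rewrite big_cons hc // hc' //.
  rewrite mulr_sumr -big_split; apply: eq_bigr => e _ /=.
  by rewrite mulrDl mulrA.
move: u.2 hu => e he {u s IHs c hc hs}.
case: (boolP [exists j, V j && (k < e j)%N]) => [/existsP [j /andP[Vj kj]]|].
  pose e' i := if i == j then (e j - k.+1)%N else e i.
  have e'j : e' j = (e j - k.+1)%N by rewrite /e' eqxx.
  have se : (\sum_i e i = \sum_i e' i + k.+1)%N.
    rewrite (bigD1 j) //= [in RHS](bigD1 j) //= e'j.
    rewrite addnAC subnK //; congr (_ + _)%N.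
    by apply: eq_bigr => i /negPf ij; rewrite /e' ij.
  have d_gt0 : (\sum_i e' i + k < d)%N by rewrite -addnS -se.
  have [|c hc] := IH _ d_gt0 (fun x => mon e' x * h j x) (leq_trans (ltnW d_gt0) le_dD).
    by apply: pf_mul; [apply: pf_mon|apply: pfh].
  exists c => x Xx; rewrite -hc // -relX //.
  rewrite /mon (bigD1 j) //= [in RHS](bigD1 j) //= e'j.
  rewrite mulrAC -exprD subnK //; congr (_ * _).
  by apply: eq_bigr => i /negPf ij; rewrite /e' ij.
rewrite negb_exists => /forallP hV.
have eb j : (e j <= if V j then k else D)%N.
  have := hV j; case: (V j) => /=; first by rewrite -leqNgt.
  by move=> _; apply: leq_trans le_dD; apply: leq_trans he; rewrite (bigD1 j) ?leq_addr.
have ltB j : (e j < (k + D).+1)%N by have := eb j; case: (V j); lia.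
pose e0 : {ffun 'I_N -> 'I_(k + D).+1} := [ffun j => Ordinal (ltB j)].
exists (fun e1 => (e1 == e0)%:R) => x _.
rewrite (bigD1 e0) /=; last by rewrite inE; apply/forallP => j; rewrite ffunE eb.
rewrite eqxx mul1r big1 ?addr0.
  by rewrite /mon; apply: eq_bigr => j _; rewrite ffunE.
by move=> e1 /andP[_ /negPf->]; rewrite mul0r.
Qed.

(** With more polynomials than reduced monomials, the matrix of reduced coefficients has a nonzero
    left kernel. *)
Lemma linear_relation (G : finType) (L : G -> 'rV[R]_N -> R) :
  (forall g, pf D (L g)) -> (k.+1 ^ #|V| * D.+1 ^ #|predC V| < #|G|)%N ->
  exists c : G -> R, (exists g, c g != 0) /\
    forall x, X x -> \sum_g c g * L g x = 0.
Proof.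
move=> pfL ltG; have {}ltG := leq_ltn_trans card_redexp ltG.
have /choice[C hC] : forall g, exists c : {ffun 'I_N -> 'I_(k + D).+1} -> R,
    forall x, X x -> L g x = \sum_(e in redexp) c e * mon (fun j => e j) x.
  by move=> g; apply: reduction (leqnn D) (pfL g).
pose A : 'M[R]_(#|G|, #|redexp|) := \matrix_(i, j) C (enum_val i) (enum_val j).
have /rowV0Pn [u /sub_kermxP uA u0] : kermx A != 0.
  rewrite -mxrank_eq0 mxrank_ker subn_eq0 -ltnNge.
  exact: leq_ltn_trans (rank_leq_col A) ltG.
exists (fun g => u ord0 (enum_rank g)); split.
  have [j uj] : exists j, u ord0 j != 0.
    apply: contra_notP (negP u0) => nex; apply/eqP/rowP => j; rewrite mxE.
    by apply/eqP; apply: contrapT => /negP ?; apply: nex; exists j.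
  by exists (enum_val j); rewrite enum_valK.
move=> x Xx.
under eq_bigr => g _ do rewrite hC // mulr_sumr.
rewrite exchange_big /= big1 // => e he.
under eq_bigr => g _ do rewrite mulrA.
rewrite -mulr_suml (_ : \sum_g _ = 0) ?mul0r //.
have /rowP/(_ (enum_rank_in he e)) := uA; rewrite !mxE => E.
rewrite -[RHS]E (reindex_onto enum_val enum_rank) /=; last by move=> ? _; exact: enum_rankK.
under eq_bigl do rewrite enum_valK eqxx.
by apply: eq_bigr => i _; rewrite !mxE enum_valK enum_rankK_in.
Qed.

End Reduction.

(** Products of coordinate differences give, for each point, a polynomial that vanishes at all the
    other points but not at this one, so they satisfy no linear relation on [X]. Their degree grows
    with [q], but when every variable is reducible the number of reduced monomials does not depend
    on the degree. *)
Lemma card_common_zeros N k (X : set 'rV[R]_N) (h : 'I_N -> 'rV[R]_N -> R) q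
    (x : 'I_q -> 'rV[R]_N) :
  (forall j, pf k (h j)) -> (forall x j, X x -> x ord0 j ^+ k.+1 = h j x) ->
  injective x -> (forall l, X (x l)) -> (q <= k.+1 ^ N)%N.
Proof.
move=> pfh relX injx Xx; rewrite leqNgt; apply/negP => lt_q.
have /choice [sep hsep] : forall gl : 'I_q * 'I_q, exists j : option 'I_N,
    gl.1 != gl.2 -> if j is Some j then x gl.1 ord0 j != x gl.2 ord0 j else false.
  move=> [g l] /=; case: (eqVneq g l) => [->|gl]; first by exists None.
  have : x g != x l by rewrite (inj_eq injx).
  move=> /eqP/rowP; rewrite -existsNE => -[j /eqP hj]; by exists (Some j).
pose fac (g l : 'I_q) (y : 'rV[R]_N) : R :=
  if sep (g, l) is Some j then y ord0 j - x l ord0 j else 1.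
pose L g y := \prod_(l | l != g) fac g l y.
have pfL g : pf q (L g).
  apply: (@pf_le _ _ (\sum_(l < q | l != g) 1)).
    by rewrite sum1_card; apply: leq_trans (max_card _) _; rewrite card_ord.
  apply: pf_prod => l _; rewrite /fac; case: (sep _) => [j|]; last exact: pf_cst.
  by apply: pf_sub; [apply: pf_var|apply: pf_cst].
have [|||c [[g cg] hc]] := @linear_relation N k q predT X h _ _ 'I_q L pfL.
- by move=> j _; apply: pfh.
- by move=> y j Xy _; apply: relX.
- rewrite card_ord cardT size_enum_ord.
  have -> : #|predC (@predT 'I_N)| = 0%N by apply: eq_card0 => j.
  by rewrite expn0 muln1.
have := hc _ (Xx g); rewrite (bigD1 g) //= big1 ?addr0 => [/eqP|l lg].
  rewrite mulf_eq0 (negPf cg) /= => /prodf_eq0 [l lg].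
  rewrite /fac; have := hsep (g, l); rewrite eq_sym lg => /(_ isT) /=.
  by case: (sep _) => // j; rewrite subr_eq0 => /negPf->.
rewrite /L (bigD1 g) 1?eq_sym //= (_ : fac l g (x g) = 0) ?mul0r ?mulr0 //.
rewrite /fac; have := hsep (l, g) lg => /=.
by case: (sep _) => // j _; rewrite subrr.
Qed.

End PolynomialFunctions.

(** * Gradients and second-order expansions *)

Section Calculus.
Variable R : realType.
Implicit Types (N D : nat).

Lemma rV_norm_le N (x : 'rV[R]_N) e : 0 <= e ->
  (forall j, `|x ord0 j| <= e) -> `|x| <= e.
Proof.
move=> e0 h; rewrite [leLHS]/Num.Def.normr/= mx_normrE (bigmax_le _ e0)//=.
by move=> -[i j] _ /=; rewrite ord1.
Qed.

Lemma rV_coord_le N (x : 'rV[R]_N) j : `|x ord0 j| <= `|x|.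
Proof.
rewrite [leRHS]/Num.Def.normr/= mx_normrE; apply/bigmax_geP; right => /=.
by exists (ord0, j).
Qed.

Lemma rV_norm_lt N (x : 'rV[R]_N) e : 0 < e ->
  (forall j, `|x ord0 j| < e) -> `|x| < e.
Proof.
move=> e0 h; rewrite [ltLHS]/Num.Def.normr/= mx_normrE; apply/bigmax_ltP; split=> //.
by move=> -[i j] _ /=; rewrite ord1.
Qed.

Lemma ler_normD_le (a b c d : R) : `|a| <= c -> `|b| <= d -> `|a + b| <= c + d.
Proof. by move=> h1 h2; apply: le_trans (ler_normD _ _) _; apply: lerD. Qed.

Lemma pf_continuous N D (f : 'rV[R]_N -> R) : pf D f -> continuous f.
Proof.
elim=> {D f}.
- by move=> D c; apply: cst_continuous.
- by move=> D j; apply: coord_continuous.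
- by move=> D f g _ hf _ hg x; apply: continuousD; [apply: hf|apply: hg].
- by move=> D E f g _ hf _ hg x; apply: continuousM; [apply: hf|apply: hg].
- by [].
Qed.

Lemma pf_bounded N D (f : 'rV[R]_N -> R) A : pf D f ->
  exists2 M, 0 <= M & forall x, `|x| <= A -> `|f x| <= M.
Proof.
elim=> {D f}.
- by move=> D c; exists `|c|.
- move=> D j; exists `|A| => // x xA; apply: le_trans (rV_coord_le _ _) _.
  exact: le_trans xA (ler_norm _).
- move=> D f g _ [M M0 hM] _ [K K0 hK]; exists (M + K); first exact: addr_ge0.
  by move=> x xA; apply: le_trans (ler_normD _ _) _; rewrite lerD ?hM ?hK.
- move=> D E f g _ [M M0 hM] _ [K K0 hK]; exists (M * K); first exact: mulr_ge0.
  by move=> x xA; rewrite normrM ler_pM ?hM ?hK.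
- by [].
Qed.

Lemma pf_lipschitz N D (f : 'rV[R]_N -> R) A : pf D f ->
  exists2 M, 0 <= M &
    forall x y, `|x| <= A -> `|y| <= A -> `|f y - f x| <= M * `|y - x|.
Proof.
elim=> {D f}.
- by move=> D c; exists 0 => // x y _ _; rewrite subrr normr0 mul0r.
- move=> D j; exists 1 => // x y _ _; rewrite mul1r.
  by apply: le_trans (rV_coord_le _ j); rewrite !mxE.
- move=> D f g _ [M M0 hM] _ [K K0 hK]; exists (M + K); first exact: addr_ge0.
  move=> x y xA yA; rewrite opprD addrACA.
  by rewrite [leRHS]mulrDl; apply: ler_normD_le; [apply: hM|apply: hK].
- move=> D E f g pff [M M0 hM] pfg [K K0 hK].
  have [Bf Bf0 hBf] := pf_bounded A pff; have [Bg Bg0 hBg] := pf_bounded A pfg.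
  exists (M * Bg + Bf * K); first by rewrite addr_ge0 ?mulr_ge0.
  move=> x y xA yA.
  have -> : f y * g y - f x * g x = (f y - f x) * g y + f x * (g y - g x) by ring.
  rewrite [leRHS]mulrDl; apply: ler_normD_le; rewrite normrM.
    by rewrite mulrAC ler_pM ?hM ?hBg.
  by rewrite -mulrA ler_pM ?hBf ?hK.
- by [].
Qed.

(* The same degree bound serves for a polynomial and its gradient: [perturb] below
   leaves room for it. *)
Definition gradient N (f : 'rV[R]_N -> R) (g : 'I_N -> 'rV[R]_N -> R) :=
  forall A, exists2 M, 0 <= M & forall x y, `|x| <= A -> `|y| <= A ->
    `|f y - f x - \sum_j (y ord0 j - x ord0 j) * g j x| <= M * `|y - x| ^+ 2.

Lemma gradient_add N (f f' : 'rV[R]_N -> R) g g' : gradient f g -> gradient f' g' ->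
  gradient (fun x => f x + f' x) (fun j x => g j x + g' j x).
Proof.
move=> hf hf' A; have [M M0 hM] := hf A; have [K K0 hK] := hf' A.
exists (M + K) => [|x y xA yA]; first exact: addr_ge0.
under eq_bigr do rewrite mulrDr; rewrite big_split /=.
set s := \sum_ _ _; set s' := \sum_ _ _.
have -> : f y + f' y - (f x + f' x) - (s + s') = (f y - f x - s) + (f' y - f' x - s') by ring.
by rewrite [leRHS]mulrDl; apply: ler_normD_le; [apply: hM|apply: hK].
Qed.

Lemma gradient_cst N (c : R) : @gradient N (fun=> c) (fun _ _ => 0).
Proof.
move=> A; exists 0 => // x y _ _; rewrite subrr sub0r normrN mul0r.
by rewrite big1 ?normr0 // => j _; rewrite mulr0.
Qed.

Lemma gradient_var N (i : 'I_N) :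
  gradient (fun x : 'rV[R]_N => x ord0 i) (fun j _ => (j == i)%:R).
Proof.
move=> A; exists 0 => // x y _ _; rewrite mul0r (bigD1 i) //= eqxx mulr1 big1.
  by rewrite addr0 subrr normr0.
by move=> j /negPf ->; rewrite mulr0.
Qed.

Lemma gradient_mul N D E (f f' : 'rV[R]_N -> R) g g' : pf D f -> pf E f' ->
  gradient f g -> gradient f' g' ->
  gradient (fun x => f x * f' x) (fun j x => g j x * f' x + f x * g' j x).
Proof.
move=> pff pff' hf hf' A; have [M M0 hM] := hf A; have [K K0 hK] := hf' A.
have [B B0 hB] := pf_bounded A pff; have [B' B'0 hB'] := pf_bounded A pff'.
have [L L0 hL] := pf_lipschitz A pff; have [L' L'0 hL'] := pf_lipschitz A pff'.
exists (L * L' + M * B' + B * K) => [|x y xA yA].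
  by rewrite !addr_ge0 ?mulr_ge0.
have -> : \sum_j (y ord0 j - x ord0 j) * (g j x * f' x + f x * g' j x) =
    (\sum_j (y ord0 j - x ord0 j) * g j x) * f' x +
    f x * (\sum_j (y ord0 j - x ord0 j) * g' j x).
  rewrite mulr_suml mulr_sumr -big_split; apply: eq_bigr => j _ /=; ring.
set s := \sum_ _ _; set s' := \sum_ _ _.
have -> : f y * f' y - f x * f' x - (s * f' x + f x * s') =
  (f y - f x) * (f' y - f' x) + (f y - f x - s) * f' x + f x * (f' y - f' x - s').
  by ring.
rewrite [leRHS]mulrDl [X in _ <= X + _]mulrDl; apply: ler_normD_le; last by rewrite normrM -mulrA ler_pM ?hB ?hK.
apply: ler_normD_le; last by rewrite normrM mulrAC ler_pM ?hB' ?hM.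
by rewrite normrM expr2 mulrACA ler_pM ?hL ?hL'.
Qed.

Lemma gradient_scale N D c (f : 'rV[R]_N -> R) g : pf D f -> gradient f g ->
  gradient (fun x => c * f x) (fun j x => c * g j x).
Proof.
move=> pff hf; have := gradient_mul (@pf_cst _ _ 0 c) pff (@gradient_cst N c) hf.
by congr gradient; do 2!apply/funext => ?; rewrite mul0r add0r.
Qed.

Lemma gradient_exp N (i : 'I_N) k :
  gradient (fun x : 'rV[R]_N => x ord0 i ^+ k)
           (fun j x => (j == i)%:R * (k%:R * x ord0 i ^+ k.-1)).
Proof.
elim: k => [|k IH].
  have := @gradient_cst N 1; congr gradient; do ?[apply/funext => ?] => //.
  by rewrite mul0r mulr0.
have pfk : pf (k * 1) (fun x : 'rV[R]_N => x ord0 i ^+ k).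
  by apply: (@pf_exp _ _ 1 (fun x => x ord0 i)); apply: pf_var.
have := gradient_mul (@pf_var _ _ 0 i) pfk (gradient_var i) IH.
congr gradient; first by apply/funext => x; rewrite exprS.
do 2!apply/funext => ?; case: k {IH pfk} => [|k] /=; first by rewrite mul0r !mulr0 addr0 mul1r.
rewrite mulrCA -mulrDr mulrCA -exprS -[X in _ * (X + _)]mul1r -mulrDl.
by rewrite -[in RHS]natr1 addrC.
Qed.

Lemma gradient_sum N (I : finType) (f : I -> 'rV[R]_N -> R) g :
  (forall i, gradient (f i) (g i)) ->
  gradient (fun x => \sum_i f i x) (fun j x => \sum_i g i j x).
Proof.
move=> hf.
suff H (s : seq I) : gradient (fun x => \sum_(i <- s) f i x) (fun j x => \sum_(i <- s) g i j x).
  exact: H.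
elim: s => [|i s IH].
  have := @gradient_cst N 0; congr gradient; do ?[apply/funext => ?];
    by rewrite big_nil.
have := gradient_add (hf i) IH; congr gradient; do ?[apply/funext => ?];
    by rewrite big_cons.
Qed.

Lemma pf_gradient N D (f : 'rV[R]_N -> R) : pf D f ->
  exists2 g, gradient f g & forall j, pf D (g j).
Proof.
elim=> {D f}.
- by move=> D c; exists (fun _ _ => 0); [apply: gradient_cst|move=> j; apply: pf_cst].
- move=> D i; exists (fun j _ => (j == i)%:R); first exact: gradient_var.
  by move=> j; apply: pf_cst.
- move=> D f f' _ [g gf pg] _ [g' gf' pg']; exists (fun j x => g j x + g' j x).
    exact: gradient_add.
  by move=> j; apply: pf_add.
- move=> D E f f' pf1 [g gf pg] pf2 [g' gf' pg'].
  exists (fun j x => g j x * f' x + f x * g' j x); first exact: gradient_mul pf1 pf2 _ _.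
  by move=> j; apply: pf_add; apply: pf_mul.
- move=> D E f DE _ [g gf pg]; exists g => // j; exact: pf_le (pg j).
Qed.

(** A step of length [s * |c|] against a nonzero partial derivative [c] lowers [f] by [s * c ^ 2],
    up to an error [M * s ^ 2 * c ^ 2] that is smaller once [M * s < 1]. *)
Lemma gradient_local_min N (f : 'rV[R]_N -> R) g (U : set 'rV[R]_N) x :
  gradient f g -> open U -> U x -> (forall y, U y -> f x <= f y) ->
  forall j, g j x = 0.
Proof.
move=> gf oU Ux minx j.
have /nbhs_ballP[e /= e0 he] : nbhs x U by apply: open_nbhs_nbhs.
have [M M0 hM] := gf (`|x| + 1).
set c := g j x; apply/eqP; rewrite -[_ == 0]negbK; apply/negP => c0.
(* The three bounds keep the step inside the region where [M] is valid, inside [U], and make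
   [M * s < 1]. The divisor [1 + |c|] makes both [s] and [s * |c|] small. *)
pose s := Num.min (Num.min 1 (e / 2)) (2 * M + 2)^-1 / (1 + `|c|).
have d0 : 0 < Num.min (Num.min 1 (e / 2)) (2 * M + 2)^-1.
  by rewrite !lt_min ltr01 divr_gt0 //= invr_gt0; lra.
have c1 : 0 < 1 + `|c| by rewrite ltr_pwDl.
have s0 : 0 < s by rewrite divr_gt0.
have sc : s * `|c| < Num.min (Num.min 1 (e / 2)) (2 * M + 2)^-1.
  by rewrite /s mulrAC -mulrA gtr_pMr // ltr_pdivrMr // mul1r ltrDr.
have sM : s <= (2 * M + 2)^-1.
  apply: (@le_trans _ _ (Num.min (Num.min 1 (e / 2)) (2 * M + 2)^-1)).
    by rewrite /s ler_pdivrMr // ler_peMr ?(ltW d0) // lerDl.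
  by rewrite ge_min lexx orbT.
clearbody s; pose y := x - (s * c) *: delta_mx ord0 j.
have yx i : y ord0 i - x ord0 i = - (s * c) * (i == j)%:R.
  by rewrite !mxE /= addrAC subrr add0r mulNr.
have nyx : `|y - x| <= s * `|c|.
  apply: rV_norm_le => [|i]; first by rewrite mulr_ge0 // ltW.
  have -> : (y - x) ord0 i = y ord0 i - x ord0 i by rewrite !mxE.
  rewrite yx normrM normrN normrM (gtr0_norm s0) ler_piMr ?mulr_ge0 ?(ltW s0) //.
  by rewrite normr_nat lern1 leq_b1.
have /minx fy : U y.
  apply: he; rewrite -ball_normE /= distrC; apply: le_lt_trans nyx _.
  apply: lt_le_trans sc _; rewrite ge_min ge_min.
  by apply/orP; left; apply/orP; right; lra.
have xA : `|x| <= `|x| + 1 by lra.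
have yA : `|y| <= `|x| + 1.
  rewrite -[y](subrK x) addrC; apply: le_trans (ler_normD _ _) _; rewrite lerD2l.
  apply: le_trans nyx _; apply: ltW; apply: lt_le_trans sc _.
  by rewrite !ge_min lexx.
have := hM x y xA yA.
rewrite (bigD1 j) //= big1 ?addr0 => [|i ij]; last first.
  by rewrite yx (negPf ij) mulr0 mul0r.
rewrite yx eqxx mulr1 -/c mulNr opprK => /ler_normlP[_ hy].
have {}hy : s * c * c <= M * (s * `|c|) ^+ 2.
  apply: le_trans (_ : M * `|y - x| ^+ 2 <= _); last by rewrite ler_wpM2l // lerXn2r ?nnegrE ?mulr_ge0 ?(ltW s0).
  by apply: le_trans hy; rewrite lerDr subr_ge0.
have cc : 0 < c ^+ 2 by rewrite exprn_even_gt0.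
move: hy; rewrite -mulrA -expr2 exprMn real_normK ?num_real // [in leRHS]mulrA ler_pM2r //.
rewrite expr2 [leRHS]mulrA -[leLHS]mul1r ler_pM2r // leNgt => /negP; apply.
apply: le_lt_trans (_ : M * (2 * M + 2)^-1 < 1); first by rewrite ler_wpM2l.
by rewrite ltr_pdivrMr; lra.
Qed.

End Calculus.

Lemma choice2 T T' (P Q : T -> T' -> Prop) : (forall x, exists2 y, P x y & Q x y) ->
  exists f, (forall x, P x (f x)) /\ forall x, Q x (f x).
Proof.
move=> h; have /choice[f hf] : forall x, exists y, P x y /\ Q x y.
  by move=> x; have [y] := h x; exists y.
by exists f; split=> x; case: (hf x).
Qed.

(** * Counting pieces of a real algebraic set *)

Section Counting.
Variable R : realType.
Implicit Types (N D : nat).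

Lemma uniform_pos (I : finType) (P : I -> R -> Prop) :
  (forall i, exists2 d, 0 < d & forall d', 0 < d' <= d -> P i d') ->
  exists2 d, 0 < d & forall i, P i d.
Proof.
move=> /choice2 [d [d0 hd]].
have h0 : 0 < \big[Num.min/1]_i d i by apply/lt_bigmin.
exists (\big[Num.min/1]_i d i) => // i; apply: hd; rewrite h0 /=.
exact: bigmin_le_cond.
Qed.

Lemma closed_rV_le N A : closed [set x : 'rV[R]_N | `|x| <= A].
Proof.
rewrite (_ : [set x | _] = (fun x : 'rV[R]_N => `|x|) @^-1` [set r | r <= A]) //.
by apply: preimage_closed; [move=> ? _; exact: norm_continuous|exact: closed_le].
Qed.

Lemma open_rV_lt N A : open [set x : 'rV[R]_N | `|x| < A].
Proof.
rewrite (_ : [set x | _] = (fun x : 'rV[R]_N => `|x|) @^-1` [set r | r < A]) //.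
by apply: open_comp; [move=> ? _; exact: norm_continuous|exact: open_lt].
Qed.

Lemma compact_rV N A (C : set 'rV[R]_N) :
  closed C -> (forall x, C x -> `|x| <= A) -> compact C.
Proof.
move=> cC bC; apply: bounded_closed_compact => //.
exists A; split; first exact: num_real.
by move=> M AM x /bC xA; apply: le_trans xA (ltW AM).
Qed.

Lemma compact_min N (f : 'rV[R]_N -> R) (C : set 'rV[R]_N) :
  C !=set0 -> compact C -> continuous f ->
  exists2 c, C c & forall x, C x -> f c <= f x.
Proof.
move=> C0 cC cf; have [|c cC' hc] := compact_EVT_min C0 cC (f := f).
  exact: continuous_subspaceT.
by exists c; [exact: set_mem|move=> x Cx; apply: hc; exact: mem_set].
Qed.

Lemma compact_pos N (f : 'rV[R]_N -> R) (C : set 'rV[R]_N) :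
  compact C -> continuous f -> (forall x, C x -> 0 < f x) ->
  exists2 d, 0 < d & forall x, C x -> d <= f x.
Proof.
move=> cC cf fpos; have [C0|/set0P/negP/negPn/eqP ->] := pselect (C !=set0).
  by have [c Cc hc] := compact_min C0 cC cf; exists (f c) => //; apply: fpos.
by exists 1.
Qed.

(** The even exponent makes the added term nonnegative and coercive, and its derivative has degree
    above that of the gradient of [E], so the critical equations are rewriting rules. *)
Definition perturb N e (E : 'rV[R]_N -> R) eps (x : 'rV[R]_N) : R :=
  E x + eps * \sum_j x ord0 j ^+ (2 * e).+2.

Lemma perturb_continuous N e D (E : 'rV[R]_N -> R) eps : pf D E ->
  continuous (perturb e E eps).
Proof.
move=> pE.
have pS : pf ((2 * e).+2 * 1) (fun x : 'rV[R]_N => \sum_j x ord0 j ^+ (2 * e).+2).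
  by apply: pf_sum => j _; apply: (@pf_exp _ _ 1 (fun x => x ord0 j)); apply: pf_var.
apply: (@pf_continuous _ _ (D + (2 * e).+2 * 1)).
apply: pf_add; first exact: pf_le (leq_addr _ _) pE.
exact: pf_le (leq_addl _ _) (pf_scale eps pS).
Qed.

Lemma perturb_critical N e D (E : 'rV[R]_N -> R) g eps (U : set 'rV[R]_N) x :
  pf D E -> gradient E g -> open U -> U x ->
  (forall y, U y -> perturb e E eps x <= perturb e E eps y) ->
  forall j, g j x + eps * ((2 * e).+2%:R * x ord0 j ^+ (2 * e).+1) = 0.
Proof.
move=> pE gE oU Ux minx j.
have pS : pf ((2 * e).+2 * 1) (fun x : 'rV[R]_N => \sum_j x ord0 j ^+ (2 * e).+2).
  by apply: pf_sum => i _; apply: (@pf_exp _ _ 1 (fun x => x ord0 i)); apply: pf_var.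
have gS := gradient_scale eps pS (gradient_sum (fun i => @gradient_exp R N i (2 * e).+2)).
have := gradient_local_min (gradient_add gE gS) oU Ux minx j.
rewrite (bigD1 j) //= eqxx mul1r big1 ?addr0 // => i.
by rewrite eq_sym => /negPf ->; rewrite mul0r.
Qed.

Lemma sum_pow_le N k (x : 'rV[R]_N) A : `|x| <= A ->
  \sum_j x ord0 j ^+ k <= N%:R * A ^+ k.
Proof.
move=> xA; rewrite -[X in _ <= X%:R * _]card_ord mulr_natl -sumr_const.
apply: ler_sum => j _; apply: le_trans (ler_norm _) _; rewrite normrX lerXn2r ?nnegrE //.
  exact: le_trans xA.
exact: le_trans (rV_coord_le _ _) xA.
Qed.

(** The boundaries of the [U l] miss the zero set, so [E] is at least some [d > 0] there and on the
    sphere of radius [A + 1]. A perturbation smaller than [d] at the zero [w l] then has its minimum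
    over the closed piece at an interior, hence critical, point. *)
Lemma count_pieces N e (E : 'rV[R]_N -> R) A q (U : 'I_q -> set 'rV[R]_N) :
  pf e E -> (forall x, 0 <= E x) -> (forall x, E x = 0 -> `|x| <= A) ->
  (forall l, open (U l)) -> (forall l l' x, U l x -> U l' x -> l = l') ->
  (forall l, exists2 x, E x = 0 & U l x) ->
  (forall l x, E x = 0 -> closure (U l) x -> U l x) ->
  (q <= (2 * e).+1 ^ N)%N.
Proof.
move=> pE E0 EA oU dU /choice2[w [Ew Uw]] clU.
have cE := pf_continuous pE.
pose V l := U l `&` [set x | `|x| < A + 1].
have oV l : open (V l) by apply: openI; [exact: oU|exact: open_rV_lt].
pose C l := closure (U l) `&` [set x | `|x| <= A + 1].
have clC l : closed (C l).
  by apply: closedI; [exact: closed_closure|exact: closed_rV_le].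
have cC l : compact (C l) by apply: (@compact_rV _ (A + 1)) => // x [].
have VC l x : V l x -> C l x.
  by move=> [Ux xA]; split; [exact: subset_closure|exact: ltW].
have Vw l : V l (w l).
  by split; [exact: Uw|rewrite /= (le_lt_trans (EA _ (Ew l))) // ltrDl].
have [d d0 hd] : exists2 d, 0 < d & forall l x, C l x -> ~ V l x -> d <= E x.
  apply: (uniform_pos (P := fun l d => forall x, C l x -> ~ V l x -> d <= E x)) => l.
  have [||d d0 hd] := @compact_pos _ E (C l `&` ~` V l) _ cE.
  - apply: (@compact_rV _ (A + 1)) => [|x [[]]//].
    by apply: closedI => //; exact: open_closedC.
  - move=> x [[Ux xA] nV]; rewrite lt_def E0 andbT; apply/eqP => Ex0.
    apply: nV; split; first exact: clU.
    by rewrite /= (le_lt_trans (EA _ Ex0)) // ltrDl.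
  exists d => // d' /andP[_ d'd] x Cx nVx; apply: le_trans d'd _.
  by apply: hd.
pose S := N%:R * (`|A| + 1) ^+ (2 * e).+2.
have S0 : 0 <= S by rewrite mulr_ge0 // exprn_ge0 // addr_ge0.
(* [S] bounds the perturbing sum at each [w l]; this choice gives [eps * S < d]. *)
pose eps := d / (S + 1).
have S1 : 0 < S + 1 by rewrite ltr_pwDr.
have eps0 : 0 < eps by rewrite divr_gt0.
have epsS : eps * S < d by rewrite /eps mulrAC ltr_pdivrMr // ltr_pM2l // ltrDl.
pose F := perturb e E eps.
have cF : continuous F by exact: perturb_continuous pE.
have /choice[v hv] : forall l, exists v, V l v /\ forall y, V l y -> F v <= F y.
  move=> l; have [|v Cv minv] := compact_min _ (cC l) cF.
    by exists (w l); apply: VC.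
  exists v; split; last by move=> y /VC/minv.
  apply: contrapT => nV; have := hd l v Cv nV.
  rewrite leNgt => /negP; apply; apply: le_lt_trans (_ : F v < d).
    rewrite /F /perturb lerDl mulr_ge0 ?(ltW eps0) // sumr_ge0 // => j _.
    by rewrite exprn_even_ge0 //= negbK oddM.
  apply: le_lt_trans (minv _ (VC _ _ (Vw l))) _.
  rewrite /F /perturb Ew add0r; apply: le_lt_trans epsS.
  rewrite ler_wpM2l ?(ltW eps0) //; apply: sum_pow_le.
  by apply: le_trans (EA _ (Ew l)) _; apply: le_trans (ler_norm _) _; rewrite lerDl.
have [g gE pg] := pf_gradient pE.
pose X := [set x : 'rV[R]_N | forall j, g j x + eps * ((2 * e).+2%:R * x ord0 j ^+ (2 * e).+1) = 0].
pose h (j : 'I_N) (x : 'rV[R]_N) := - (eps * (2 * e).+2%:R)^-1 * g j x.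
have c0 : eps * (2 * e).+2%:R != 0 by rewrite mulf_neq0 ?gt_eqF // pnatr_eq0.
apply: (@card_common_zeros R N (2 * e) X h q v).
- by move=> j; apply: pf_scale; apply: pf_le (pg j); rewrite leq_pmull.
- move=> x j /(_ j) /eqP; rewrite addrC addr_eq0 mulrA => /eqP hx.
  by apply: (mulfI c0); rewrite hx /h mulNr mulrN mulVKf.
- move=> l l' vv; apply: (dU l l' (v l)); first by case: (hv l) => -[].
  by rewrite vv; case: (hv l') => -[].
- move=> l; have [Vv minv] := hv l; exact: perturb_critical pE gE (oV l) Vv minv.
Qed.

(** A qualitative form of the Łojasiewicz inequality, obtained from compactness; the perturbation
    will be chosen after [d]. *)
Lemma near_zero_set N D (E : 'rV[R]_N -> R) A eta : pf D E -> (forall x, 0 <= E x) ->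
  0 < eta -> exists2 d, 0 < d & forall v, `|v| <= A -> E v < d ->
    exists2 w, E w = 0 & `|v - w| < eta.
Proof.
move=> pE E0 eta0; have cE := pf_continuous pE.
pose O := \bigcup_(w in [set w | E w = 0]) [set v : 'rV[R]_N | `|v - w| < eta].
have oO : open O.
  apply: bigcup_open => w _.
  rewrite (_ : [set v | _] = ball w eta); first exact: ball_open.
  by apply/seteqP; split => v; rewrite -ball_normE /= distrC.
have [||d d0 hd] := @compact_pos _ E ([set x | `|x| <= A] `&` ~` O) _ cE.
- apply: (@compact_rV _ A) => [|x []//].
  by apply: closedI; [exact: closed_rV_le|exact: open_closedC].
- move=> x [xA nO]; rewrite lt_def E0 andbT; apply/eqP => Ex0.
  by apply: nO; exists x => //=; rewrite subrr normr0.
exists d => // v vA Evd; apply: contrapT => h.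
have := hd v; rewrite leNgt Evd => /(_ _)/negP; apply; split=> //.
Qed.

End Counting.

(** * Connected components *)

(* In a compact set, points linked by [eta]-chains for every [eta > 0] lie in the same
   component; unlike components, [eta]-chain classes keep a distance [eta]. *)
Inductive chain {R : realType} {N : nat} (A : set 'rV[R]_N) (eta : R) (x : 'rV[R]_N) :
    'rV[R]_N -> Prop :=
| chain0 : A x -> chain A eta x x
| chainS y z : chain A eta x y -> A z -> `|z - y| < eta -> chain A eta x z.

Section Components.
Variables (R : realType) (N : nat).
Implicit Types (A : set 'rV[R]_N).

Lemma chain_mem A eta x y : chain A eta x y -> A x /\ A y.
Proof. by elim=> // {}y z _ [Ax _] Az _. Qed.

Lemma chain_trans A eta x y z : chain A eta x y -> chain A eta y z -> chain A eta x z.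
Proof. by move=> xy; elim=> // {}z t _ xz At tz; exact: chainS xz At tz. Qed.

Lemma chain_sym A eta x y : chain A eta x y -> chain A eta y x.
Proof.
elim=> [Ax|{}y z xy yx Az zy]; first exact: chain0.
apply: chain_trans yx; have [_ Ay] := chain_mem xy.
by apply: chainS (chain0 _ Az) Ay _; rewrite distrC.
Qed.

Lemma chain_le A eta eta' x y : eta <= eta' -> chain A eta x y -> chain A eta' x y.
Proof.
move=> le; elim=> [Ax|{}y z _ xy Az zy]; first exact: chain0.
exact: chainS xy Az (lt_le_trans zy le).
Qed.

Lemma chain_exit A eta (V : set 'rV[R]_N) x z : V x -> chain A eta x z -> ~ V z ->
  exists y t, [/\ V y, ~ V t, chain A eta x t & `|t - y| < eta].
Proof.
move=> Vx; elim=> // {}z t xz IH At tz nVt.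
have [Vz|/IH//] := pselect (V z).
by exists z, t; split=> //; exact: chainS xz At tz.
Qed.

Lemma compact_uniform_nbhs (B C : set 'rV[R]_N) : compact B -> open C -> B `<=` C ->
  exists2 t, 0 < t & forall b x, B b -> `|b - x| < t -> C x.
Proof.
move=> /compact_near_coveringP cB oC BC.
have : \forall t \near (0:R)^'+, B `<=` [set b | ball b t `<=` C].
  apply: cB => b /BC Cb.
  have /nbhs_ballP[e /= e0 he] : nbhs b C by apply: open_nbhs_nbhs.
  exists (ball b (e / 2), [set t | t < e / 2]) => /=.
    split; first by apply: nbhsx_ballx; rewrite divr_gt0.
    by apply: nbhs_right_lt; rewrite divr_gt0.
  move=> [c t] /= [bc te] x cx; apply: he.
  rewrite [e]splitr; apply: ball_triangle bc _.
  exact: le_ball (ltW te) _ cx.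
move=> /(filterI (nbhs_right_gt 0)) /filter_ex [t [/= t0 ht]].
by exists t => // b x Bb bx; apply: (ht b Bb); rewrite -ball_normE.
Qed.

(** If a relatively clopen part [B] of the class were proper, a compact shell [S] around [B] would
    miss the class. By compactness one [e] excludes [e]-chains from [a] to any point of [S]; but a
    chain with short steps leaving [B] cannot jump over the shell. *)
Lemma connected_chain_class A a : compact A -> A a ->
  connected [set x | forall eta, 0 < eta -> chain A eta a x].
Proof.
move=> cA Aa; set Q := [set x | _].
have clA : closed A by apply: compact_closed => //; exact: norm_hausdorff.
have QA x : Q x -> A x by move=> Qx; case: (chain_mem (Qx 1 ltr01)).
have clQ : closed Q.
  move=> x clx eta eta0.
  have /clx [y [Qy]] : nbhs x (ball x eta) by exact: nbhsx_ballx.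
  rewrite -ball_normE /= => xy; apply: chainS (Qy _ eta0) _ xy.
  by apply: clA => U /clx [t [/QA At Ut]]; exists t.
move=> B [q1 Bq1] [C1 oC1 BC1] [C2 cC2 BC2].
apply: contrapT => BQ.
have [q2 Qq2 nBq2] : exists2 q, Q q & ~ B q.
  apply: contrapT => h; apply: BQ; apply/seteqP; split; first by rewrite BC1 => x [].
  by move=> x Qx; apply: contrapT => nBx; apply: h; exists x.
have cB : compact B.
  by rewrite BC2; apply: subclosed_compact cA _; [exact: closedI|move=> x [/QA]].
have [|t t0 ht] := compact_uniform_nbhs cB oC1; first by rewrite BC1 => x [].
pose V := [set x | exists2 b, B b & `|b - x| < t / 3].
have oV : open V.
  rewrite (_ : V = \bigcup_(b in B) ball b (t / 3)); last first.
    by apply/seteqP; split => x [b Bb bx]; exists b => //; move: bx; rewrite -ball_normE.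
  by apply: bigcup_open => b _; exact: ball_open.
(* The shell lies outside the [t / 3]-neighbourhood of [B] but still within [C1], where the only
   points of the class are those of [B]. It is wider than a step of size less than [t / 3]. *)
pose S := A `&` ~` V `&` closure [set x | exists2 b, B b & `|b - x| < t * 2 / 3].
have cS : compact S.
  apply: subclosed_compact cA _ => [|x [[]] //].
  by apply: closedI; [apply: closedI => //; exact: open_closedC|exact: closed_closure].
have SQ x : S x -> ~ Q x.
  move=> [[Ax nV] clx] Qx.
  have /clx [y [[b Bb by_]]] : nbhs x (ball x (t / 3)) by apply: nbhsx_ballx; rewrite divr_gt0.
  rewrite -ball_normE /= => xy.
  have C1x : C1 x.
    apply: (ht b) => //; rewrite -[b](subrK y) -addrA.
    apply: le_lt_trans (ler_normD _ _) _; rewrite (distrC y x).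
    have -> : t = t * 2 / 3 + t / 3 by field.
    exact: ltrD.
  apply: nV; exists x; first by rewrite BC1.
  by rewrite subrr normr0 divr_gt0.
have : \forall eta \near (0:R)^'+, S `<=` [set x | A x -> ~ chain A eta a x].
  apply: (compact_near_coveringP _).1 cS _ _ _ _ _ => x Sx.
  have [eta eta0 heta] : exists2 eta, 0 < eta & ~ chain A eta a x.
    apply: contrapT => h; apply: (SQ x Sx) => eta eta0; apply: contrapT => nch.
    by apply: h; exists eta.
  exists (ball x eta, [set e | e < eta]) => /=.
    by split; [exact: nbhsx_ballx|exact: nbhs_right_lt].
  move=> [y e] /= []; rewrite -ball_normE /= => xy ee Ay ch.
  apply: heta; apply: chainS (chain_le (ltW ee) ch) _ xy.
  by case: Sx => -[].
have t3 : 0 < t / 3 by rewrite divr_gt0.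
move=> /(filterI (nbhs_right_gt 0)) /(filterI (nbhs_right_lt t3)).
move=> /filter_ex [e [/= et [e0 he]]].
have Qq1 : Q q1 by move: Bq1; rewrite BC1 => -[].
have ch12 : chain A e q1 q2.
  apply: chain_trans (Qq2 e e0); apply: chain_sym.
  exact: Qq1.
have Vq1 : V q1 by exists q1 => //; rewrite subrr normr0.
have nVq2 : ~ V q2.
  move=> [b Bb bq]; apply: nBq2; rewrite BC1; split=> //; apply: (ht b) => //.
  by apply: lt_le_trans bq _; rewrite ler_pdivrMr // ler_peMr ?(ltW t0) // ler1n.
have [y [x [[b Bb bY] nVx chx xy]]] := chain_exit Vq1 ch12 nVq2.
have [_ Ax] := chain_mem chx.
apply: (he x) => //.
  split=> //; apply: subset_closure; exists b => //.
  rewrite -[b](subrK y) -addrA; apply: le_lt_trans (ler_normD _ _) _.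
  have -> : t * 2 / 3 = t / 3 + t / 3 by field.
  by rewrite ltrD // distrC (lt_trans xy).
apply: chain_trans chx.
exact: Qq1.
Qed.

(** A single [e] separates the finitely many chain classes, since points linked at every scale share
    a component. The [e / 2]-neighbourhoods of the [e]-chain classes are then disjoint, and a point
    of [A] in the closure of one is a single chain step away, so it already belongs to it. *)
Lemma separate_components A q (a : 'I_q -> 'rV[R]_N) : compact A ->
  (forall l, A (a l)) -> injective (fun l => connected_component A (a l)) ->
  exists O : 'I_q -> set 'rV[R]_N,
    [/\ forall l, open (O l), forall l l' x, O l x -> O l' x -> l = l',
        forall l, O l (a l) & forall l x, A x -> closure (O l) x -> O l x].
Proof.
move=> cA Aa inja.
have [e e0 he] : exists2 e, 0 < e &
    forall ll : 'I_q * 'I_q, ll.1 != ll.2 -> ~ chain A e (a ll.1) (a ll.2).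
  apply: (uniform_pos (P := fun ll e => ll.1 != ll.2 -> ~ chain A e (a ll.1) (a ll.2))).
  move=> [l l'] /=; case: (eqVneq l l') => [->|ll]; first by exists 1.
  have [e e0 he] : exists2 e, 0 < e & ~ chain A e (a l) (a l').
    apply: contrapT => h; move: ll => /eqP; apply; apply: inja.
    apply: same_connected_component.
    apply: (connected_component_max _ _ (connected_chain_class cA (Aa l))).
    - by move=> e _; exact: chain0.
    - by move=> x Qx; case: (chain_mem (Qx 1 ltr01)).
    - by move=> e e0; apply: contrapT => nch; apply: h; exists e.
  by exists e => // e' /andP[_ ee'] _ /(chain_le ee').
have e2 : 0 < e / 2 by rewrite divr_gt0.
exists (fun l => \bigcup_(b in [set b | chain A e (a l) b]) ball b (e / 2)); split.
- by move=> l; apply: bigcup_open => b _; exact: ball_open.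
- move=> l l' x [b ab bx] [b' ab' bx']; apply/eqP; apply: contrapT => /negP /(he (l, l')) /=.
  apply; apply: (chain_trans ab (chain_trans _ (chain_sym ab'))).
  have [_ Ab] := chain_mem ab; have [_ Ab'] := chain_mem ab'.
  apply: chainS (chain0 _ Ab) Ab' _.
  move: bx bx'; rewrite -ball_normE /= => bx b'x.
  rewrite -[b'](subrK x) -addrA [e]splitr; apply: le_lt_trans (ler_normD _ _) _.
  by rewrite ltrD // distrC.
- by move=> l; exists (a l); [exact: chain0|exact: ballxx].
- move=> l x Ax clx.
  have /clx [y [[b ab]]] : nbhs x (ball x (e / 2)) by exact: nbhsx_ballx.
  rewrite -!ball_normE /= => by_ xy.
  exists x; last by rewrite /= subrr normr0.
  apply: chainS ab Ax _.
  rewrite -[x](subrK y) -addrA [e]splitr; apply: le_lt_trans (ler_normD _ _) _.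
  by rewrite ltrD // distrC.
Qed.

End Components.

(** The open sets separating components of the image are pulled back by [phi]: the pieces of the
    zero set that are counted need not be connected, so components of the image are bounded
    directly. *)
Lemma b0_zero_set_image (R : realType) N M e (E : 'rV[R]_N -> R) A
    (phi : 'rV[R]_N -> 'rV[R]_M) :
  pf e E -> (forall x, 0 <= E x) -> (forall x, E x = 0 -> `|x| <= A) ->
  continuous phi ->
  (b0 (phi @` [set x | E x = 0%R]) <= (((2 * e).+1 ^ N)%:R)%:E)%E.
Proof.
move=> pE E0 EA cphi; apply: ge_ereal_sup => _ [q [-> [a [Aa inja]]]].
rewrite lee_fin ler_nat.
have clW : closed [set x | E x = 0].
  rewrite (_ : [set x | _] = E @^-1` [set r : R | r = 0]) //.
  apply: preimage_closed; first by move=> x _; exact: (pf_continuous pE).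
  exact: closed_eq.
have cphiW : compact (phi @` [set x | E x = 0]).
  apply: continuous_compact; first exact: continuous_subspaceT.
  exact: compact_rV clW EA.
have [Op [oO dO Oa clO]] := separate_components cphiW Aa inja.
apply: (@count_pieces R N e E A q (fun l => phi @^-1` Op l)) => //.
- by move=> l; apply: open_comp => // x _; exact: cphi.
- by move=> l l' x; exact: dO.
- by move=> l; have [x Ex phix] := Aa l; exists x => //=; rewrite phix.
- move=> l x Ex clx /=; apply: clO; first by exists x.
  by move=> B /cphi /clx [y [Oy By]]; exists (phi y).
Qed.

Lemma card_bigcup_le (I T : finType) (P : pred I) (F : I -> {set T}) :
  (#|\bigcup_(i | P i) F i| <= \sum_(i | P i) #|F i|)%N.
Proof.
elim/big_ind2: _ => [|p A q B Ap Bq|//]; first by rewrite cards0.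
exact: leq_trans (leq_card_setU A B).1 (leq_add Ap Bq).
Qed.

(** * Counting grid cells *)

(* A [hit] cell either isolates a piece of its slice, and is counted by [count_pieces],
   or the slice [touches] one of its faces, which is a cell of the next slice. *)
Section CellCount.
Variables (R : realType) (M n i K e : nat).
Variables (Q : 'rV[R]_M -> R) (y : 'I_n -> 'I_M) (grid : 'I_n -> nat -> R) (A : R).
Hypotheses (pQ : pf e Q) (e2 : (2 <= e)%N) (Q0 : forall w, 0 <= Q w).
Hypothesis QA : forall w, Q w = 0 -> `|w| <= A.
Hypothesis grid_mono : forall j a b, (a < b)%N -> grid j a < grid j b.
Local Notation cell := {ffun 'I_n -> 'I_K}.

Definition slice (J : {set 'I_n}) (k : cell) (w : 'rV[R]_M) :=
  Q w = 0 /\ forall j, j \in J -> w ord0 (y j) = grid j (k j).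

Definition in_cell (J : {set 'I_n}) (k : cell) (w : 'rV[R]_M) :=
  forall j, j \notin J -> grid j (k j) <= w ord0 (y j) <= grid j (k j).+1.

(** The range condition leaves room for the upper face of the cell, whose index [(k j).+1] must
    again be an index in ['I_K]. *)
Definition hit (J : {set 'I_n}) (k : cell) :=
  (forall j, j \notin J -> ((k j).+1 < K)%N) /\ exists2 w, slice J k w & in_cell J k w.

Definition hits J : {set cell} := [set k | `[< hit J k >]]%SET.

Definition touches (J : {set 'I_n}) (k : cell) :=
  exists w j, [/\ j \notin J, slice J k w, in_cell J k w &
    w ord0 (y j) = grid j (k j) \/ w ord0 (y j) = grid j (k j).+1].

Hypothesis slice_empty : forall (J : {set 'I_n}) k w, #|J| = i.+1 -> ~ slice J k w.

Let Kc := ((2 * e).+1 ^ M)%N.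

(** With the values on [J] fixed by [l], all these cells live in the zero set of one function [E].
    Since the slice avoids the faces of an untouched cell, the open cell isolates a piece of that
    zero set. Adding squares of linear forms keeps the degree because [2 <= e]. *)
Lemma card_isolated (J : {set 'I_n}) (l : cell) :
  (#|[set k in hits J | `[< ~ touches J k >] & [forall j in J, k j == l j]]%SET| <= Kc)%N.
Proof.
set S := [set k in _ | _]%SET.
pose E w := Q w + \sum_j (if j \in J then (w ord0 (y j) - grid j (l j)) ^+ 2 else 0).
have Esq (w : 'rV[R]_M) j : 0 <= (if j \in J then (w ord0 (y j) - grid j (l j)) ^+ 2 else 0).
  by case: ifP => // _; exact: sqr_ge0.
have S0 (w : 'rV[R]_M) : 0 <= \sum_j (if j \in J then (w ord0 (y j) - grid j (l j)) ^+ 2 else 0).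
  by apply: sumr_ge0.
have pE : pf e E.
  apply: pf_add => //; apply: pf_sum => j _; case: (j \in J); last exact: pf_cst.
  apply: (@pf_le _ _ (2 * 1)) => //.
  by apply: (@pf_exp _ _ 1 (fun x => x ord0 (y j) - _)); apply: pf_sub; [exact: pf_var|exact: pf_cst].
have E0 w : 0 <= E w by rewrite addr_ge0.
have slE k w : k \in S -> (E w = 0 <-> slice J k w).
  rewrite inE => /and3P[_ _ /forall_inP kl]; split.
    move=> /eqP; rewrite paddr_eq0 // => /andP[/eqP Qw].
    rewrite psumr_eq0 // => /allP hS; split=> // j jJ.
    have := hS j (mem_index_enum j); rewrite jJ /= sqrf_eq0 subr_eq0 => /eqP->.
    by rewrite (eqP (kl j jJ)).
  move=> [Qw hw]; rewrite /E Qw add0r big1 // => j _.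
  by case: ifP => // jJ; rewrite hw // (eqP (kl j jJ)) subrr expr0n.
have inS k w j : k \in S -> slice J k w -> in_cell J k w -> j \notin J ->
    grid j (k j) < w ord0 (y j) < grid j (k j).+1.
  rewrite inE => /and3P[_ /asboolP nt _] sl ic jJ; have /andP[h1 h2] := ic j jJ.
  rewrite !lt_def h1 h2 !andbT; apply/andP; split.
    by apply/eqP => h; apply: nt; exists w, j; split=> //; left.
  by apply/eqP => h; apply: nt; exists w, j; split=> //; right.
pose U (a : 'I_#|S|) := [set w : 'rV[R]_M | forall j, j \notin J ->
  grid j ((enum_val a : cell) j) < w ord0 (y j) < grid j ((enum_val a : cell) j).+1].
apply: (@count_pieces R M e E A #|S| U) => //.
- move=> w /eqP; rewrite paddr_eq0 // => /andP[/eqP Qw _]; exact: QA.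
- move=> a.
  rewrite openE => w Uw; rewrite /interior.
  have {}Uw : \forall z \near w, forall j, j \notin J ->
      grid j ((enum_val a : cell) j) < (z : 'rV[R]_M) ord0 (y j) < grid j ((enum_val a : cell) j).+1.
    apply: (@filter_forall _ _ (fun j (z : 'rV[R]_M) => j \notin J ->
      grid j ((enum_val a : cell) j) < z ord0 (y j) < grid j ((enum_val a : cell) j).+1)
      (nbhs w)) => j.
    case: (boolP (j \in J)) => jJ; first by near=> z.
    have /andP[w1 w2] := Uw j jJ.
    have o : open ((fun w : 'rV[R]_M => w ord0 (y j)) @^-1`
      [set` `]grid j ((enum_val a : cell) j), grid j ((enum_val a : cell) j).+1[]).
      by apply: open_comp; [move=> ? _; exact: coord_continuous|exact: itv_open].
    have : nbhs w ((fun w : 'rV[R]_M => w ord0 (y j)) @^-1`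
      [set` `]grid j ((enum_val a : cell) j), grid j ((enum_val a : cell) j).+1[]).
      by apply: open_nbhs_nbhs; split=> //; rewrite /= in_itv /= w1.
    by apply: filterS => z; rewrite /= in_itv.
  exact: Uw.
- move=> a b w Ua Ub; apply: enum_val_inj; apply/ffunP => j.
  have [jJ|jJ] := boolP (j \in J).
    have := enum_valP a; have := enum_valP b; rewrite !inE.
    move=> /and3P[_ _ /forall_inP /(_ j jJ) /eqP ->].
    by move=> /and3P[_ _ /forall_inP /(_ j jJ) /eqP ->].
  have /andP[a1 a2] := Ua j jJ; have /andP[b1 b2] := Ub j jJ.
  have mono_le p q : (p < q)%N -> grid j p.+1 <= grid j q.
    by rewrite -ltnS => pq; rewrite ltnS leq_eqVlt in pq; case/orP: pq => [/eqP <-|/(@grid_mono j)/ltW].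
  have [lt_ab|lt_ba|eq_ab] := ltngtP (nat_of_ord ((enum_val a : cell) j))
                                     (nat_of_ord ((enum_val b : cell) j)).
  - by have := lt_trans (lt_le_trans a2 (mono_le _ _ lt_ab)) b1; rewrite ltxx.
  - by have := lt_trans (lt_le_trans b2 (mono_le _ _ lt_ba)) a1; rewrite ltxx.
  - exact: val_inj.
- move=> a; have aS := enum_valP a.
  have : enum_val a \in hits J by move: aS; rewrite inE => /and3P[].
  rewrite inE => /asboolP[_ [w sl ic]]; exists w; first exact/(slE _ _ aS).
  by move=> j jJ; apply: inS.
- move=> a w /(slE _ _ (enum_valP a)) sl clw j jJ; apply: inS => //.
    exact: enum_valP.
  move=> {jJ}j jJ.
  have cl : closed ((fun w : 'rV[R]_M => w ord0 (y j)) @^-1`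
      [set` `[grid j ((enum_val a : cell) j), grid j ((enum_val a : cell) j).+1]]).
    by apply: preimage_closed; [move=> ? _; exact: coord_continuous|exact: itv_closed].
  have /closureS : U a `<=` (fun w : 'rV[R]_M => w ord0 (y j)) @^-1`
      [set` `[grid j ((enum_val a : cell) j), grid j ((enum_val a : cell) j).+1]].
    by move=> x /(_ j jJ) /andP[h1 h2]; rewrite /= in_itv /= !ltW.
  by rewrite -((closure_id _).1 cl) => /(_ w clw); rewrite /= in_itv.
Unshelve. all: by end_near. Qed.

Lemma card_untouched (J : {set 'I_n}) :
  (#|[set k in hits J | `[< ~ touches J k >]]%SET| <= Kc * K ^ #|J|)%N.
Proof.
set S := [set k in _ | _]%SET.
case: (posnP K) => [K0|K0].
  have [n0|n0] := posnP n.
    have J0 : #|J| = 0%N by apply: eq_card0 => -[j hj]; exfalso; rewrite n0 in hj.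
    rewrite J0 expn0 muln1.
    apply: leq_trans (max_card _) _; rewrite card_ffun !card_ord n0 expn0.
    by rewrite expn_gt0.
  have -> : #|S| = 0%N; last by [].
  apply: eq_card0 => k; exfalso.
  by case: (k (Ordinal n0)) => a; rewrite K0.
(* Resetting the coordinates outside [J] to index [0] groups the cells by their slice; there are at
   most [K ^ #|J|] slices. *)
pose r (k : cell) : cell := [ffun j => if j \in J then k j else Ordinal K0].
have rS : (#|r @: S| <= K ^ #|J|)%N.
  have -> : (K ^ #|J| = #|pffun_on (Ordinal K0) (mem J) (predT : pred 'I_K)|)%N.
    by rewrite card_pffun_on cardT size_enum_ord.
  apply: subset_leq_card; apply/fintype.subsetP => _ /imsetP [k _ ->].
  apply/pffun_onP; split=> //.
  apply/supportP => j jJ; by rewrite ffunE (negPf jJ).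
have -> : #|S| = (\sum_(l in r @: S) #|[set k in S | r k == l]%SET|)%N.
  rewrite -sum1_card (partition_big_imset r) /=.
  apply: eq_bigr => l _; rewrite -sum1_card; apply: eq_bigl => k.
  by rewrite inE.
apply: leq_trans (_ : (\sum_(l in r @: S) Kc <= _)%N); last first.
  by rewrite sum_nat_const mulnC leq_mul2l rS orbT.
apply: leq_sum => l _; apply: leq_trans (card_isolated J l).
apply: subset_leq_card; apply/fintype.subsetP => k; rewrite !inE.
move=> /andP[/andP[-> ->] /eqP <-] /=; apply/forall_inP => j jJ.
by rewrite ffunE jJ.
Qed.

(** A contact point on a face in direction [j] hits a cell of the slice [j |: J]: the same index for
    the lower face, the index raised by one at [j] for the upper face. Subtracting [b] at [j]
    recovers the touched cell, so each direction costs a factor of two. *)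
Lemma hits_subset (J : {set 'I_n}) :
  hits J \subset [set k in hits J | `[< ~ touches J k >]]%SET :|:
    \bigcup_(j | j \notin J) \bigcup_(b : bool)
      ((fun k : cell => ([ffun j' => if j' == j then insubd (k j) (k j - b)%N else k j'] : cell))
         @: hits (j |: J))%SET.
Proof.
apply/fintype.subsetP => k kJ; rewrite inE.
have [tch|ntch] := pselect (touches J k); last first.
  by apply/orP; left; rewrite inE kJ; apply/asboolP.
apply/orP; right.
move: kJ; rewrite inE => /asboolP[rng _].
have [w [j [jJ sl ic wj]]] := tch.
apply/bigcupP; exists j => //.
have cellP (k' : cell) : (forall j', j' != j -> k' j' = k j') ->
    w ord0 (y j) = grid j (k' j) -> k' \in hits (j |: J).
  move=> k'k wk'; rewrite inE; apply/asboolP; split.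
    move=> j'; rewrite !inE negb_or => /andP[j'j j'J].
    by rewrite k'k //; exact: rng.
  case: sl => Qw slw; exists w; [split=> //|] => j'; rewrite !inE.
    by case: eqVneq => [->//|j'j] /= j'J; rewrite slw // k'k.
  by rewrite negb_or => /andP[j'j j'J]; rewrite k'k //; exact: ic.
case: wj => wj.
  apply/bigcupP; exists false => //; apply/imsetP; exists k; first exact: cellP.
  apply/ffunP => j'; rewrite ffunE; case: eqP => // ->.
  by apply: val_inj; rewrite val_insubd subn0 ltn_ord.
apply/bigcupP; exists true => //; apply/imsetP.
exists ([ffun j' => if j' == j then Ordinal (rng j jJ) else k j'] : cell).
  by apply: cellP => [j' /negPf j'j|]; rewrite ffunE ?j'j // eqxx wj.
apply/ffunP => j'; rewrite !ffunE eqxx; case: eqP => // ->.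
by apply: val_inj; rewrite val_insubd /= subn1 /= (ltnW (rng j jJ)).
Qed.

(** The induction starts at [#|J| = i.+1], where slices are empty. Going down one level costs
    [2 * n] for the choice of a face and [K] for its position, which is the ratio of the geometric
    sum. *)
Lemma card_hits_rec (J : {set 'I_n}) m : (#|J| + m = i.+1)%N ->
  (#|hits J| <= Kc * K ^ #|J| * \sum_(a < m) (2 * n * K) ^ a)%N.
Proof.
elim: m J => [|m IH] J.
  rewrite addn0 => cJ; rewrite big_ord0 muln0 leqn0 cards_eq0; apply/eqP/setP => k.
  rewrite !inE; apply/negP => /asboolP[_ [w sl _]].
  exact: slice_empty cJ sl.
move=> cJ; apply: leq_trans (subset_leq_card (hits_subset J)) _.
apply: leq_trans (leq_card_setU _ _).1 _.
rewrite big_ord_recl expn0 mulnDr muln1; apply: leq_add; first exact: card_untouched.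
set B := (Kc * K ^ #|J|.+1 * \sum_(a < m) (2 * n * K) ^ a)%N.
have hB j : j \notin J -> (#|hits (j |: J)| <= B)%N.
  move=> jJ; have := IH (j |: J); rewrite cardsU1 jJ add1n; apply.
  by rewrite addSnnS.
apply: leq_trans (_ : n * (2 * B) <= _)%N.
  apply: leq_trans (card_bigcup_le _ _) _.
  apply: leq_trans (_ : \sum_(j | j \notin J) 2 * B <= _)%N; last first.
    rewrite sum_nat_const leq_mul2r; apply/orP; right.
    by apply: leq_trans (max_card _) _; rewrite card_ord.
  apply: leq_sum => j jJ; apply: leq_trans (card_bigcup_le _ _) _.
  rewrite big_bool /= mul2n -addnn; apply: leq_add;
    exact: leq_trans (leq_imset_card _ _) (hB j jJ).
rewrite /B expnS; under [in leqRHS]eq_bigr do rewrite lift0 expnS.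
rewrite -big_distrr /=; apply: eq_leq; ring.
Qed.

Lemma card_hits : (#|hits finset.set0| <= Kc * \sum_(a < i.+1) (2 * n * K) ^ a)%N.
Proof.
have := @card_hits_rec finset.set0 i.+1; rewrite cards0 expn0 muln1; exact.
Qed.

End CellCount.

Lemma leq_expn a b n : (a <= b)%N -> (a ^ n <= b ^ n)%N.
Proof. by move=> ab; elim: n => // n IH; rewrite !expnS leq_mul. Qed.

(** * Algebraic dependence and generic grids *)

Section Core.
Variable R : realType.

Lemma poly_small_nonroot (P : {poly R}) d : P != 0 -> 0 < d ->
  exists2 t, 0 < t < d & P.[t] != 0.
Proof.
move=> P0 d0; apply: contrapT => h.
pose u (a : nat) : R := d / a.+2%:R.
have u0 a : 0 < u a < d.
  by rewrite divr_gt0 //= ltr_pdivrMr // ltr_pMr // ltr1n.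
have inju : injective u.
  move=> a b /(mulfI (lt0r_neq0 d0)) /invr_inj /eqP.
  by rewrite eqr_nat => /eqP [].
have /(max_poly_roots P0) /= : all (root P) [seq u a | a <- iota 0 (size P)].
  apply/allP => _ /mapP [a _ ->]; apply/rootP/eqP; apply: contrapT => /negP ua.
  by apply: h; exists (u a).
by rewrite map_inj_uniq // iota_uniq size_map size_iota ltnn => /(_ isT).
Qed.

Lemma pf_line N D (f : 'rV[R]_N -> R) x w : pf D f ->
  exists P : {poly R}, forall t, f (x + t *: w) = P.[t].
Proof.
elim=> {D f}.
- by move=> D c; exists c%:P => t; rewrite hornerC.
- move=> D j; exists ((x ord0 j)%:P + (w ord0 j) *: 'X) => t.
  by rewrite !mxE hornerD hornerC hornerZ hornerX mulrC.
- move=> D f g _ [P hP] _ [Q hQ]; exists (P + Q) => t; by rewrite hornerD hP hQ.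
- move=> D E f g _ [P hP] _ [Q hQ]; exists (P * Q) => t; by rewrite hornerM hP hQ.
- by [].
Qed.

(** The functions are treated one at a time. On the line from the current [s] to a point where the
    next function is nonzero, all functions treated so far restrict to nonzero polynomials, so a
    small nonzero parameter avoids their roots. *)
Lemma avoid_zeros N (I : finType) (F : I -> 'rV[R]_N -> R) e :
  (forall l, exists D, pf D (F l)) -> (forall l, exists u, F l u != 0) -> 0 < e ->
  exists2 s, `|s| < e & forall l, F l s != 0.
Proof.
move=> pF nF e0.
suff [s se hs] : exists2 s, `|s| < e & forall l, l \in enum I -> F l s != 0.
  by exists s => // l; apply: hs; rewrite mem_enum.
elim: (enum I) => [|l r [s se hs]]; first by exists 0; rewrite ?normr0.
have [u Fu] := nF l.
have /choice[P hP] : forall l, exists P : {poly R}, forall t, F l (s + t *: (u - s)) = P.[t].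
  by move=> l'; have [D pD] := pF l'; apply: pf_line pD.
have P0 : \prod_(l' <- l :: r) P l' != 0.
  rewrite prodf_seq_neq0; apply/allP => l' /=; rewrite inE => /orP[/eqP->|/hs Fs].
    by apply: contraNneq Fu => Pl0; have := hP l 1; rewrite Pl0 horner0 scale1r addrC subrK => ->.
  apply: contraNneq Fs => Pl0; have := hP l' 0.
  by rewrite Pl0 horner0 scale0r addr0 => ->.
have us0 : 0 < `|u - s| + 1 by rewrite ltr_wpDl.
have d0 : 0 < (e - `|s|) / (`|u - s| + 1) by rewrite divr_gt0 // subr_gt0.
have [t /andP[t0 td] Pt] := poly_small_nonroot P0 d0.
exists (s + t *: (u - s)).
  apply: le_lt_trans (ler_normD _ _) _; rewrite normrZ gtr0_norm // -ltrBrDl.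
  apply: le_lt_trans (_ : t * (`|u - s| + 1) < _); first by rewrite ler_pM2l // lerDl.
  by rewrite -ltr_pdivlMr.
move=> l' l'r; rewrite hP; move: Pt; rewrite horner_prod prodf_seq_neq0 => /allP.
by move=> /(_ l' l'r).
Qed.

(** A dimension count: at degree [D] the reduced monomials number [O(D ^ i)], because only [i]
    variables are not reducible, while polynomials in [i.+1] variables have dimension of order
    [D ^ i.+1]. *)
Lemma algebraic_relation N i k (X : set 'rV[R]_(N + i)) (h : 'I_N -> 'rV[R]_(N + i) -> R)
    (c : 'I_i.+1 -> 'I_(N + i)) :
  (forall j, pf k (h j)) ->
  (forall x j, X x -> x ord0 (lshift i j) ^+ k.+1 = h j x) ->
  exists S : 'rV[R]_i.+1 -> R, [/\ exists D, pf D S, exists u, S u != 0 &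
    forall x, X x -> S (\row_a x ord0 (c a)) = 0].
Proof.
move=> pfh relX.
pose V := [pred j : 'I_(N + i) | (j < N)%N].
have cV : #|V| = N.
  rewrite -sum1_card big_split_ord /= [X in (_ + X)%N]big1; last first.
    by move=> j; rewrite inE /= ltnNge leq_addr.
  rewrite addn0 (eq_bigl predT) ?sum1_card ?card_ord // => j.
  by rewrite inE /= ltn_ord.
have cV' : #|predC V| = i.
  by have := cardC V; rewrite cV card_ord => /eqP; rewrite eqn_add2l => /eqP.
(* Chosen so that [s ^ i.+1] exceeds [k.+1 ^ N * (i.+2 * s) ^ i]. The [L g] are Lagrange products on
   the grid of side [s], so a combination with [C g != 0] is visibly nonzero at [node g]. *)
pose s := (k.+1 ^ N * i.+2 ^ i).+1.
pose node (g : {ffun 'I_i.+1 -> 'I_s}) : 'rV[R]_i.+1 := \row_a (g a : nat)%:R.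
pose L (g : {ffun 'I_i.+1 -> 'I_s}) (u : 'rV[R]_i.+1) : R :=
  \prod_a \prod_(b | b != g a) (u ord0 a - (b : nat)%:R).
have pL g : pf (i.+1 * s) (L g).
  apply: (@pf_le _ _ (\sum_(a < i.+1) s)); first by rewrite sum_nat_const card_ord.
  apply: pf_prod => a _.
  apply: (@pf_le _ _ (\sum_(b < s | b != g a) 1)).
    by rewrite sum1_card; apply: leq_trans (max_card _) _; rewrite card_ord.
  by apply: pf_prod => b _; apply: pf_sub; [exact: pf_var|exact: pf_cst].
have Lg g g' : (L g (node g') != 0) = (g == g').
  apply/idP/eqP => [|<-].
    rewrite prodf_seq_neq0 => /allP Lgg'; apply/ffunP => a.
    have := Lgg' a (mem_index_enum _); rewrite prodf_seq_neq0 => /allP /(_ (g' a) (mem_index_enum _)).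
    rewrite mxE subrr eqxx implybF => /negPn/eqP; by [].
  apply/prodf_neq0 => a _; apply/prodf_neq0 => b ba.
  by rewrite mxE subr_eq0 eqr_nat eq_sym.
pose phi (x : 'rV[R]_(N + i)) : 'rV[R]_i.+1 := \row_a x ord0 (c a).
have pLphi g : pf (i.+1 * s) (fun x => L g (phi x)).
  apply: pf_comp (pL g) => a; apply: eq_pf (pf_var 0 (c a)) => x.
  by rewrite mxE.
pose hV (j : 'I_(N + i)) : 'rV[R]_(N + i) -> R :=
  if insub (j : nat) is Some j' then h j' else fun=> 0.
have [|||C [[g Cg] hC]] := @linear_relation R (N + i) k (i.+1 * s) V X hV _ _ _ _ pLphi.
- move=> j Vj; rewrite /hV; case: insubP => [j' _ _|]; first exact: pfh.
  by move=> _; exact: pf_cst.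
- move=> x j Xx Vj; rewrite /hV; case: insubP => [j' _ jj'|]; last by rewrite (Vj : (j < N)%N).
  rewrite -relX //; congr (x ord0 _ ^+ _); exact/val_inj.
- rewrite cV cV' card_ffun !card_ord.
  apply: (@leq_ltn_trans (k.+1 ^ N * (i.+2 * s) ^ i)).
    rewrite leq_mul2l; apply/orP; right; apply: leq_expn.
    by rewrite /s; lia.
  rewrite expnMn mulnA expnS ltn_mul2r /s ltnSn andbT.
  by rewrite expn_gt0.
exists (fun u => \sum_g C g * L g u); split.
- by exists (i.+1 * s)%N; apply: pf_sum => g' _; apply: pf_scale.
- exists (node g); rewrite (bigD1 g) //= big1 ?addr0 => [|g' /negPf g'g].
    by rewrite mulf_neq0 // Lg.
  by apply/eqP; rewrite mulf_eq0; apply/orP; right; rewrite -[_ == 0]negbK Lg g'g.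
- by move=> x /hC.
Qed.

(* The last of the [N + i + 1] coordinates puts the points on a sphere, which makes the
   critical set compact. *)
Lemma core_count N i n e (H : 'rV[R]_(N + i) -> R) g eps (io : 'I_n -> 'I_N) eta A K :
  pf e H -> (forall j, pf e (g j)) -> 0 < eps -> injective io -> 0 < eta ->
  exists grid : 'I_n -> nat -> R,
    (forall j a, grid j a.+1 = grid j a + eta) /\
  exists cells : {set {ffun 'I_n -> 'I_(2 * K + 3)}},
    (#|cells| <= (16 * e + 9) ^ (N + i + 1) * \sum_(a < i.+1) (2 * n * (2 * K + 3)) ^ a)%N /\
    forall z : 'rV[R]_(N + i),
      (forall j : 'I_N, g (lshift i j) z +
         eps * ((2 * e).+2%:R * z ord0 (lshift i j) ^+ (2 * e).+1) = 0) ->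
      \sum_j z ord0 j ^+ 2 <= A ^+ 2 ->
      (forall j, `|z ord0 (lshift i (io j))| <= K%:R * eta) ->
      exists2 k, k \in cells & forall j,
        grid j (k j) <= z ord0 (lshift i (io j)) <= grid j (k j).+1.
Proof.
move=> pH pg eps0 inj_io eta0.
pose G (j : 'I_N) (z : 'rV[R]_(N + i)) := g (lshift i j) z +
   eps * ((2 * e).+2%:R * z ord0 (lshift i j) ^+ (2 * e).+1).
pose X := [set z | forall j, G j z = 0].
have pG j : pf (2 * e).+1 (G j).
  apply: pf_add; first by apply: pf_le (pg _); lia.
  do 2!apply: pf_scale; rewrite -[X in pf X]muln1.
  by apply: (@pf_exp _ _ 1 (fun z => z ord0 _)); exact: pf_var.
pose h (j : 'I_N) (z : 'rV[R]_(N + i)) := - (eps * (2 * e).+2%:R)^-1 * g (lshift i j) z.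
have c0 : eps * (2 * e).+2%:R != 0 by rewrite mulf_neq0 ?gt_eqF // pnatr_eq0.
have /choice[S hS] : forall c : {ffun 'I_i.+1 -> 'I_n}, exists S : 'rV[R]_i.+1 -> R,
    [/\ exists D, pf D S, exists u, S u != 0 &
     forall x, X x -> S (\row_a x ord0 (lshift i (io (c a)))) = 0].
  move=> c; apply: (@algebraic_relation N i (2 * e) X h) => [j|x j].
    by apply: pf_scale; apply: pf_le (pg _); lia.
  move=> /(_ j) /eqP; rewrite /G addrC addr_eq0 mulrA => /eqP hx.
  by apply: (mulfI c0); rewrite hx /h mulNr mulrN mulVKf.
(* Starting [K.+1] steps below zero, the [2 * K + 3] grid values still cover [[- K * eta, K * eta]]
   after a shift by less than [eta], with the index of the upper face in range. *)
pose off (a : nat) : R := eta * (a%:R - K.+1%:R).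
pose F (ck : {ffun 'I_i.+1 -> 'I_n} * {ffun 'I_i.+1 -> 'I_(2 * K + 3)}) (s : 'rV[R]_n) : R :=
  if injectiveb ck.1 then S ck.1 (\row_a (s ord0 (ck.1 a) + off (ck.2 a))) else 1.
have [||s se hs] := @avoid_zeros n _ F eta _ _ eta0.
- move=> [c k]; rewrite /F /=; case: injectiveb; last by exists 0%N; exact: pf_cst.
  have [[D pD] _ _] := hS c; exists D; apply: pf_comp pD => a.
  apply: eq_pf (pf_add (pf_var 0 (c a)) (pf_cst 1 (off (k a)))) => x.
  by rewrite mxE.
- move=> [c k]; rewrite /F /=; case: injectiveP => [injc|_]; last by exists 0; exact: oner_neq0.
  have [_ [u Su] _] := hS c.
  (* Injectivity of [c] allows the shift to be prescribed independently on the coordinates [c a], so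
     that the grid point becomes [u]. *)
  exists (\row_j (if [pick a | c a == j] is Some a then u ord0 a - off (k a) else 0)).
  rewrite (_ : (\row_a _) = u) //; apply/rowP => a; rewrite !mxE.
  case: pickP => [b /eqP/injc ->|/(_ a)]; last by rewrite eqxx.
  by rewrite subrK.
pose grid j a := s ord0 j + off a.
exists grid; split.
  by move=> j a; rewrite /grid /off -natr1; ring.
have grid_mono j a b : (a < b)%N -> grid j a < grid j b.
  by move=> ab; rewrite ltrD2l ltr_pM2l // ltrD2r ltr_nat.
pose M := (N + i + 1)%N.
pose Q (w : 'rV[R]_M) := \sum_j G j (lsubmx w) ^+ 2 + (\sum_j w ord0 j ^+ 2 - A ^+ 2) ^+ 2.
pose y j : 'I_M := lshift 1 (lshift i (io j)).
(* A common bound for the degree [2 * (2 * e).+1] of the squared critical equations and the degree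
   [4] of the squared sphere equation; [(2 * e').+1] is [16 * e + 9]. *)
pose e' := (4 * (2 * e).+1)%N.
have pQ : pf e' Q.
  apply: pf_add.
    apply: (@pf_le _ _ (2 * (2 * e).+1)); first by rewrite leq_mul2r orbT.
    apply: pf_sum => j _; apply: (@pf_exp _ _ _ (fun w => G j (lsubmx w))).
    apply: (pf_comp (phi := lsubmx)) (pG j) => j'.
    by apply: eq_pf (pf_var 0 (lshift 1 j')) => w; rewrite mxE.
  apply: (@pf_le _ _ (2 * (2 * 1))); first by rewrite /e'; lia.
  apply: (@pf_exp _ _ _ (fun w => \sum_j w ord0 j ^+ 2 - A ^+ 2)).
  apply: pf_sub; last exact: pf_cst.
  by apply: pf_sum => j _; apply: (@pf_exp _ _ _ (fun w => w ord0 j)); exact: pf_var.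
have sq0 (w : 'rV[R]_M) : 0 <= \sum_j G j (lsubmx w) ^+ 2.
  by apply: sumr_ge0 => j _; exact: sqr_ge0.
have Q0 w : 0 <= Q w by rewrite addr_ge0 // sqr_ge0.
have QP w : Q w = 0 -> X (lsubmx w) /\ \sum_j w ord0 j ^+ 2 = A ^+ 2.
  move=> /eqP; rewrite paddr_eq0 ?sqr_ge0 // => /andP[].
  rewrite psumr_eq0 => [/allP hG|j _]; last exact: sqr_ge0.
  rewrite sqrf_eq0 subr_eq0 => /eqP ->; split=> // j.
  by have := hG j (mem_index_enum _); rewrite sqrf_eq0 => /eqP.
have QA w : Q w = 0 -> `|w| <= `|A|.
  move=> /QP[_ wA]; apply: rV_norm_le => // j.
  rewrite -ler_sqr ?nnegrE // !real_normK ?num_real // -wA (bigD1 j) //=.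
  by rewrite lerDl; apply: sumr_ge0 => l _; exact: sqr_ge0.
have slice_empty (J : {set 'I_n}) (k : {ffun 'I_n -> 'I_(2 * K + 3)}) w :
    #|J| = i.+1 -> ~ slice Q y grid J k w.
  move=> cJ [/QP[Xw _] hw].
  (* The [i.+1] coordinates fixed by the slice satisfy the relation [S c], whereas the shift makes
     [S c] nonzero at every grid point. *)
  pose c := [ffun a : 'I_i.+1 => enum_val (cast_ord (esym cJ) a)] : {ffun 'I_i.+1 -> 'I_n}.
  have injc : injective c.
    by move=> a b; rewrite !ffunE => /enum_val_inj/cast_ord_inj.
  have cJa a : c a \in J by rewrite ffunE enum_valP.
  clearbody c; have := hs (c, [ffun a => k (c a)]); rewrite /F /=.
  have /injectiveP -> := injc; move=> /negP; apply; apply/eqP.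
  have [_ _ /(_ _ Xw)] := hS c; congr (S c _ = 0).
  by apply/rowP => a; rewrite !mxE ffunE; have := hw _ (cJa a); rewrite /y => ->.
have e2 : (2 <= e')%N by rewrite /e'; lia.
have := card_hits pQ e2 Q0 QA grid_mono slice_empty.
set cells := hits _ _ _ _ _ => ccells.
exists cells; split.
  by apply: leq_trans ccells _; rewrite (_ : (2 * e').+1 = (16 * e + 9)%N) // /e'; lia.
move=> z Gz zA yK.
pose w : 'rV[R]_M := row_mx z (const_mx (Num.sqrt (A ^+ 2 - \sum_j z ord0 j ^+ 2))).
have lw : lsubmx w = z by rewrite row_mxKl.
have Qw : Q w = 0.
  rewrite /Q lw big1 ?add0r => [|j _]; last by rewrite /G Gz expr0n.
  rewrite big_split_ord /=.
  under eq_bigr do rewrite row_mxEl.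
  rewrite big_ord1 row_mxEr mxE sqr_sqrtr ?subr_ge0 //.
  by rewrite addrC subrK subrr expr0n.
have wy j : w ord0 (y j) = z ord0 (lshift i (io j)) by rewrite row_mxEl.
have /choice[k hk] : forall j, exists a : 'I_(2 * K + 3),
    (a.+1 < 2 * K + 3)%N /\ grid j a <= z ord0 (lshift i (io j)) <= grid j a.+1.
  move=> j; set x := z ord0 _.
  pose u := (x - s ord0 j) / eta + K.+1%:R.
  have sj : `|s ord0 j| < eta by exact: le_lt_trans (rV_coord_le _ _) se.
  have xK := yK j; rewrite -/x in xK.
  have /ltr_normlP [s1 s2] := sj; have /ler_normlP [x1 x2] := xK.
  have ux : x = s ord0 j + eta * (u - K.+1%:R).
    by rewrite /u addrK mulrC divfK ?gt_eqF // addrC subrK.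
  have u0 : 0 <= u.
    rewrite -(pmulr_rge0 _ eta0) /u mulrDr mulrCA divff ?gt_eqF // mulr1 -natr1.
    by rewrite mulrDr mulr1; lra.
  have u1 : u < (2 * K + 2)%:R.
    rewrite -(ltr_pM2l eta0) /u mulrDr mulrCA divff ?gt_eqF // mulr1 -natr1.
    by rewrite natrD natrM !mulrDr mulr1; lra.
  have /andP[t1 t2] := truncn_itv u0.
  have tK : (Num.truncn u < 2 * K + 2)%N by rewrite -(ltr_nat R); exact: le_lt_trans u1.
  have tK' : (Num.truncn u < 2 * K + 3)%N by apply: leq_trans tK _; rewrite leq_add2l.
  exists (Ordinal tK'); split; first by rewrite /= addnS ltnS.
  by rewrite ux /grid /off !lerD2l !ler_pM2l // !lerD2r t1 ltW.
exists [ffun j => k j]; last by move=> j; rewrite ffunE; case: (hk j).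
rewrite inE; apply/asboolP; split=> [j _|]; first by rewrite ffunE; case: (hk j).
exists w; first by split=> // j; rewrite inE.
by move=> j _; rewrite ffunE wy; case: (hk j).
Qed.

End Core.

(** * Frames adapted to a spectrum *)

Section Spectral.
Variable R : realType.

Definition dot m (u v : 'rV[R]_m) : R := \sum_j u ord0 j * v ord0 j.

Lemma mul_trE m (u v : 'rV[R]_m) : u *m v^T = (dot u v)%:M.
Proof.
by apply/matrixP => a b; rewrite !ord1 !mxE eqxx mulr1n; apply: eq_bigr => j _; rewrite mxE.
Qed.

Lemma dotE m (u v : 'rV[R]_m) : dot u v = (u *m v^T) ord0 ord0.
Proof. by rewrite mul_trE mxE eqxx. Qed.

Lemma dot_eq0 m (u : 'rV[R]_m) : (dot u u == 0) = (u == 0).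
Proof.
apply/eqP/eqP => [/eqP|->]; last by rewrite /dot big1 // => j _; rewrite mxE mul0r.
rewrite psumr_eq0 => [/allP h|j _]; last by rewrite -expr2 sqr_ge0.
apply/rowP => j; have := h j (mem_index_enum _); rewrite -expr2 sqrf_eq0 mxE.
by move=> /eqP.
Qed.

Lemma dot_ge0 m (u : 'rV[R]_m) : 0 <= dot u u.
Proof. by apply: sumr_ge0 => j _; rewrite -expr2 sqr_ge0. Qed.

Lemma unit_vector m (u : 'rV[R]_m) : u != 0 -> exists2 c, c != 0 & dot (c *: u) (c *: u) = 1.
Proof.
move=> u0; have d0 : 0 < dot u u by rewrite lt_def dot_eq0 u0 dot_ge0.
exists (Num.sqrt (dot u u))^-1; first by rewrite invr_eq0 gt_eqF // sqrtr_gt0.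
have -> (c : R) : dot (c *: u) (c *: u) = c ^+ 2 * dot u u.
  by rewrite /dot mulr_sumr; apply: eq_bigr => j _; rewrite !mxE; ring.
rewrite exprVn.
by rewrite sqr_sqrtr ?dot_ge0 // mulVf ?gt_eqF.
Qed.

(** The reflection exchanging [v] with the first basis vector; it completes a unit eigenvector to an
    orthogonal matrix. *)
Lemma householder m (v : 'rV[R]_(1 + m)) : dot v v = 1 ->
  exists2 Q : 'M[R]_(1 + m), Q *m Q^T = 1%:M & row ord0 Q = v.
Proof.
move=> v1; set e := delta_mx ord0 ord0 : 'rV[R]_(1 + m).
have [->|ve] := eqVneq v e.
  by exists 1%:M; [rewrite trmx1 mulmx1|rewrite row1].
set w := e - v; have w0 : w != 0 by rewrite subr_eq0 eq_sym.
have ew (u : 'rV[R]_(1 + m)) : dot e u = u ord0 ord0.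
  rewrite /dot (bigD1 ord0) //= mxE !eqxx mul1r big1 ?addr0 // => j /negPf j0.
  by rewrite mxE j0 andbF mul0r.
have ww : dot w w = 2 * (1 - v ord0 ord0).
  have -> : dot w w = dot e e - dot e v - dot e v + dot v v.
    rewrite /dot -!sumrB -big_split /=; apply: eq_bigr => j _.
    have -> : w ord0 j = e ord0 j - v ord0 j by rewrite !mxE.
    by ring.
  have e00 : e ord0 ord0 = 1 by rewrite mxE !eqxx.
  by rewrite !ew v1 e00; ring.
have ww0 : dot w w != 0 by rewrite dot_eq0.
set c := 2 / dot w w.
exists (1%:M - c *: (w^T *m w)).
  set T := w^T *m w.
  have TT : T^T = T by rewrite /T trmx_mul trmxK.
  have T2 : T *m T = dot w w *: T.
    by rewrite /T mulmxA -[w^T *m w *m w^T]mulmxA mul_trE mul_mx_scalar scalemxAl.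
  clearbody T; have -> : (1%:M - c *: T)^T = 1%:M - c *: T.
    by apply/matrixP => a b; rewrite -[in RHS]TT !mxE eq_sym.
  rewrite mulmxBl mul1mx mulmxBr mulmx1 -scalemxAr -scalemxAl T2 !scalerA.
  have -> : c * c * dot w w = 2 * c by rewrite -mulrA {2}/c divfK // mulrC.
  by rewrite -addrA -opprD -scalerBl -scalerDl (_ : c + (c - 2 * c) = 0) ?scale0r ?subr0 //; ring.
rewrite rowE mulmxBr mulmx1 -scalemxAr mulmxA mul_trE mul_scalar_mx scalerA.
rewrite -/e ew (_ : c * _ = 1); first by rewrite scale1r /w opprB addrC subrK.
have -> : w ord0 ord0 = 1 - v ord0 ord0 by rewrite !mxE !eqxx.
rewrite /c ww; field; move: ww0; rewrite ww mulf_eq0 negb_or => /andP[_]; exact.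
Qed.

Lemma char_poly_conj m (Q M : 'M[R]_m) : Q *m Q^T = 1%:M ->
  char_poly (Q *m M *m Q^T) = char_poly M.
Proof.
move=> QQ; have dQ : \det (map_mx (@polyC R) Q) * \det (map_mx (@polyC R) Q^T) = 1.
  by rewrite -det_mulmx -map_mxM QQ map_mx1 det1.
rewrite /char_poly -[RHS]mulr1 -dQ mulrCA -!det_mulmx; congr (\det _).
rewrite /char_poly_mx !map_mxM mulmxBl mulmxBr !mulmxA; congr (_ - _).
by rewrite mul_mx_scalar -scalemxAl -map_mxM QQ map_mx1 scalemx1.
Qed.

(** The real roots come with the hypothesis. A unit eigenvector for the first one becomes the first
    row of an orthogonal matrix, symmetry clears the first row and column, and the recursion keeps
    the order of [s] on the diagonal. *)
Lemma symmetric_diagonalization m (M : 'M[R]_m) (s : seq R) : M^T = M ->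
  char_poly M = \prod_(x <- s) ('X - x%:P) ->
  exists2 U : 'M[R]_m, U *m U^T = 1%:M &
    U *m M *m U^T = diag_mx (\row_(k < m) s`_k).
Proof.
elim: m M s => [|m IH] M s Msym cM.
  by exists 1%:M; apply/matrixP => -[].
case: s cM => [|x s] cM.
  by have := size_char_poly M; rewrite cM big_nil size_poly1.
have : eigenvalue M x by rewrite eigenvalue_root_char cM big_cons rootM root_XsubC eqxx.
move=> /eigenvalueP [v0 v0M /unit_vector[c c0 v1]].
set v : 'rV[R]_(1 + m) := c *: v0 in v1.
have vM : v *m M = x *: v by rewrite /v -scalemxAl v0M scalerA mulrC -scalerA.
have [Q QQ Qv] := householder v1.
have [N NQ] : exists N : 'M[R]_(1 + m), N = Q *m M *m Q^T by exists (Q *m M *m Q^T).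
have Nsym : N^T = N by rewrite NQ !trmx_mul trmxK Msym mulmxA.
have N0 : row ord0 N = x *: delta_mx ord0 ord0.
  by rewrite NQ -mulmxA row_mul Qv mulmxA vM -scalemxAl -Qv -row_mul QQ row1.
have N0j j : N ord0 j = x *+ (j == ord0).
  have /rowP/(_ j) := N0; rewrite !mxE eqxx /= => ->.
  by rewrite mulr_natr.
have l0 : lshift m (ord0 : 'I_1) = ord0 :> 'I_(1 + m) by exact: val_inj.
have NE : N = block_mx x%:M 0 0 (drsubmx N).
  rewrite -[LHS](submxK N); congr block_mx; apply/matrixP => a b; rewrite !ord1 ?mxE.
  - by rewrite !l0 N0j.
  - by rewrite l0 N0j.
  - by rewrite -Nsym mxE l0 N0j.
set N' := drsubmx N in NE.
have N'sym : N'^T = N' by rewrite /N' trmx_drsub Nsym.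
have cb : @char_poly R (1 + m) (block_mx x%:M 0 0 N') = ('X - x%:P) * char_poly N'.
  rewrite /char_poly /char_poly_mx map_block_mx scalar_mx_block opp_block_mx add_block_mx.
  rewrite !map_mx0 !oppr0 !addr0 det_lblock; congr (_ * _).
  by rewrite det_mx11 !mxE eqxx !mulr1n.
have cN' : char_poly N' = \prod_(x <- s) ('X - x%:P).
  apply: (mulfI (negbT (polyXsubC_eq0 x))).
  rewrite -cb -NE NQ; move: cM; rewrite big_cons => <-; exact: char_poly_conj.
have [U UU UD] := IH _ _ N'sym cN'.
pose B : 'M[R]_(1 + m) := block_mx 1%:M 0 0 U.
have BT : B^T = block_mx 1%:M 0 0 U^T by rewrite tr_block_mx trmx1 !trmx0.
have BB : B *m B^T = 1%:M.
  by rewrite BT mulmx_block !mul0mx !mulmx0 !mulmx1 !addr0 !add0r UU -scalar_mx_block.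
have BNB : B *m N *m B^T = block_mx x%:M 0 0 (diag_mx (\row_k s`_k)).
  rewrite BT NE !mulmx_block !mul0mx !mulmx0 !mulmx1 !mul1mx !addr0 !add0r !mul0mx.
  by rewrite UD.
exists (B *m Q).
  by rewrite trmx_mul mulmxA -[B *m Q *m Q^T]mulmxA QQ mulmx1.
have -> : B *m Q *m M *m (B *m Q)^T = B *m N *m B^T by rewrite NQ trmx_mul !mulmxA.
rewrite BNB; apply/matrixP => a b.
rewrite !mxE -val_eqE /=; case: splitP => a' ea; rewrite !mxE; case: splitP => b' eb;
  rewrite !mxE ?ord1 ea eb ?ord1 //=.
Qed.

Lemma dotC m (u v : 'rV[R]_m) : dot u v = dot v u.
Proof. by apply: eq_bigr => j _; rewrite mulrC. Qed.

(** A space of dimension [j.+1] meets the orthogonal complement of the first [j] rows of [U]. The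
    last vector is chosen first, from this intersection; the others are found in its orthogonal
    complement inside [B]. *)
Lemma adapted_frame m (U : 'M[R]_m) j q (B : 'M[R]_(q, m)) : (j <= \rank B)%N ->
  exists W : nat -> 'rV[R]_m,
    [/\ forall a b, (a < j)%N -> (b < j)%N -> dot (W a) (W b) = (a == b)%:R,
        forall a, (a < j)%N -> (W a <= B)%MS &
        forall a (k : 'I_m), (a < j)%N -> (k < a)%N -> (W a *m U^T) ord0 k = 0].
Proof.
elim: j q B => [|j IH] q B jB; first by exists (fun=> 0).
have jm : (j <= m)%N by apply: leq_trans (leq_trans (leqnSn j) jB) (rank_leq_col B).
pose D : 'M[R]_(m, j) := \matrix_(r, k) U^T r (widen_ord jm k).
have /rowV0Pn[v0] : (B :&: kermx D)%MS != 0.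
  rewrite -mxrank_eq0 -lt0n -(ltn_add2l (\rank (B *m D))) mxrank_mul_ker addn0.
  exact: leq_ltn_trans (rank_leq_col _) jB.
rewrite sub_capmx => /andP[v0B /sub_kermxP v0D] /unit_vector[c c0].
set w := c *: v0 => w1.
have wB : (w <= B)%MS by rewrite scalemx_sub.
have wU (k : 'I_m) : (k < j)%N -> (w *m U^T) ord0 k = 0.
  move=> kj; have /matrixP/(_ ord0 (Ordinal kj)) := v0D; rewrite !mxE => E.
  rewrite -[RHS](mulr0 c) -[in RHS]E mulr_sumr; apply: eq_bigr => l _.
  rewrite !mxE mulrA; congr (_ * U _ _); exact/val_inj.
have [|W [Wo WB WU]] := IH _ (B :&: kermx w^T)%MS.
  rewrite -(leq_add2l (\rank (B *m w^T))) mxrank_mul_ker.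
  by apply: leq_trans jB; apply: (@leq_add _ _ 1 j) => //; exact: rank_leq_col.
have Ww a : (a < j)%N -> dot (W a) w = 0.
  move=> /WB; rewrite sub_capmx => /andP[_ /sub_kermxP].
  by rewrite mul_trE => /matrixP/(_ ord0 ord0); rewrite !mxE eqxx.
exists (fun a => if a == j then w else W a); split.
- move=> a b; rewrite !ltnS => aj bj.
  have [aj'|naj] := boolP (a == j); have [bj'|nbj] := boolP (b == j).
  + by rewrite (eqP aj') (eqP bj') eqxx.
  + by rewrite (eqP aj') dotC Ww 1?eq_sym ?(negPf nbj) // ltn_neqAle nbj.
  + by rewrite (eqP bj') Ww ?(negPf naj) // ltn_neqAle naj.
  + by rewrite Wo // ltn_neqAle ?naj ?nbj.
- move=> a; rewrite ltnS => aj; case: (eqVneq a j) => // naj.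
  have := WB a; rewrite ltn_neqAle naj aj => /(_ isT).
  by rewrite sub_capmx => /andP[].
- move=> a k; rewrite ltnS => aj; case: (eqVneq a j) => [->|naj] ka; first exact: wU.
  by apply: WU => //; rewrite ltn_neqAle naj.
Qed.

(** A simultaneous form of the Courant-Fischer principle: [W a] has no component on the first [a]
    eigenvectors, so its Rayleigh quotient is at most the eigenvalue of index [a]. This is where
    exactly the [i] largest singular values enter for an [i]-plane. *)
Lemma spectral_frame m i (M P : 'M[R]_m) (s : m.-tuple R) : M^T = M ->
  sorted_spectrum M s -> grass_proj i P ->
  exists W : nat -> 'rV[R]_m,
    [/\ forall a b, (a < i)%N -> (b < i)%N -> dot (W a) (W b) = (a == b)%:R,
        forall a, (a < i)%N -> W a *m P = W a &
        forall a : 'I_m, (a < i)%N -> dot (W a *m M) (W a) <= tnth s a].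
Proof.
move=> Msym [ss cM] [Psym [PP rP]].
have [U UU UMU] := symmetric_diagonalization Msym cM.
have [|W [Wo WP WU]] := @adapted_frame m U i m P; first by rewrite rP.
exists W; split=> //.
  by move=> a /WP /submxP[C ->]; rewrite -mulmxA PP.
move=> a ai; pose c := W a *m U^T.
have UtU : U^T *m U = 1%:M by exact: mulmx1C.
have Wc : W a = c *m U by rewrite /c -mulmxA UtU mulmx1.
have cc : dot c c = 1.
  rewrite dotE /c trmx_mul trmxK mulmxA -[W a *m U^T *m U]mulmxA UtU mulmx1.
  by rewrite -dotE Wo // eqxx.
have -> : dot (W a *m M) (W a) = \sum_(k < m) s`_k * c ord0 k ^+ 2.
  rewrite dotE {1}Wc {1}Wc trmx_mul !mulmxA.
  rewrite -[c *m U *m M *m U^T]mulmxA -[c *m U *m (M *m U^T)]mulmxA [U *m (M *m U^T)]mulmxA UMU.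
  rewrite mul_mx_diag mxE; apply: eq_bigr => k _; rewrite !mxE; ring.
rewrite -[leRHS]mulr1 -cc /dot mulr_sumr; apply: ler_sum => k _.
rewrite -expr2; have [ka|ak] := ltnP k a.
  by rewrite (WU a k ai ka) expr0n /= !mulr0.
rewrite ler_wpM2r ?sqr_ge0 // (tnth_nth 0).
have sge : transitive (>=%R : rel R) by move=> x y z /= yx xz; exact: le_trans yx.
have := sorted_leq_nth sge (@lexx _ R) 0 ss; apply; rewrite ?inE ?size_tuple //.
Qed.

End Spectral.

(** * Sublevel sets of singular values as projections of algebraic sets *)

Section Lift.
Variable R : realType.

Lemma poly_fun_deg_pf n d (f : 'rV[R]_n -> R) : poly_fun_deg d f -> pf d f.
Proof.
move=> [c [cd fE]].
have := @pf_sum R n d _ (index_enum _) predT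
  (fun (a : {ffun 'I_n -> 'I_d.+1}) x => c a * \prod_(j < n) x ord0 j ^+ a j).
move=> h; apply: eq_pf (h _) => [x|a _]; first by rewrite fE.
have [da|ad] := ltnP d (\sum_(j < n) a j).
  by apply: eq_pf (pf_cst d 0) => x; rewrite cd // mul0r.
by apply: pf_scale; apply: pf_le ad _; exact: (@pf_mon R n (fun j => a j)).
Qed.

(* [Defs.jacobian] and [Defs.edist] are qualified since the library has homonyms. *)
Lemma jacobian_gradient n m (p : 'rV[R]_n -> 'rV[R]_m) g :
  (forall k, gradient (fun x => p x ord0 k) (g k)) ->
  forall x, Defs.jacobian p x = \matrix_(k, j) g k j x.
Proof.
move=> pg x; apply/matrixP => k j; rewrite !mxE.
have -> : 'D_(delta_mx ord0 j) p x = \row_k g k j x; last by rewrite mxE.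
apply: cvg_lim; first exact: norm_hausdorff.
have /choice2[M [M0 hM]] : forall k, exists2 M, 0 <= M & forall x' y, `|x'| <= `|x| + 1 ->
    `|y| <= `|x| + 1 -> `|p y ord0 k - p x' ord0 k -
       \sum_j (y ord0 j - x' ord0 j) * g k j x'| <= M * `|y - x'| ^+ 2.
  by move=> k'; exact: pg.
pose K := \sum_k M k.
have K0 : 0 <= K by apply: sumr_ge0.
apply/cvgrPdist_lt => e e0.
have d0 : 0 < Num.min 1 (e / (K + 1)) by rewrite lt_min ltr01 divr_gt0 // ltr_wpDl.
near=> h.
have h0 : h != 0 by near: h; exact: nbhs_dnbhs_neq.
have hd : `|h| < Num.min 1 (e / (K + 1)) by near: h; exact: dnbhs0_lt.
have /andP[h1 he] : (`|h| < 1) && (`|h| < e / (K + 1)) by rewrite -lt_min.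
have K1 : 0 < K + 1 by rewrite ltr_wpDl.
apply: rV_norm_lt => // l.
pose y := h *: delta_mx ord0 j + x.
have yx : y - x = h *: delta_mx ord0 j by rewrite /y addrK.
have nyx : `|y - x| <= `|h|.
  rewrite yx; apply: rV_norm_le => // a; rewrite !mxE normrM ler_piMr //.
  by rewrite normr_nat lern1 leq_b1.
have xA : `|x| <= `|x| + 1 by rewrite lerDl.
have yA : `|y| <= `|x| + 1.
  rewrite -[y](subrK x) addrC; apply: le_trans (ler_normD _ _) _.
  by rewrite lerD2l (le_trans nyx) // ltW.
have := hM l x y xA yA; rewrite (bigD1 j) //= big1 ?addr0 => [|a /negPf aj]; last first.
  by rewrite /y !mxE aj andbF mulr0 add0r subrr mul0r.
have -> : y ord0 j - x ord0 j = h by rewrite /y !mxE !eqxx mulr1 addrK.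
move=> H; rewrite !mxE -/y.
have -> : g l j x - h^-1 * (p y ord0 l - p x ord0 l) =
  - (h^-1 * (p y ord0 l - p x ord0 l - h * g l j x)) by field.
rewrite normrN normrM normfV ltr_pdivrMl ?normr_gt0 //.
apply: le_lt_trans H _; apply: (@le_lt_trans _ _ (K * `|h| ^+ 2)).
  apply: ler_pM => //; last by rewrite lerXn2r ?nnegrE.
  by rewrite /K (bigD1 l) //= lerDl; apply: sumr_ge0.
rewrite expr2 mulrA [ltLHS]mulrC ltr_pM2l ?normr_gt0 //.
apply: le_lt_trans (_ : (K + 1) * `|h| < e); first by rewrite ler_wpM2r // lerDl.
by rewrite -ltr_pdivlMl // mulrC.
Unshelve. all: by end_near. Qed.

Definition pf_coefs N D (P : 'rV[R]_N -> {poly R}) := forall l, pf D (fun v => (P v)`_l).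

Lemma pf_coefs_mul N D E (P Q : 'rV[R]_N -> {poly R}) :
  pf_coefs D P -> pf_coefs E Q -> pf_coefs (D + E) (fun v => P v * Q v).
Proof.
move=> hP hQ l; apply: eq_pf (pf_sum (F := fun (a : 'I_l.+1) v => (P v)`_a * (Q v)`_(l - a)) _ _).
  by move=> v; rewrite coefM.
by move=> a _; apply: pf_mul; [exact: hP|exact: hQ].
Qed.

Lemma pf_coefs_sum N D (I : Type) (s : seq I) (F : I -> 'rV[R]_N -> {poly R}) :
  (forall i, pf_coefs D (F i)) -> pf_coefs D (fun v => \sum_(i <- s) F i v).
Proof.
move=> hF l; apply: eq_pf (pf_sum (F := fun i v => (F i v)`_l) s (P := predT) _).
  by move=> v; rewrite coef_sum.
by move=> i _; exact: hF.
Qed.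

Lemma pf_coefs_cst N D (c : {poly R}) : pf_coefs D (fun _ : 'rV[R]_N => c).
Proof. by move=> l; exact: pf_cst. Qed.

Lemma pf_coefs_prod N D (I : Type) (s : seq I) (F : I -> 'rV[R]_N -> {poly R}) :
  (forall i, pf_coefs D (F i)) -> pf_coefs (size s * D) (fun v => \prod_(i <- s) F i v).
Proof.
move=> hF; elim: s => [|i s IH].
  move=> l; apply: eq_pf (pf_cst _ (1 : {poly R})`_l) => v; by rewrite big_nil.
rewrite mulSn => l; apply: eq_pf (pf_coefs_mul (hF i) IH l) => v.
by rewrite big_cons.
Qed.

Lemma pf_coefs_det N D m (M : 'rV[R]_N -> 'M[{poly R}]_m) :
  (forall a b, pf_coefs D (fun v => M v a b)) -> pf_coefs (m * D) (fun v => \det (M v)).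
Proof.
move=> hM; apply: pf_coefs_sum => s.
have := pf_coefs_mul (@pf_coefs_cst N 0 ((-1) ^+ s))
  (pf_coefs_prod (index_enum 'I_m) (fun i => hM i (s i))).
suff -> : size (index_enum 'I_m) = m by [].
by rewrite /index_enum -enumT size_enum_ord.
Qed.

Lemma pf_coefs_char_poly N D m (M : 'rV[R]_N -> 'M[R]_m) :
  (forall a b, pf D (fun v => M v a b)) -> pf_coefs (m * D) (fun v => char_poly (M v)).
Proof.
move=> hM; apply: pf_coefs_det => a b l.
have := pf_sub (pf_cst D (('X : {poly R}) *+ (a == b))`_l)
  (_ : pf D (fun v => (M v a b)%:P`_l)).
move=> h; apply: eq_pf (h _) => [v|]; first by rewrite !mxE coefB.
case: l {h} => [|l]; first by apply: eq_pf (hM a b) => v; rewrite coefC.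
by apply: eq_pf (pf_cst D 0) => v; rewrite coefC.
Qed.

Lemma char_poly_eq m (M : 'M[R]_m) (s : m.-tuple R) :
  (forall l : 'I_m.+1, (char_poly M)`_l = (\prod_(x <- s) ('X - x%:P))`_l) ->
  char_poly M = \prod_(x <- s) ('X - x%:P).
Proof.
move=> h; apply/polyP => l; have [lm|ml] := ltnP l m.+1; first exact: (h (Ordinal lm)).
by rewrite !nth_default ?size_char_poly // size_prod_XsubC size_tuple.
Qed.

Lemma gram_spectrum_ge0 m n (L : 'M[R]_(m, n)) (s : m.-tuple R) (k : 'I_m) :
  char_poly (L *m L^T) = \prod_(x <- s) ('X - x%:P) -> 0 <= tnth s k.
Proof.
move=> cM; have Lsym : (L *m L^T)^T = L *m L^T by rewrite trmx_mul trmxK.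
have [U _ /matrixP/(_ k k)] := symmetric_diagonalization Lsym cM.
rewrite [RHS]mxE [X in _ = X *+ _]mxE eqxx mulr1n (tnth_nth 0) => <-.
have -> : U *m (L *m L^T) *m U^T = (U *m L) *m (U *m L)^T by rewrite trmx_mul !mulmxA.
by rewrite mxE; apply: sumr_ge0 => j _; rewrite !mxE -expr2 sqr_ge0.
Qed.

(* Unknowns besides [x]: the spectrum [s], slacks [a_kl ^ 2 = s_k - s_l] for [k <= l],
   [b_k ^ 2 = Lam_k ^ 2 - s_k], [c ^ 2 = r ^ 2 - |x| ^ 2], and one coordinate that puts
   the point on a sphere of radius [A]. *)
Lemma lift_zero_set n m d (p : 'rV[R]_n -> 'rV[R]_m) (Lam : 'I_m -> R) r :
  poly_map_deg d p -> (forall k, 0 <= Lam k) ->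
  exists N (io : 'I_n -> 'I_N) (E : 'rV[R]_N -> R) (A : R),
    N = (n + (m + (m * m + (m + 2))))%N /\ injective io /\
    pf (2 * (2 * d * m + m + 2)) E /\ (forall v, 0 <= E v) /\
    (forall v : 'rV[R]_N, E v = 0 -> \sum_j v ord0 j ^+ 2 = A ^+ 2) /\
    (forall v, E v = 0 -> (CLam p Lam `&` @eball R n r) (\row_j v ord0 (io j))) /\
    (forall x, (CLam p Lam `&` @eball R n r) x ->
      exists2 v, E v = 0 & \row_j v ord0 (io j) = x).
Proof.
move=> dp Lam0.
have pp k : pf d (fun x => p x ord0 k) by exact: poly_fun_deg_pf.
have /choice2[g [pg dg]] : forall k, exists2 g, gradient (fun x => p x ord0 k) g &
    forall j, pf d (g j) by move=> k; exact: pf_gradient.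
have JE := jacobian_gradient pg.
pose I : finType := ('I_n + ('I_m + ('I_m * 'I_m + ('I_m + bool))))%type.
pose N := #|I|.
pose cI (x : I) : 'I_N := enum_rank x.
have cI_inj : injective cI by exact: enum_rank_inj.
pose co (x : I) (v : 'rV[R]_N) : R := v ord0 (cI x).
pose iy (j : 'I_n) : I := inl j.
pose is_ (k : 'I_m) : I := inr (inl k).
pose ia (k l : 'I_m) : I := inr (inr (inl (k, l))).
pose ib (k : 'I_m) : I := inr (inr (inr (inl k))).
pose ic : I := inr (inr (inr (inr true))).
pose ie : I := inr (inr (inr (inr false))).
pose Y (v : 'rV[R]_N) : 'rV[R]_n := \row_j co (iy j) v.
pose S (v : 'rV[R]_N) : m.-tuple R := [tuple co (is_ k) v | k < m].
pose L (v : 'rV[R]_N) : 'M[R]_(m, n) := \matrix_(k, j) g k j (Y v).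
(* Bounds the sum of squares of the other coordinates: [x] and [c] together give [r ^ 2], and
   [s_k ^ 2 <= Lam_k ^ 4], [a_kl ^ 2 <= Lam_k ^ 2], [b_k ^ 2 <= Lam_k ^ 2]. *)
pose B2 : R := r ^+ 2 + \sum_k Lam k ^+ 4 + \sum_(k < m) \sum_(l < m) Lam k ^+ 2 + \sum_k Lam k ^+ 2.
have B20 : 0 <= B2.
  by rewrite !addr_ge0 ?sqr_ge0 //; do ?[apply: sumr_ge0 => ? _]; rewrite ?exprn_ge0 ?sqr_ge0.
pose E1 v := \sum_(l < m.+1) ((char_poly (L v *m (L v)^T))`_l - (\prod_(x <- S v) ('X - x%:P))`_l) ^+ 2.
pose E2 v := \sum_(kl : 'I_m * 'I_m | (kl.1 <= kl.2)%N)
   (co (is_ kl.1) v - co (is_ kl.2) v - co (ia kl.1 kl.2) v ^+ 2) ^+ 2.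
pose E3 v := \sum_k (co (is_ k) v + co (ib k) v ^+ 2 - Lam k ^+ 2) ^+ 2.
pose E4 v := (\sum_j co (iy j) v ^+ 2 + co ic v ^+ 2 - r ^+ 2) ^+ 2.
pose E5 (v : 'rV[R]_N) := (\sum_j v ord0 j ^+ 2 - B2) ^+ 2.
pose E v := E1 v + E2 v + E3 v + E4 v + E5 v.
(* The coefficients of the characteristic polynomial of the Gram matrix have degree at most
   [2 * d * m], those of the product over [S v] at most [m], and the slack equations [2]; nothing
   grows with [n]. *)
pose D := (2 * d * m + m + 2)%N.
have pco x : pf 1 (co x) by exact: pf_var.
have pco2 x : pf 2 (fun v => co x v ^+ 2) by apply: (@pf_le _ _ (2 * 1) 2) => //; apply: (@pf_exp _ _ 1 (co x)).
have D2 : (2 <= D)%N by rewrite /D; lia.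
have D1 : (1 <= D)%N by rewrite /D; lia.
have pE : pf (2 * D) E.
  have pE5 : pf (2 * D) E5.
    apply: (@pf_exp _ _ D (fun v : 'rV[R]_N => \sum_j v ord0 j ^+ 2 - B2)).
    apply: pf_sub; last exact: pf_cst.
    apply: pf_sum => j _; apply: (pf_le D2).
    apply: (@pf_le _ _ (2 * 1) 2) => //.
    by apply: (@pf_exp _ _ 1 (fun v : 'rV[R]_N => v ord0 j)); exact: pf_var.
  have pE4 : pf (2 * D) E4.
    apply: (@pf_exp _ _ D (fun v => \sum_j co (iy j) v ^+ 2 + co ic v ^+ 2 - r ^+ 2)).
    apply: pf_sub; last exact: pf_cst.
    by apply: pf_add; [apply: pf_sum => j _|]; apply: (pf_le D2).
  have pE3 : pf (2 * D) E3.
    apply: pf_sum => k _.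
    apply: (@pf_exp _ _ D (fun v => co (is_ k) v + co (ib k) v ^+ 2 - Lam k ^+ 2)).
    apply: pf_sub; last exact: pf_cst.
    by apply: pf_add; [apply: (pf_le D1)|apply: (pf_le D2)].
  have pE2 : pf (2 * D) E2.
    apply: pf_sum => kl _.
    apply: (@pf_exp _ _ D (fun v => co (is_ kl.1) v - co (is_ kl.2) v - co (ia kl.1 kl.2) v ^+ 2)).
    by apply: pf_sub; [apply: pf_sub; apply: (pf_le D1)|apply: (pf_le D2)].
  do 4!(apply: pf_add => //).
  apply: pf_sum => l _.
  apply: (@pf_exp _ _ D (fun v => (char_poly (L v *m (L v)^T))`_l - (\prod_(x <- S v) ('X - x%:P))`_l)).
  apply: pf_sub.
    apply: (@pf_le _ _ (m * (d + d))); first by rewrite /D addnn -mul2n mulnC; lia.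
    apply: (pf_coefs_char_poly (M := fun v => L v *m (L v)^T)) => a b.
    apply: eq_pf (pf_sum (F := fun (j : 'I_n) v => g a j (Y v) * g b j (Y v)) _ _ (P := predT)).
      by move=> v; rewrite !mxE; apply: eq_bigr => j _; rewrite !mxE.
    move=> j _; have pY k : pf d (fun v => g k j (Y v)).
      by apply: pf_comp (dg k j) => j'; apply: eq_pf (pco (iy j')) => v; rewrite mxE.
    by apply: pf_mul.
  apply: (@pf_le _ _ (m * 1)); first by rewrite /D; lia.
  have pX (k : 'I_m) : pf_coefs 1 (fun v => 'X - (co (is_ k) v)%:P).
    move=> a.
    have h := pf_sub (pf_cst 1 ('X : {poly R})`_a) (_ : pf 1 (fun v => (co (is_ k) v)%:P`_a)).
    apply: eq_pf (h _) => [v|]; first by rewrite coefB.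
    case: a {h} => [|a]; first by apply: eq_pf (pco (is_ k)) => v; rewrite coefC.
    by apply: eq_pf (pf_cst 1 0) => v; rewrite coefC.
  have := pf_coefs_prod (index_enum 'I_m) pX l.
  rewrite (_ : size _ = m); last by rewrite /index_enum -enumT size_enum_ord.
  apply: eq_pf => v; congr (_`_l); rewrite /S /= big_map.
  by rewrite /= big_enum.
have E10 v : 0 <= E1 v by apply: sumr_ge0 => l _; exact: sqr_ge0.
have E20 v : 0 <= E2 v by apply: sumr_ge0 => l _; exact: sqr_ge0.
have E30 v : 0 <= E3 v by apply: sumr_ge0 => l _; exact: sqr_ge0.
have E40 v : 0 <= E4 v by exact: sqr_ge0.
have E50 v : 0 <= E5 v by exact: sqr_ge0.
have E0 v : 0 <= E v by rewrite /E !addr_ge0.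
have EE v : E v = 0 -> [/\ E1 v = 0, E2 v = 0, E3 v = 0, E4 v = 0 & E5 v = 0].
  have := E10 v; have := E20 v; have := E30 v; have := E40 v; have := E50 v.
  rewrite /E; move=> *; split; lra.
exists N, (fun j => cI (iy j)), E, (Num.sqrt B2); split; last split; last split; last split;
  last split; last split => //.
- by rewrite /N /I !card_sum card_prod !card_ord card_bool.
- by move=> j j' /cI_inj [].
- exact: pE.
- exact: E0.
- move=> v /EE[_ _ _ _ /eqP]; rewrite sqr_sqrtr // /E5 sqrf_eq0 subr_eq0.
  by move=> /eqP.
- move=> v /EE[/eqP v1 /eqP v2 /eqP v3 /eqP v4 _]; rewrite -/(Y v); split.
    exists (S v); rewrite JE -/(L v); split; last first.
      move=> k; rewrite tnth_mktuple; move: v3; rewrite psumr_eq0 => [|? _]; last exact: sqr_ge0.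
      move=> /allP/(_ k (mem_index_enum _)); rewrite /= sqrf_eq0 subr_eq0 => /eqP vk.
      rewrite -[leRHS]ger0_norm // -sqrtr_sqr ler_wsqrtr // -vk lerDl; exact: sqr_ge0.
    split.
      apply/(sortedP 0) => a; rewrite size_tuple => am.
      have am' : (a < m)%N by exact: ltnW.
      have := tnth_nth 0 (S v) (Ordinal am); have := tnth_nth 0 (S v) (Ordinal am').
      rewrite !tnth_mktuple /= => <- <-.
      move: v2; rewrite psumr_eq0 => [|? _]; last exact: sqr_ge0.
      move=> /allP/(_ (Ordinal am', Ordinal am) (mem_index_enum _)) /=.
      rewrite leqnSn /= sqrf_eq0 subr_eq0 => /eqP h.
      rewrite -subr_ge0 h; exact: sqr_ge0.
    apply: char_poly_eq => l; move: v1; rewrite psumr_eq0 => [|? _]; last exact: sqr_ge0.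
    move=> /allP/(_ l (mem_index_enum _)) /=; rewrite sqrf_eq0 subr_eq0 => /eqP; exact.
  move: v4; rewrite sqrf_eq0 subr_eq0 => /eqP h; rewrite /eball /= -h.
  under eq_bigr do rewrite mxE; by rewrite lerDl sqr_ge0.
- move=> x [[s []]]; rewrite JE => -[ss cp] sl xr.
  have s0 k : 0 <= tnth s k by exact: gram_spectrum_ge0 cp.
  have sL k : tnth s k <= Lam k ^+ 2.
    by rewrite -[leLHS]sqr_sqrtr // lerXn2r ?nnegrE ?sqrtr_ge0.
  have smono (k l : 'I_m) : (k <= l)%N -> tnth s l <= tnth s k.
    move=> kl; rewrite !(tnth_nth 0).
    have sge : transitive (>=%R : rel R) by move=> a b c /= ba cb; exact: le_trans ba.
    by apply: (sorted_leq_nth sge (@lexx _ R) 0 ss); rewrite ?inE ?size_tuple.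
  pose h0 (u : I) : R := match u with
    | inl j => x ord0 j | inr (inl k) => tnth s k
    | inr (inr (inl (k, l))) => if (k <= l)%N then Num.sqrt (tnth s k - tnth s l) else 0
    | inr (inr (inr (inl k))) => Num.sqrt (Lam k ^+ 2 - tnth s k)
    | inr (inr (inr (inr true))) => Num.sqrt (r ^+ 2 - \sum_j x ord0 j ^+ 2)
    | _ => 0 end.
  have sumI (h : I -> R) : \sum_u h u = \sum_j h (iy j) + (\sum_k h (is_ k) +
      (\sum_k \sum_l h (ia k l) + (\sum_k h (ib k) + (h ic + h ie)))).
    rewrite !big_sumType /= big_bool (pair_bigA _ (fun k l => h (ia k l))) /=.
    by do 3!congr (_ + _); apply: eq_bigr => -[].
  have h0B : \sum_u h0 u ^+ 2 <= B2.
    rewrite sumI /= expr0n addr0.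
    rewrite sqr_sqrtr ?subr_ge0 //.
    have l1 : \sum_(k < m) tnth s k ^+ 2 <= \sum_k Lam k ^+ 4.
      apply: ler_sum => k _; rewrite (_ : 4 = 2 * 2)%N // exprM lerXn2r ?nnegrE ?sqr_ge0 //.
    have l2 : \sum_(k < m) \sum_(l < m) (if (k <= l)%N then Num.sqrt (tnth s k - tnth s l) else 0) ^+ 2
        <= \sum_(k < m) \sum_(l < m) Lam k ^+ 2.
      apply: ler_sum => k _; apply: ler_sum => l _; case: ifP => kl; last by rewrite expr0n sqr_ge0.
      rewrite sqr_sqrtr ?subr_ge0 ?smono //; apply: le_trans (sL k); by rewrite gerBl.
    have l3 : \sum_(k < m) Num.sqrt (Lam k ^+ 2 - tnth s k) ^+ 2 <= \sum_k Lam k ^+ 2.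
      apply: ler_sum => k _; rewrite sqr_sqrtr ?subr_ge0 //; by rewrite gerBl.
    rewrite /B2; lra.
  (* The coordinate [ie] is zero in [h0] and now takes up what is missing to reach the sphere. *)
  pose h (u : I) : R := if u == ie then Num.sqrt (B2 - \sum_u h0 u ^+ 2) else h0 u.
  exists (\row_i h (enum_val i)); last first.
    by apply/rowP => j; rewrite !mxE enum_rankK.
  set v := \row_i _.
  have cov u : co u v = h u by rewrite /co mxE enum_rankK.
  have Yv : Y v = x by apply/rowP => j; rewrite mxE cov.
  have Sv : S v = s by apply: eq_from_tnth => k; rewrite tnth_mktuple cov.
  rewrite /E /E1 /L Yv Sv cp big1 => [|l _]; last by rewrite subrr expr0n.
  rewrite /E2 big1 => [|[k l] /= kl]; last first.
    by rewrite !cov /h /= kl sqr_sqrtr ?subr_ge0 ?smono // subrr expr0n.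
  rewrite /E3 big1 => [|k _]; last first.
    by rewrite !cov /h /= sqr_sqrtr ?subr_ge0 // addrCA subrr addr0 subrr expr0n.
  rewrite /E4 cov /h /= sqr_sqrtr ?subr_ge0 //.
  under eq_bigr do rewrite cov /h /=.
  rewrite [X in X - r ^+ 2]addrC subrK subrr expr0n /= !add0r.
  rewrite /E5 (reindex cI) /=; last first.
    by exists (fun i => enum_val i) => i _; [exact: enum_rankK|exact: enum_valK].
  under eq_bigr do rewrite -/(co _ v) cov.
  have -> : \sum_u h u ^+ 2 = B2.
    rewrite (bigD1 ie) //= {1}/h eqxx sqr_sqrtr ?subr_ge0 //.
    under eq_bigr => u /negPf ue do rewrite /h ue.
    by rewrite [X in _ - X + _](bigD1 ie) //= expr0n add0r subrK.
  by rewrite subrr expr0n.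
Qed.

End Lift.

(** * Selecting preimages in few cells *)

Section Selection.
Variable R : realType.

Lemma norm_row_mx N i (v : 'rV[R]_N) (t : 'rV[R]_i) : `|row_mx v t| <= `|v| + `|t|.
Proof.
apply: rV_norm_le => [|j]; first by rewrite addr_ge0.
case: (split_ordP j) => k ->.
  by rewrite row_mxEl (le_trans (rV_coord_le _ _)) // lerDl.
by rewrite row_mxEr (le_trans (rV_coord_le _ _)) // lerDr.
Qed.

Lemma gradient_section N i (H : 'rV[R]_(N + i) -> R) g (t : 'rV[R]_i) : gradient H g ->
  gradient (fun v => H (row_mx v t)) (fun j v => g (lshift i j) (row_mx v t)).
Proof.
move=> Hg A; have [M M0 hM] := Hg (A + `|t|); exists M => // x y xA yA.
have := hM (row_mx x t) (row_mx y t).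
rewrite !(le_trans (norm_row_mx _ _)) ?lerD2r // => /(_ isT isT).
rewrite big_split_ord /= [X in _ - (_ + X)]big1 ?addr0 => [|j _]; last first.
  by rewrite !row_mxEr subrr mul0r.
under eq_bigr do rewrite !row_mxEl.
move=> /le_trans; apply; rewrite ler_wpM2l // lerXn2r ?nnegrE //.
rewrite opp_row_mx add_row_mx subrr; apply: le_trans (norm_row_mx _ _) _.
by rewrite normr0 addr0.
Qed.

Lemma even_pow_bound (x S : R) k : ~~ odd k.+1 -> x ^+ k.+1 <= S -> `|x| <= 1 + S.
Proof.
move=> ek xS; have S0 : 0 <= S by apply: le_trans xS; exact: exprn_even_ge0.
have [x1|x1] := leP `|x| 1; first by rewrite (le_trans x1) // lerDl.
apply: le_trans (_ : S <= _); last by rewrite lerDr.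
apply: le_trans xS; rewrite -[leRHS]ger0_norm ?exprn_even_ge0 // normrX.
by rewrite ler_eXnr // ltW.
Qed.

(** Comparison with the zero [w] gives [E v + eps * sum <= eps * S], which bounds both terms. The
    compact set is large enough for the resulting bound [1 + S] to place the minimizer in its
    interior. *)
Lemma perturb_minimizer N e D (E : 'rV[R]_N -> R) g eps A w :
  pf D E -> (forall v, 0 <= E v) -> gradient E g -> 0 < eps -> E w = 0 -> `|w| <= A ->
  exists v, [/\ E v <= eps * (N%:R * A ^+ (2 * e).+2),
    `|v| <= 1 + N%:R * A ^+ (2 * e).+2 &
    forall j, g j v + eps * ((2 * e).+2%:R * v ord0 j ^+ (2 * e).+1) = 0].
Proof.
move=> pE E0 gE eps0 Ew wA; set S := N%:R * _.
have A0 : 0 <= A by exact: le_trans wA.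
have S0 : 0 <= S by rewrite mulr_ge0 // exprn_ge0.
have ev : ~~ odd (2 * e).+2 by rewrite /= negbK oddM.
have pw : \sum_j w ord0 j ^+ (2 * e).+2 <= S by exact: sum_pow_le.
have cF : continuous (perturb e E eps) by exact: perturb_continuous pE.
pose C := [set x : 'rV[R]_N | `|x| <= A + (2 + S)].
have cC : compact C by apply: (compact_rV (A := A + (2 + S))) => //; exact: closed_rV_le.
have Cw : C w by rewrite /C /= (le_trans wA) // lerDl addr_ge0.
have [|v Cv minv] := compact_min _ cC cF; first by exists w.
have Fv : perturb e E eps v <= eps * S.
  apply: le_trans (minv _ Cw) _; rewrite /perturb Ew add0r ler_wpM2l //; exact: ltW.
have sv0 : 0 <= \sum_j v ord0 j ^+ (2 * e).+2.
  by apply: sumr_ge0 => j _; exact: exprn_even_ge0.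
have sv : \sum_j v ord0 j ^+ (2 * e).+2 <= S.
  rewrite -(ler_pM2l eps0); apply: le_trans Fv; by rewrite /perturb lerDr.
have v1 : `|v| <= 1 + S.
  apply: rV_norm_le => [|j]; first exact: addr_ge0.
  apply: (@even_pow_bound _ _ (2 * e).+1) => //; apply: le_trans sv.
  rewrite (bigD1 j) //= lerDl; apply: sumr_ge0 => l _; exact: exprn_even_ge0.
exists v; split=> //.
  by apply: le_trans Fv; rewrite /perturb lerDl mulr_ge0 // ltW.
apply: (perturb_critical (U := [set x : 'rV[R]_N | `|x| < A + (2 + S)]) pE gE).
- exact: open_rV_lt.
- by rewrite /= (le_lt_trans v1) //; lra.
- by move=> y /= yA; apply: minv; exact: ltW.
Qed.

(** The plane enters through the [i] coordinates [tau] relative to [B], so only [i] parameters join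
    the [N] unknowns. The section of [H] at [t = tau w] vanishes at [w]; the minimizer [v] of its
    perturbation replaces [w] and falls in a counted cell. *)
Lemma selection_cells N n m i D (E : 'rV[R]_N -> R) A (io : 'I_n -> 'I_N)
    (f : 'rV[R]_N -> 'rV[R]_m) (B : 'M[R]_(i, m)) (tau : 'rV[R]_N -> 'rV[R]_i) (r eta : R) (K : nat) :
  (0 < D)%N -> pf (2 * D) E -> (forall v, 0 <= E v) ->
  (forall v : 'rV[R]_N, E v = 0 -> \sum_j v ord0 j ^+ 2 = A ^+ 2) -> injective io ->
  (forall k, pf D (fun v => f v ord0 k)) ->
  (forall v, f v = tau v *m B) -> (forall l, exists D', pf D' (fun v => tau v ord0 l)) ->
  (forall v, E v = 0 -> forall j, `|v ord0 (io j)| <= r) ->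
  0 < eta -> r + eta <= K%:R * eta ->
  exists grid : 'I_n -> nat -> R,
    (forall j a, grid j a.+1 = grid j a + eta) /\
  exists cells : {set {ffun 'I_n -> 'I_(2 * K + 3)}},
    (#|cells| <= (32 * D + 9) ^ (N + i + 1) * \sum_(a < i.+1) (2 * n * (2 * K + 3)) ^ a)%N /\
    forall w, E w = 0 -> exists k (v w' : 'rV[R]_N), [/\ k \in cells, E w' = 0,
      forall j, `|v ord0 (io j) - w' ord0 (io j)| <= eta,
      forall j, grid j (k j) <= v ord0 (io j) <= grid j (k j).+1 &
      forall l, `|f v ord0 l - f w ord0 l| <= eta ^+ 2].
Proof.
move=> D0 pE E0 EA inj_io pf_f fB ptau Er eta0 hK.
have EA' v : E v = 0 -> `|v| <= `|A|.
  move=> /EA vA; apply: rV_norm_le => // j.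
  rewrite -ler_sqr ?nnegrE // !real_normK ?num_real // -vA (bigD1 j) //=.
  by rewrite lerDl; apply: sumr_ge0 => l _; exact: sqr_ge0.
pose H (z : 'rV[R]_(N + i)) := E (lsubmx z) +
  \sum_k (f (lsubmx z) ord0 k - (rsubmx z *m B) ord0 k) ^+ 2.
have pl (F : 'rV[R]_N -> R) D' : pf D' F -> pf D' (fun z : 'rV[R]_(N + i) => F (lsubmx z)).
  apply: pf_comp => j; apply: eq_pf (pf_var 0 (lshift i j)) => z; by rewrite mxE.
have pH : pf (2 * D) H.
  apply: pf_add; first exact: pl.
  apply: pf_sum => k _.
  apply: (@pf_exp _ _ D (fun z => f (lsubmx z) ord0 k - (rsubmx z *m B) ord0 k)).
  apply: pf_sub; first exact: (pl (fun v => f v ord0 k)).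
  apply: (pf_le D0).
  apply: eq_pf (pf_sum (F := fun (l : 'I_i) (z : 'rV[R]_(N + i)) => B l k * z ord0 (rshift N l)) _ _ (P := predT)).
    by move=> z; rewrite !mxE; apply: eq_bigr => l _; rewrite mxE mulrC.
  by move=> l _; apply: pf_scale; exact: pf_var.
have H0 z : 0 <= H z by rewrite addr_ge0 // sumr_ge0 // => k _; exact: sqr_ge0.
have [g gH pg] := pf_gradient pH.
have /choice2[T [T0 hT]] : forall l, exists2 T, 0 <= T & forall v, `|v| <= `|A| -> `|tau v ord0 l| <= T.
  by move=> l; have [D' pD'] := ptau l; have [T] := pf_bounded `|A| pD'; exists T.
pose S := N%:R * `|A| ^+ (2 * (2 * D)).+2.
have S0 : 0 <= S by rewrite mulr_ge0 // exprn_ge0.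
have [d d0 hd] := near_zero_set (1 + S) pE E0 eta0.
(* The bound [d / 2] places [v] within [eta] of a zero [w'] of [E], and [eta ^ 4] bounds the squared
   deviation of [f v] from [f w]. *)
pose eps := Num.min (d / 2) (eta ^+ 4) / (S + 1).
have S1 : 0 < S + 1 by rewrite ltr_wpDl.
have m0 : 0 < Num.min (d / 2) (eta ^+ 4) by rewrite lt_min divr_gt0 // exprn_gt0.
have eps0 : 0 < eps by rewrite divr_gt0.
have epsS : eps * S <= Num.min (d / 2) (eta ^+ 4).
  by rewrite /eps mulrAC ler_pdivrMr // ler_pM2l // lerDl.
(* The summand [1] gives [A2 <= A2 ^ 2], so [A2] serves as a radius. *)
pose A2 := 1 + (N%:R * (1 + S) ^+ 2 + \sum_l T l ^+ 2).
have A21 : 1 <= A2.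
  rewrite lerDl addr_ge0 ?sumr_ge0 // => [|l _]; last exact: sqr_ge0.
  by rewrite mulr_ge0 // sqr_ge0.
have [grid [gs [cells [ccells hcells]]]] := core_count A2 K pH pg eps0 inj_io eta0.
exists grid; split=> //; exists cells; split.
  apply: leq_trans ccells _; by rewrite mulnA.
move=> w Ew; set t := tau w.
have Hw : H (row_mx w t) = 0.
  rewrite /H row_mxKl row_mxKr Ew add0r big1 // => k _.
  by rewrite fB subrr expr0n.
have pHt : pf (2 * D) (fun v => H (row_mx v t)).
  apply: pf_comp pH => j; case: (split_ordP j) => l ->.
    by apply: eq_pf (pf_var 0 l) => v; rewrite row_mxEl.
  by apply: eq_pf (pf_cst 1 (t ord0 l)) => v; rewrite row_mxEr.
have [v [Hv vS Gv]] := @perturb_minimizer N (2 * D) (2 * D) _ _ eps `|A| w pHt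
  (fun v => H0 (row_mx v t)) (gradient_section t gH) eps0 Hw (EA' _ Ew).
have Ev : E v <= Num.min (d / 2) (eta ^+ 4).
  apply: le_trans epsS; apply: le_trans Hv; rewrite /H row_mxKl lerDl.
  by apply: sumr_ge0 => k _; exact: sqr_ge0.
have [|w' Ew' vw'] := hd v vS.
  apply: le_lt_trans Ev _; rewrite gt_min; apply/orP; left.
  by rewrite ltr_pdivrMr // ltr_pMr // ltr1n.
have vw'j j : `|v ord0 (io j) - w' ord0 (io j)| <= eta.
  apply: le_trans (ltW vw'); apply: le_trans (rV_coord_le _ (io j)); by rewrite !mxE.
have [|||k kc hk] := hcells (row_mx v t).
- by move=> j; rewrite row_mxEl; exact: Gv.
- rewrite big_split_ord /=.
  apply: le_trans (_ : N%:R * (1 + S) ^+ 2 + \sum_l T l ^+ 2 <= _); last first.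
    by rewrite expr2; apply: le_trans (ler_peMr _ A21); rewrite ?lerDr // (le_trans _ A21).
  apply: lerD.
    under eq_bigr do rewrite row_mxEl; exact: sum_pow_le.
  apply: ler_sum => l _; rewrite row_mxEr -[leLHS]real_normK ?num_real //.
  by rewrite lerXn2r ?nnegrE //; apply: hT; exact: EA'.
- move=> j; rewrite row_mxEl; apply: le_trans hK.
  rewrite -[v ord0 _](subrK (w' ord0 (io j))) addrC; apply: ler_normD_le => //.
  exact: Er.
exists k, v, w'; split=> // [j|l]; first by have := hk j; rewrite row_mxEl.
rewrite -[leRHS]ger0_norm ?sqr_ge0 // -ler_sqr ?nnegrE // !real_normK ?num_real // -exprM.
apply: (@le_trans _ _ (eps * S)); last by apply: le_trans epsS _; rewrite ge_min lexx orbT.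
apply: le_trans Hv; rewrite /H row_mxKl row_mxKr /t -fB (bigD1 l) //= addrCA.
by rewrite lerDl addr_ge0 // sumr_ge0 // => k' _; exact: sqr_ge0.
Qed.

End Selection.

(** * Coverings and Hausdorff measure *)

Section Covering.
Variable R : realType.

Lemma omega_ball_ge0 s : 0 <= omega_ball s :> R.
Proof.
suff [] : 0 <= omega_ball s :> R /\ 0 <= omega_ball s.+1 :> R by [].
elim: s => [|s [IH1 IH2]] /=; first by split.
split=> //; rewrite divr_ge0 // mulr_ge0 // mulr_ge0 //; exact: pi_ge0.
Qed.

Lemma ediam_ge0 N (C : set 'rV[R]_N) : (0 <= ediam C)%E.
Proof. by apply: ereal_sup_ubound; left. Qed.

Lemma ediam_le N (C : set 'rV[R]_N) x : 0 <= x ->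
  (forall u v, C u -> C v -> Defs.edist u v <= x) -> (ediam C <= x%:E)%E.
Proof.
move=> x0 h; apply: ge_ereal_sup => _ [->|[u [v [Cu [Cv ->]]]]]; rewrite lee_fin //.
exact: h.
Qed.

Lemma ediam_set0 N : ediam (@set0 'rV[R]_N) = 0%E.
Proof. by apply/eqP; rewrite eq_le ediam_ge0 andbT; apply: ediam_le => //. Qed.

Lemma hausdorff_delta_finite N s delta (E : set 'rV[R]_N) (Q : finType) (D : {set Q})
    (C : Q -> set 'rV[R]_N) x : (0 < s)%N -> 0 <= x <= delta ->
  (forall t, E t -> exists2 q, q \in D & C q t) ->
  (forall q, (ediam (C q) <= x%:E)%E) ->
  (hausdorff_delta s delta E <= (omega_ball s * (#|D|%:R * x ^+ s))%:E)%E.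
Proof.
move=> s0 /andP[x0 xd] cov dC.
(* Padding by empty sets costs nothing, since [0 ^ s = 0] for [0 < s]. *)
pose C' (j : nat) : set 'rV[R]_N :=
  if insub j is Some j' then C (enum_val (j' : 'I_#|D|)) else set0.
have dC' j : (ediam (C' j) <= x%:E)%E.
  by rewrite /C'; case: insubP => [j' _ _|_]; rewrite ?ediam_set0 ?lee_fin.
pose u (j : nat) : \bar R := ((@omega_ball R s)%:E * (ediam (C' j) * (2^-1)%:E) ^+ s)%E.
have dfin j : exists2 y, 0 <= y <= x & ediam (C' j) = y%:E.
  have := ediam_ge0 (C' j); have := dC' j; case: (ediam (C' j)) => [y| |] //=.
    by rewrite !lee_fin => yx y0; exists y => //; rewrite y0.
have u0 j : (0 <= u j)%E.
  have [y /andP[y0 _] E'] := dfin j; rewrite /u E' -EFinM -EFin_expe -EFinM lee_fin.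
  by rewrite mulr_ge0 ?omega_ball_ge0 // exprn_ge0 // mulr_ge0.
have ux j : (u j <= (omega_ball s * x ^+ s)%:E)%E.
  have [y /andP[y0 yx] E'] := dfin j; rewrite /u E' -EFinM -EFin_expe -EFinM lee_fin.
  rewrite ler_wpM2l ?omega_ball_ge0 // lerXn2r ?nnegrE ?mulr_ge0 //.
  by apply: le_trans yx; rewrite ler_pdivrMr // ler_peMr // ler1n.
apply: (@le_trans _ _ (\sum_(j <oo) u j)%E).
  apply: ereal_inf_lbound; exists C'; split.
    move=> t /cov [q qD Cqt]; exists (enum_rank_in qD q) => //.
    rewrite /C'; case: insubP => [j' _ /val_inj ->|]; last by rewrite ltn_ord.
    by rewrite enum_rankK_in.
  by split=> // j; apply: le_trans (dC' j) _; rewrite lee_fin.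
have -> : (\sum_(j <oo) u j = \sum_(0 <= j < #|D|) u j)%E.
  apply: cvg_lim => //; apply: cvg_near_cst; exists #|D| => // k /= Dk.
  rewrite (big_cat_nat (n := #|D|)) //=.
  suff -> : (\sum_(#|D| <= j < k) u j = 0)%E by rewrite adde0.
  rewrite big_nat_cond big1 // => j; rewrite andbT => /andP[Dj _]; rewrite /u /C' insubF ?ediam_set0; last first.
    by rewrite ltnNge Dj.
  by rewrite mul0e -EFin_expe expr0n (gtn_eqF s0) mule0.
apply: (@le_trans _ _ (\sum_(0 <= j < #|D|) (omega_ball s * x ^+ s)%:E)%E).
  exact: lee_sum.
rewrite sumEFin sumr_const_nat subn0 lee_fin mulrCA mulr_natl; exact: lexx.
Qed.

Lemma frame_parseval m i (P : 'M[R]_m) (W : nat -> 'rV[R]_m) : grass_proj i P ->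
  (forall a b, (a < i)%N -> (b < i)%N -> dot (W a) (W b) = (a == b)%:R) ->
  (forall a, (a < i)%N -> W a *m P = W a) ->
  forall v, v *m P = v -> dot v v = \sum_(a < i) dot v (W a) ^+ 2.
Proof.
move=> [Psym [PP rP]] Wo WP v vP.
pose M : 'M[R]_(i, m) := \matrix_(a < i) W a.
have MM : M *m M^T = 1%:M.
  apply/matrixP => a b; rewrite !mxE -[RHS]/((a == b :> nat)%:R) -Wo // /dot; apply: eq_bigr => j _; by rewrite !mxE.
have MP : M *m P = M by apply/row_matrixP => a; rewrite row_mul rowK WP.
have sMP : (M <= P)%MS by rewrite -MP submxMl.
have rM : \rank M = i.
  apply/eqP; rewrite eqn_leq rank_leq_row /=.
  by rewrite -{1}(mxrank1 R i) -MM mxrankM_maxl.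
have sPM : (P <= M)%MS by rewrite -(mxrank_leqif_sup sMP) rM rP.
have /submxP[c vc] : (v <= M)%MS by rewrite -vP mulmx_sub.
have cv a : c ord0 a = dot v (W a).
  have -> : c = v *m M^T by rewrite vc -mulmxA MM mulmx1.
  rewrite mxE /dot; apply: eq_bigr => j _; by rewrite !mxE.
have -> : dot v v = dot c c by rewrite !dotE vc trmx_mul mulmxA -[c *m M *m M^T]mulmxA MM mulmx1.
by rewrite {1}/dot; apply: eq_bigr => a _; rewrite -expr2 cv.
Qed.

Lemma coord_le_dot m (v : 'rV[R]_m) j : v ord0 j ^+ 2 <= dot v v.
Proof.
rewrite /dot (bigD1 j) //= -expr2 lerDl; apply: sumr_ge0 => l _.
by rewrite -expr2 sqr_ge0.
Qed.

Lemma dot_bound m (u v : 'rV[R]_m) a b : 0 <= a -> (forall j, `|u ord0 j| <= a) ->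
  (forall j, `|v ord0 j| <= b) -> `|dot u v| <= m%:R * (a * b).
Proof.
move=> a0 ua vb; apply: le_trans (ler_norm_sum _ _ _) _.
rewrite -[X in _ <= X%:R * _]card_ord mulr_natl -sumr_const; apply: ler_sum => j _.
by rewrite normrM ler_pM.
Qed.

Lemma sum_max_sqr i (F : 'I_i -> R) x : 0 <= x -> (forall a, `|F a| <= x) ->
  Num.sqrt (\sum_a F a ^+ 2) <= i%:R * x.
Proof.
move=> x0 Fx; rewrite -[leRHS]ger0_norm ?mulr_ge0 // -sqrtr_sqr ler_wsqrtr //.
apply: (@le_trans _ _ (i%:R * x ^+ 2)).
  rewrite -[X in _ <= X%:R * _]card_ord mulr_natl -sumr_const; apply: ler_sum => a _.
  by rewrite -[leLHS]real_normK ?num_real // lerXn2r ?nnegrE.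
rewrite exprMn ler_wpM2r ?sqr_ge0 //; case: i {F Fx} => [|i]; first by rewrite expr0n.
by rewrite expr2 ler_peMl // ler1n.
Qed.

(** Along [W a] the linear part is [dot D (W a *m L)], and the norm of [W a *m L] is at most the
    singular value of index [a]. So the image lies in a box of half-widths [r a], cut into slabs of
    width [eta ^ 2]; [q] only makes the boxes a finite type. *)
Lemma box_cover m n i q (P : 'M[R]_m) (L : 'M[R]_(m, n)) (Lam : 'I_m -> R) (im : (i <= m)%N)
    (x0 : 'rV[R]_m) (eta c : R) (u : 'I_i -> nat) :
  grass_proj i P -> sing_vals_le L Lam -> 0 < eta -> 0 <= c -> x0 *m P = x0 ->
  (forall a, (u a <= q)%N) ->
  (forall a, 2 * (n%:R * (2 * eta * Lam (widen_ord im a)) + m%:R * (c * eta ^+ 2)) / eta ^+ 2 < (u a)%:R) ->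
  exists C : {ffun 'I_i -> 'I_q} -> set 'rV[R]_m,
    (forall b, (ediam (C b) <= (i%:R * eta ^+ 2)%:E)%E) /\
    forall (t : 'rV[R]_m) (D : 'rV[R]_n) (rho : 'rV[R]_m),
      (forall j, `|D ord0 j| <= 2 * eta) -> (forall l, `|rho ord0 l| <= c * eta ^+ 2) ->
      t - x0 = (D *m L^T + rho) *m P ->
      exists2 b : {ffun 'I_i -> 'I_q}, (forall a, (b a < u a)%N) & C b t.
Proof.
move=> gP [s [ss sL]] eta0 c0 x0P uq hu.
have e20 : 0 < eta ^+ 2 by rewrite exprn_gt0.
have Lsym : (L *m L^T)^T = L *m L^T by rewrite trmx_mul trmxK.
have [W [Wo WP WM]] := spectral_frame Lsym ss gP.
have [Psym [PP rP]] := gP.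
pose r (a : 'I_i) := n%:R * (2 * eta * Lam (widen_ord im a)) + m%:R * (c * eta ^+ 2).
pose lo (a : 'I_i) := dot x0 (W a) - r a.
exists (fun b : {ffun 'I_i -> 'I_q} => [set x : 'rV[R]_m | x *m P = x /\ forall a : 'I_i,
  lo a + (b a : nat)%:R * eta ^+ 2 <= dot x (W a) <= lo a + (b a).+1%:R * eta ^+ 2]); split.
  move=> b; apply: ediam_le => [|x y [xP hx] [yP hy]]; first by rewrite mulr_ge0 // ltW.
  have xyP : (x - y) *m P = x - y by rewrite mulmxBl xP yP.
  have -> : Defs.edist x y = Num.sqrt (dot (x - y) (x - y)).
    by congr Num.sqrt; apply: eq_bigr => j _; rewrite !mxE expr2.
  rewrite (frame_parseval gP Wo WP xyP).
  apply: sum_max_sqr => [|a]; first exact: ltW.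
  have -> : dot (x - y) (W a) = dot x (W a) - dot y (W a).
    by rewrite /dot -sumrB; apply: eq_bigr => j _; rewrite !mxE mulrBl.
  have := hx a; have := hy a; rewrite -natr1 mulrDl mul1r => /andP[y1 y2] /andP[x1 x2].
  by rewrite ler_norml; apply/andP; split; lra.
move=> t D rho hD hrho tE.
have tP : t *m P = t.
  by rewrite -[t](subrK x0) mulmxDl tE x0P -mulmxA PP.
have coord (a : 'I_i) : `|dot (t - x0) (W a)| <= r a.
  have ai : (a < i)%N by [].
  have -> : dot (t - x0) (W a) = dot (D *m L^T + rho) (W a).
    by rewrite tE !dotE -mulmxA -{1}Psym -trmx_mul WP.
  have -> : dot (D *m L^T + rho) (W a) = dot D (W a *m L) + dot rho (W a).
    by rewrite !dotE mulmxDl mxE trmx_mul mulmxA.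
  apply: ler_normD_le.
    apply: dot_bound => [||j]; [by rewrite mulr_ge0 // ltW|exact: hD|].
    apply: le_trans (sL (widen_ord im a)).
    rewrite -sqrtr_sqr ler_wsqrtr //; apply: le_trans (coord_le_dot _ _) _.
    by apply: le_trans (WM (widen_ord im a) ai); rewrite !dotE trmx_mul !mulmxA.
  rewrite -[c * _]mulr1; apply: dot_bound => [||l]; [by rewrite mulr_ge0 // ltW|exact: hrho|].
  rewrite -(@ler_pXn2r _ 2) ?nnegrE // real_normK ?num_real // expr1n.
  by apply: le_trans (coord_le_dot _ _) _; rewrite Wo // eqxx.
have dB (a : nat) : dot t (W a) = dot (t - x0) (W a) + dot x0 (W a).
  by rewrite /dot -big_split; apply: eq_bigr => j _ /=; rewrite !mxE; ring.
have /choice[b hb] : forall a : 'I_i, exists b : 'I_q, (b < u a)%N /\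
    lo a + (b : nat)%:R * eta ^+ 2 <= dot t (W a) <= lo a + b.+1%:R * eta ^+ 2.
  move=> a; pose z := (dot t (W a) - lo a) / eta ^+ 2.
  have /ler_normlP[h1 h2] := coord a.
  have z0 : 0 <= z.
    by rewrite divr_ge0 ?(ltW e20) // /lo dB; lra.
  have zu : z < (u a)%:R.
    apply: le_lt_trans (hu a); rewrite -/(r a) ler_pM2r ?invr_gt0 //.
    by rewrite /lo dB; lra.
  have /andP[t1 t2] := truncn_itv z0.
  have tu : (Num.truncn z < u a)%N by rewrite -(ltr_nat R); exact: le_lt_trans zu.
  exists (Ordinal (leq_trans tu (uq a))); split=> //=.
  have -> : dot t (W a) = lo a + z * eta ^+ 2 by rewrite /z divfK ?gt_eqF // addrC subrK.
  by rewrite !lerD2l !ler_pM2r // t1 ltW.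
exists [ffun a => b a]; first by move=> a; rewrite ffunE; case: (hb a).
by split=> // a; rewrite ffunE; case: (hb a).
Qed.

Lemma card_box i q (u : 'I_i -> nat) :
  (#|[set b : {ffun 'I_i -> 'I_q} | [forall a, (b a < u a)%N]]%SET| <= \prod_a u a)%N.
Proof.
pose F (a : 'I_i) := [pred b : 'I_q | (b < u a)%N].
have -> : #|[set b : {ffun 'I_i -> 'I_q} | [forall a, (b a < u a)%N]]%SET| = #|family F|.
  by apply: eq_card => e; rewrite inE; apply/forallP/familyP.
rewrite card_family foldrE big_map big_enum /=; apply: leq_prod => a _.
suff : (#|F a| <= u a)%N by [].
case: (posnP (u a)) => [ua|ua].
  by rewrite ua leqn0; apply/eqP/eq_card0 => b; rewrite inE ?ua.
have iu : u a = (u a).-1.+1 by rewrite prednK.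
rewrite [X in (_ <= X)%N]iu -[X in (_ <= X)%N]card_ord.
pose g (b : 'I_q) : 'I_(u a).-1.+1 := inord b.
rewrite -(@card_in_image _ _ g (F a)); first exact: max_card.
move=> b b'; rewrite !inE => lb lb' /(congr1 val) /=.
by rewrite !inordK ?prednK // => /val_inj.
Qed.

End Covering.

(** * Coverings of projected images *)

Section ImageMeasure.
Variable R : realType.

Definition lift_dim n m := (n + (m + (m * m + (m + 2))))%N.
Definition lift_deg d m := (2 * d * m + m + 2)%N.

Lemma proj_factor m i (P : 'M[R]_m) : grass_proj i P ->
  exists (B : 'M[R]_(i, m)) (B' : 'M[R]_(m, i)), P = P *m B' *m B.
Proof.
move=> [_ [_ <-]]; exists (row_base P), (pinvmx (row_base P)).
by rewrite mulmxKpV // eq_row_base.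
Qed.

Lemma pf_mulmx_col n m i D (f : 'rV[R]_n -> 'rV[R]_m) (B : 'M[R]_(m, i)) :
  (forall k, pf D (fun x => f x ord0 k)) -> forall l, pf D (fun x => (f x *m B) ord0 l).
Proof.
move=> hf l.
apply: eq_pf (pf_sum (F := fun (k : 'I_m) x => B k l * f x ord0 k) _ _ (P := predT)).
  by move=> x; rewrite mxE; apply: eq_bigr => k _; rewrite mulrC.
by move=> k _; apply: pf_scale.
Qed.

Lemma geometric_sum_le (X Y : R) i : 0 <= X <= Y -> 1 <= Y ->
  \sum_(a < i.+1) X ^+ a <= i.+1%:R * Y ^+ i.
Proof.
move=> /andP[X0 XY] Y1; rewrite -[X in _ <= X%:R * _]card_ord mulr_natl -sumr_const.
apply: ler_sum => a _; apply: (@le_trans _ _ (Y ^+ a)).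
  by rewrite lerXn2r ?nnegrE // (le_trans X0).
by rewrite ler_weXn2l // -ltnS.
Qed.

(** Only [c] depends on [p] beyond its degree bound, and it enters through [c * eta] alone, hence
    disappears in the limit. *)
Lemma image_cover n m d (p : 'rV[R]_n -> 'rV[R]_m) (Lam : 'I_m -> R) (r : R) i (P : 'M[R]_m)
    (im : (i <= m)%N) :
  (m <= n)%N -> (0 < i)%N -> poly_map_deg d p -> (forall k, 0 <= Lam k) -> 0 < r ->
  grass_proj i P ->
  exists2 c, 0 <= c & forall eta delta, 0 < eta -> eta <= 1 -> eta <= r ->
    i%:R * eta ^+ 2 <= delta ->
    (hausdorff_delta i delta
       ((fun a => a *m P) @` (p @` (CLam p Lam `&` @eball R n r))) <=
     (omega_ball i * (((32 * lift_deg d m + 9) ^ (lift_dim n m + i + 1))%:R *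
       (i.+1%:R * (18 * n%:R * r) ^+ i) * i%:R ^+ i *
       \prod_(a < i) (4 * n%:R * Lam (widen_ord im a) + c * eta)))%:E)%E.
Proof.
move=> mn i0 dp Lam0 r0 gP.
have m0 : (0 < m)%N by exact: leq_trans im.
have n0 : (0 < n)%N by exact: leq_trans mn.
have [Psym [PP rP]] := gP.
have [N [io [E [A [NE [inj_io [pE [E0 [EA [E1 E2]]]]]]]]]] := lift_zero_set r dp Lam0.
set D := (2 * d * m + m + 2)%N in pE.
pose y (v : 'rV[R]_N) : 'rV[R]_n := \row_j v ord0 (io j).
have D0 : (0 < D)%N by rewrite /D; lia.
have dD : (d <= D)%N by rewrite /D; nia.
have pp k : pf d (fun x => p x ord0 k) by exact: poly_fun_deg_pf.
have /choice2[g [pg dg]] : forall k, exists2 g, gradient (fun x => p x ord0 k) g &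
    forall j, pf d (g j) by move=> k; exact: pf_gradient.
have JE := jacobian_gradient pg.
(* The points compared later are at distance at most [2 * eta <= 2] from the ball. *)
have /choice2[M [M0 hM]] : forall k, exists2 M, 0 <= M & forall x x', `|x| <= r + 2 ->
    `|x'| <= r + 2 -> `|p x' ord0 k - p x ord0 k -
       \sum_j (x' ord0 j - x ord0 j) * g k j x| <= M * `|x' - x| ^+ 2.
  by move=> k'; exact: pg.
pose f v := p (y v) *m P.
have ppy k : pf D (fun v => p (y v) ord0 k).
  apply: (pf_le dD); apply: pf_comp (pp k) => j.
  by apply: eq_pf (pf_var 0 (io j)) => v; rewrite mxE.
have pf_f k : pf D (fun v => f v ord0 k) by exact: pf_mulmx_col.
have fP v : f v *m P = f v by rewrite /f -mulmxA PP.
have [B [B' PB]] := proj_factor gP.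
pose tau v := f v *m B'.
have ftau v : f v = tau v *m B by rewrite -[LHS]fP PB !mulmxA fP.
have ptau l : exists D', pf D' (fun v => tau v ord0 l).
  by exists D; exact: pf_mulmx_col.
have yr v : E v = 0 -> forall j, `|v ord0 (io j)| <= r.
  move=> /E1[_]; rewrite /eball /= => vr j.
  rewrite -[leRHS]gtr0_norm // -ler_sqr ?nnegrE // !real_normK ?num_real //.
  apply: le_trans vr; rewrite (bigD1 j) //= mxE lerDl.
  by apply: sumr_ge0 => l _; exact: sqr_ge0.
(* A displacement of at most [2 * eta] leaves a remainder [4 * M k * eta ^ 2]; replacing [f w] by
   [f v] costs another [eta ^ 2]. *)
pose M1 := 4 * (\sum_k M k) + 1.
have sM0 : 0 <= \sum_k M k by exact: sumr_ge0.
have M10 : 0 <= M1 by rewrite /M1; lra.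
exists (2 * m%:R * M1 + 1).
  by rewrite addr_ge0 // mulr_ge0 // mulr_ge0.
move=> eta delta eta0 eta1 etar ed.
have e20 : 0 < eta ^+ 2 by rewrite exprn_gt0.
pose K := (Num.truncn ((r + eta) / eta)).+1.
have re0 : 0 <= (r + eta) / eta by rewrite divr_ge0 ?ltW // addr_gt0.
have hK : r + eta <= K%:R * eta.
  by rewrite -ler_pdivrMr // ltW //; have /andP[_] := truncn_itv re0.
have Ku : K%:R <= (r + eta) / eta + 1.
  by rewrite /K -natr1 lerD2r; have /andP[] := truncn_itv re0.
have [grid [gs [cells [ccells hcells]]]] :=
  selection_cells D0 pE E0 EA inj_io pf_f ftau ptau yr eta0 hK.
pose Ra (a : 'I_i) := n%:R * (2 * eta * Lam (widen_ord im a)) + m%:R * (M1 * eta ^+ 2).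
have Ra0 a : 0 <= Ra a.
  by rewrite addr_ge0 // mulr_ge0 // mulr_ge0 // ?mulr_ge0 // ltW.
pose u (a : 'I_i) := (Num.truncn (2 * Ra a / eta ^+ 2)).+1.
have z0 a : 0 <= 2 * Ra a / eta ^+ 2 by rewrite divr_ge0 ?(ltW e20) // mulr_ge0.
have hu a : 2 * Ra a / eta ^+ 2 < (u a)%:R by have /andP[] := truncn_itv (z0 a).
have uu a : (u a)%:R <= 2 * Ra a / eta ^+ 2 + 1.
  by rewrite /u -natr1 lerD2r; have /andP[] := truncn_itv (z0 a).
pose q := (\sum_a u a)%N.
have uq a : (u a <= q)%N by rewrite /q (bigD1 a) //= leq_addr.
have /choice[C hC] : forall k : {ffun 'I_n -> 'I_(2 * K + 3)},
    exists C : {ffun 'I_i -> 'I_q} -> set 'rV[R]_m,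
    (forall b, (ediam (C b) <= (i%:R * eta ^+ 2)%:E)%E) /\
    forall w v w' : 'rV[R]_N, E w' = 0 ->
      (forall j, `|v ord0 (io j) - w' ord0 (io j)| <= eta) ->
      (forall j, grid j (k j) <= v ord0 (io j) <= grid j (k j).+1) ->
      (forall l, `|f v ord0 l - f w ord0 l| <= eta ^+ 2) ->
      exists2 b : {ffun 'I_i -> 'I_q}, (forall a, (b a < u a)%N) & C b (f w).
  move=> k.
  (* A cell met by no admissible point gets empty boxes. Otherwise a genuine zero [w0] serves as
     base point: the singular values are bounded at [y w0], whereas [y v0] need not lie in
     [CLam p Lam]. *)
  have [[w0 [v0 [Ew0 v0w0 gv0]]]|nolive] := pselect (exists w0 v0 : 'rV[R]_N,
      [/\ E w0 = 0, forall j, `|v0 ord0 (io j) - w0 ord0 (io j)| <= eta &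
        forall j, grid j (k j) <= v0 ord0 (io j) <= grid j (k j).+1]); last first.
    exists (fun=> set0); split; first by move=> b; rewrite ediam_set0 lee_fin mulr_ge0 // ltW.
    move=> w v w' Ew' vw' gv _; exfalso; apply: nolive; by exists w', v.
  have [Lx _] := E1 w0 Ew0; rewrite -/(y w0) in Lx.
  have [C [dC cC]] := box_cover gP Lx eta0 M10 (fP w0) uq hu.
  exists C; split=> // w v w' Ew' vw' gv fvw.
  pose De := y v - y w0.
  pose L := Defs.jacobian p (y w0).
  pose rho := (p (y v) - p (y w0) - De *m L^T) + (f w - f v).
  have hDe j : `|De ord0 j| <= 2 * eta.
    have -> : De ord0 j = (v ord0 (io j) - v0 ord0 (io j)) + (v0 ord0 (io j) - w0 ord0 (io j)).
      by rewrite !mxE; ring.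
    rewrite mulr_natl mulr2n; apply: ler_normD_le => //.
    have /andP[g1 g2] := gv j; have /andP[g3 g4] := gv0 j; rewrite gs in g2 g4.
    by rewrite ler_norml; apply/andP; split; lra.
  have nDe : `|De| <= 2 * eta by apply: rV_norm_le => //; rewrite mulr_ge0 // ltW.
  have yw0 : `|y w0| <= r.
    by apply: rV_norm_le => [|j]; [exact: ltW|rewrite mxE; exact: yr].
  have yw0' : `|y w0| <= r + 2 by apply: le_trans yw0 _; rewrite lerDl.
  have yv : `|y v| <= r + 2.
    rewrite -[y v](subrK (y w0)) addrC; apply: le_trans (ler_normD _ _) _.
    by apply: lerD => //; apply: le_trans nDe _; lra.
  apply: (cC _ De rho) => //.
    move=> l; rewrite /M1 mulrDl mul1r /rho [X in `|X|]mxE; apply: ler_normD_le; last first.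
      by rewrite !mxE distrC; have := fvw l; rewrite !mxE.
    have -> : (p (y v) - p (y w0) - De *m L^T) ord0 l =
        p (y v) ord0 l - p (y w0) ord0 l - \sum_j (y v ord0 j - y w0 ord0 j) * g l j (y w0).
      rewrite /L JE; rewrite [LHS]mxE [X in X + _]mxE [X in _ + X + _]mxE [X in _ + X = _]mxE.
      congr (_ - _); rewrite mxE; apply: eq_bigr => j _; rewrite /De mxE.
      by rewrite [X in _ + X]mxE [X in _ * X = _]mxE [X in _ * X = _]mxE.
    apply: le_trans (hM l _ _ yw0' yv) _.
    apply: (@le_trans _ _ (M l * (2 * eta) ^+ 2)).
      by rewrite ler_wpM2l // lerXn2r ?nnegrE // mulr_ge0 // ltW.
    rewrite exprMn mulrA ler_wpM2r ?(ltW e20) // mulrC.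
    rewrite (_ : 2 ^+ 2 = 4); last by rewrite expr2; ring.
    by rewrite ler_wpM2l // (bigD1 l) //= lerDl; apply: sumr_ge0.
  have -> : De *m L^T + rho = p (y v) - p (y w0) + (f w - f v).
    by rewrite /rho addrA; congr (_ + _); rewrite addrC subrK.
  rewrite mulmxDl !mulmxBl !fP -/(f v) -/(f w0).
  by rewrite [RHS]addrC addrA subrK.
pose box := [set b : {ffun 'I_i -> 'I_q} | [forall a, (b a < u a)%N]]%SET.
have := @hausdorff_delta_finite R m i delta
  ((fun a => a *m P) @` (p @` (CLam p Lam `&` @eball R n r)))
  ({ffun 'I_n -> 'I_(2 * K + 3)} * {ffun 'I_i -> 'I_q})%type (finset.setX cells box)
  (fun kb => C kb.1 kb.2) (i%:R * eta ^+ 2) i0.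
rewrite ed andbT mulr_ge0 ?(ltW e20) // => /(_ isT).
move=> H; apply: le_trans (H _ _) _.
- move=> _ [_ [x Sx <-] <-]; have [w Ew wx] := E2 x Sx.
  have [k [v [w' [kc Ew' vw' gv fvw]]]] := hcells w Ew.
  have [dC cC] := hC k; have [b bu Cb] := cC w v w' Ew' vw' gv fvw.
  exists (k, b); first by rewrite finset.inE /= kc finset.inE; apply/forallP.
  by move: Cb; rewrite /f /y wx.
- by move=> [k b]; exact: (hC k).1.
rewrite lee_fin ler_wpM2l ?omega_ball_ge0 //.
have -> : #|finset.setX cells box| = (#|cells| * #|box|)%N by rewrite cardsX.
rewrite NE in ccells.
have X1 : 1 <= 18 * n%:R * r / eta.
  rewrite ler_pdivlMr // mul1r; apply: le_trans etar _; rewrite ler_peMl ?(ltW r0) //.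
  by rewrite -natrM ler1n muln_gt0.
(* From [K <= r / eta + 2] and [1 <= r / eta] follows [2 * K + 3 <= 9 * (r / eta)], whence [18]. *)
have XX : (2 * n * (2 * K + 3))%:R <= 18 * n%:R * r / eta.
  rewrite !natrM natrD natrM.
  have -> : 18 * n%:R * r / eta = 2 * n%:R * (9 * (r / eta)) by ring.
  rewrite ler_wpM2l ?mulr_ge0 //.
  have h1 : 1 <= r / eta by rewrite ler_pdivlMr // mul1r.
  have h2 : (r + eta) / eta = r / eta + 1 by rewrite mulrDl divff ?gt_eqF.
  rewrite h2 in Ku; lra.
have c1 : (#|cells|)%:R <= ((32 * lift_deg d m + 9) ^ (lift_dim n m + i + 1))%:R *
    (i.+1%:R * (18 * n%:R * r / eta) ^+ i) :> R.
  apply: (@le_trans _ _ ((32 * D + 9) ^ (lift_dim n m + i + 1) *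
     \sum_(a < i.+1) (2 * n * (2 * K + 3)) ^ a)%:R).
    by rewrite ler_nat.
  rewrite natrM ler_wpM2l // natr_sum.
  under eq_bigr do rewrite natrX.
  by apply: geometric_sum_le => //; rewrite ler0n.
have c2 : (#|box|)%:R <= \prod_(a < i)
    ((4 * n%:R * Lam (widen_ord im a) + (2 * m%:R * M1 + 1) * eta) / eta) :> R.
  apply: (@le_trans _ _ (\prod_a u a)%:R); first by rewrite ler_nat card_box.
  rewrite natr_prod; apply: ler_prod => a _; rewrite ler0n /=.
  apply: le_trans (uu a) _; rewrite /Ra.
  by rewrite le_eqVlt; apply/orP; left; apply/eqP; field; rewrite gt_eqF.
rewrite natrM.
apply: (@le_trans _ _ (((32 * lift_deg d m + 9) ^ (lift_dim n m + i + 1))%:R *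
    (i.+1%:R * (18 * n%:R * r / eta) ^+ i) * (\prod_(a < i)
    ((4 * n%:R * Lam (widen_ord im a) + (2 * m%:R * M1 + 1) * eta) / eta)) *
    (i%:R * eta ^+ 2) ^+ i)).
  have ie0 : 0 <= i%:R * eta ^+ 2 :> R by rewrite mulr_ge0 // ltW.
  by rewrite ler_wpM2r ?exprn_ge0 //; apply: ler_pM.
rewrite le_eqVlt; apply/orP; left; apply/eqP.
rewrite big_split /= prodr_const card_ord exprVn.
have -> : (18 * n%:R * r / eta) ^+ i = (18 * n%:R * r) ^+ i * (eta ^+ i)^-1.
  by rewrite [LHS]exprMn exprVn.
have -> : (i%:R * eta ^+ 2) ^+ i = i%:R ^+ i * (eta ^+ i * eta ^+ i).
  by rewrite exprMn expr2 [X in _ * X]exprMn.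
have en : eta ^+ i != 0 by rewrite expf_neq0 // gt_eqF.
by field.
Qed.

End ImageMeasure.

(** * Integrals without measurability *)

Section Integrals.
Variable R : realType.

(* The integral of a nonnegative function is a supremum over the simple functions
   below it, hence monotone even on nonmeasurable functions. *)
Lemma nonmeasurable_ge0_le_integral d (T : measurableType d) (mu : {measure set T -> \bar R})
    (D : set T) (f g : T -> \bar R) :
  (forall x, D x -> (0 <= f x)%E) -> (forall x, D x -> (f x <= g x)%E) ->
  (\int[mu]_(x in D) f x <= \int[mu]_(x in D) g x)%E.
Proof.
move=> f0 fg.
have g0 x : D x -> (0 <= g x)%E by move=> Dx; exact: le_trans (f0 _ Dx) (fg _ Dx).
rewrite !ge0_integralE //; apply: le_ereal_sup => _ [h hf <-]; exists h => // x.
apply: le_trans (hf x) _; rewrite /patch; case: ifPn => // /set_mem; exact: fg.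
Qed.

Lemma hausdorff_delta_ge0 N s delta (E : set 'rV[R]_N) : (0 <= hausdorff_delta s delta E)%E.
Proof.
apply: le_ereal_inf_tmp => _ [C [_ [_ ->]]]; apply: nneseries_ge0 => j _ _.
apply: mule_ge0; first by rewrite lee_fin omega_ball_ge0.
apply: expe_ge0; apply: mule_ge0; first exact: ediam_ge0.
by rewrite lee_fin.
Qed.

Lemma hausdorff_ge0 N s (E : set 'rV[R]_N) : (0 <= hausdorff s E)%E.
Proof.
apply: (le_trans (hausdorff_delta_ge0 s 1 E)); apply: ereal_sup_ubound.
by exists 1.
Qed.

Lemma le_hausdorff N s (E F : set 'rV[R]_N) : E `<=` F -> (hausdorff s E <= hausdorff s F)%E.
Proof.
move=> EF; apply: ge_ereal_sup => _ [delta [d0 ->]].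
apply: (@le_trans _ _ (hausdorff_delta s delta F)); last first.
  by apply: ereal_sup_ubound; exists delta.
apply: le_ereal_inf => _ [C [FC [dC ->]]]; exists C; split=> //.
exact: subset_trans FC.
Qed.

Lemma hausdorff_set0 N s : (0 < s)%N -> hausdorff s (@set0 'rV[R]_N) = 0%E.
Proof.
move=> s0; apply/eqP; rewrite eq_le hausdorff_ge0 andbT.
apply: ge_ereal_sup => _ [delta [d0 ->]].
have := @hausdorff_delta_finite R N s delta set0 unit finset.set0 (fun=> set0) 0 s0.
rewrite lexx ltW // cards0 mul0r mulr0; apply=> // _.
by rewrite ediam_set0.
Qed.

Lemma layer_int_le (T : Type) (mu : set T -> \bar R) (D : set T) (f : T -> \bar R) (M H : R) :
  (forall A, (0 <= mu A)%E) -> mu set0 = 0%E -> 0 <= M ->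
  (forall x, D x -> (f x <= M%:E)%E) ->
  (forall t, 0 <= t -> (mu [set x | D x /\ (t%:E < f x)%E] <= H%:E)%E) ->
  (layer_int mu D f <= (H * M)%:E)%E.
Proof.
move=> mu0 mu00 M0 fM muH.
rewrite /layer_int; set Z := [set t : R | 0 <= t].
pose g : R -> \bar R := (cst H%:E) \_ `[0, M]%classic.
have step1 : (\int[@lebesgue_measure R]_(t in Z) mu [set x | D x /\ (t%:E < f x)%E] <=
    \int[@lebesgue_measure R]_(t in Z) g t)%E.
  apply: nonmeasurable_ge0_le_integral => [t _|t /= t0]; first exact: mu0.
  rewrite /g /patch; case: ifPn => [_|]; first exact: muH.
  move=> /negP nt; rewrite (_ : [set x | _] = set0) ?mu00 //.
  rewrite -subset0 => x [Dx tf]; apply: nt; apply/mem_set; rewrite /= in_itv /= t0 /=.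
  by have := lt_le_trans tf (fM x Dx); rewrite lte_fin => /ltW.
apply: le_trans step1 _; rewrite /g -integral_mkcondr.
have -> : Z `&` `[0, M]%classic = `[0, M]%classic.
  by apply/seteqP; split=> t /=; rewrite in_itv /=; [move=> []|move=> /[dup] /andP[]].
rewrite integral_cst //= lebesgue_measure_itv /= lte_fin.
have [->|M00] := eqVneq M 0; first by rewrite ltxx mulr0 mule0.
by rewrite lt_def M00 M0 /= -EFinB subr0 -EFinM.
Qed.

Import HBNNSimple.

(** The simple functions below [f] are measurable, so they can be compared with [C] almost
    everywhere even when [f] is not. *)
Lemma probability_integral_le d (T : measurableType d) (mu : probability T R) (G : set T)
    (f : T -> \bar R) (C : R) :
  measurable G -> mu G = 1%E -> 0 <= C -> (forall x, (0 <= f x)%E) ->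
  (forall x, G x -> (f x <= C%:E)%E) -> (\int[mu]_x f x <= C%:E)%E.
Proof.
move=> mG muG C0 f0 fC.
have mGc : measurable (~` G) by exact: measurableC.
have mGc0 : mu (~` G) = 0%E by rewrite probability_setC // muG subee.
rewrite ge0_integralTE //; apply: ge_ereal_sup => _ [h hf <-]; rewrite -integralT_nnsfun.
apply: (@le_trans _ _ (\int[mu]_x (cst C%:E x))%E); last first.
  by rewrite integral_cst // [X in (C%:E * X)%E](_ : _ = 1%E) ?mule1 //; exact: (@probability_setT d T R mu).
apply: ae_ge0_le_integral => //.
- by move=> x _; rewrite lee_fin; exact: fun_ge0.
- exact/measurable_EFinP.
- exists (~` G); split=> //.
  move=> x /= nx Gx; apply: nx => _; exact: le_trans (hf x) (fC x Gx).
Qed.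

(** Replaces the rank by a continuous function, which makes the set of projections of given rank
    closed, hence Borel. *)
Lemma idempotent_mxtrace m (P : 'M[R]_m) : P *m P = P -> \tr P = (\rank P)%:R.
Proof.
move=> PP.
have rc : row_base P *m col_base P = 1%:M.
  apply: (row_free_inj (row_base_free P)); apply: (row_full_inj (col_base_full P)).
  rewrite /= mul1mx -[row_base P *m col_base P *m row_base P]mulmxA mulmx_base.
  by rewrite [LHS]mulmxA mulmx_base PP.
by rewrite -[in LHS](mulmx_base P) mxtrace_mulC rc mxtrace1.
Qed.

Lemma mx_coord_continuous m n i j : continuous (fun M : 'M[R]_(m, n) => M i j).
Proof. exact: coord_continuous. Qed.

Lemma continuous_sum (T : topologicalType) (I : Type) (s : seq I) (F : I -> T -> R) :
  (forall k, continuous (F k)) -> continuous (fun x => \sum_(k <- s) F k x).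
Proof.
move=> cF; elim: s => [|k s IH] x.
  under [fun _ => _]funext do rewrite big_nil; exact: cst_continuous.
under [fun _ => _]funext do rewrite big_cons.
apply: (@continuousD _ _ _ (F k) (fun x => \sum_(k <- s) F k x)); [exact: cF|exact: IH].
Qed.

Lemma closed_eq_cst (T : topologicalType) (h : T -> R) c : continuous h ->
  closed [set x | h x = c].
Proof.
move=> ch; rewrite (_ : [set x | _] = h @^-1` [set r | r = c]) //.
by apply: preimage_closed; [move=> ? _; exact: ch|exact: closed_eq].
Qed.

Lemma measurable_grass m i : measurable ([set P | grass_proj i P] : set (MBorel R m)).
Proof.
have -> : [set P | grass_proj i P] =
    ((\bigcap_(ab in [set: 'I_m * 'I_m]) [set P : 'M[R]_m | P ab.1 ab.2 - P ab.2 ab.1 = 0]) `&`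
    (\bigcap_(ab in [set: 'I_m * 'I_m])
      [set P : 'M[R]_m | \sum_c P ab.1 c * P c ab.2 - P ab.1 ab.2 = 0])) `&`
    [set P : 'M[R]_m | \sum_a P a a = i%:R].
  apply/seteqP; split => P.
    move=> [sP [PP rP]]; split; [split|].
    - by move=> [a b] _ /=; rewrite -{1}sP mxE subrr.
    - move=> [a b] _ /=; have /matrixP/(_ a b) := PP; rewrite mxE => ->.
      by rewrite subrr.
    - by have := idempotent_mxtrace PP; rewrite rP.
  move=> [[h1 h2] h3].
  have PP : P *m P = P.
    by apply/matrixP => a b; rewrite mxE; apply/eqP; rewrite -subr_eq0; apply/eqP; exact: (h2 (a, b)).
  split; [|split] => //.
    by apply/matrixP => a b; rewrite mxE; apply/eqP; rewrite -subr_eq0; apply/eqP; exact: (h1 (b, a)).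
  have := idempotent_mxtrace PP; rewrite /mxtrace h3 => /eqP; rewrite eqr_nat => /eqP; exact.
have mC : forall A : set 'M[R]_m, closed A -> measurable (A : set (MBorel R m)).
  move=> A cA; rewrite -[A]setCK; apply: measurableC; apply: sub_sigma_algebra.
  exact: closed_openC.
apply: mC; apply: closedI; [apply: closedI|].
- apply: closed_bigI => -[a b] _; apply: closed_eq_cst => P.
  by apply: continuousB; exact: mx_coord_continuous.
- apply: closed_bigI => -[a b] _; apply: closed_eq_cst => P.
  apply: (@continuousB _ _ _ (fun P : 'M[R]_m => \sum_c P a c * P c b) (fun P : 'M[R]_m => P a b)).
    apply: continuous_sum => c Q.
    apply: (@continuousM _ _ (fun P : 'M[R]_m => P a c) (fun P : 'M[R]_m => P c b));
      exact: mx_coord_continuous.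
  exact: mx_coord_continuous.
- apply: closed_eq_cst; apply: continuous_sum => a; exact: mx_coord_continuous.
Qed.

End Integrals.

(** * Bounds for fibres and for projections *)

Section Final.
Variable R : realType.

Lemma row_continuous N m D (F : 'rV[R]_N -> 'rV[R]_m) :
  (forall k, pf D (fun v => F v ord0 k)) -> continuous F.
Proof.
move=> pF v; apply/(@cvgrPdist_lt _ _ _ _ (nbhs_filter v)) => e e0.
have near_v : forall k, \forall x \near v, `|F v ord0 k - F x ord0 k| < e.
  move=> k; have := pf_continuous (pF k) (x := v).
  by move=> /(@cvgrPdist_lt _ _ _ _ (nbhs_filter v)) /(_ e e0).
have := @filter_forall _ _ (fun k x => `|F v ord0 k - F x ord0 k| < e) (nbhs v)
  (nbhs_filter v) near_v.
apply: filterS => x h; apply: rV_norm_lt => // k; have := h k; by rewrite !mxE.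
Qed.

(** The fibre is again the image of a zero set: the squared equations [phi v *m P = x] join [E]
    without raising its degree bound. *)
Lemma b0_fiber_le n m d (p : 'rV[R]_n -> 'rV[R]_m) (Lam : 'I_m -> R) (r : R) (P : 'M[R]_m) x :
  (0 < m)%N -> poly_map_deg d p -> (forall k, 0 <= Lam k) ->
  (b0 [set a | (p @` (CLam p Lam `&` @eball R n r)) a /\ a *m P = x] <=
    ((4 * lift_deg d m + 1) ^ (lift_dim n m))%:R%:E)%E.
Proof.
move=> m0 dp Lam0.
have [N [io [E [A [NE [inj_io [pE [E0 [EA [E1 E2]]]]]]]]]] := lift_zero_set r dp Lam0.
set D := (2 * d * m + m + 2)%N in pE.
have dD : (d <= D)%N by rewrite /D; nia.
pose phi (v : 'rV[R]_N) := p (\row_j v ord0 (io j)).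
have pphi k : pf D (fun v => phi v ord0 k).
  have pp : pf d (fun x => p x ord0 k) by exact: poly_fun_deg_pf.
  apply: (pf_le dD); apply: pf_comp pp => j.
  by apply: eq_pf (pf_var 0 (io j)) => v; rewrite mxE.
pose Ex (v : 'rV[R]_N) := E v + \sum_k ((phi v *m P) ord0 k - x ord0 k) ^+ 2.
have sq0 v : 0 <= \sum_k ((phi v *m P) ord0 k - x ord0 k) ^+ 2.
  by apply: sumr_ge0 => k _; exact: sqr_ge0.
have pEx : pf (2 * D) Ex.
  apply: pf_add => //; apply: pf_sum => k _.
  apply: (@pf_exp _ _ D (fun v => (phi v *m P) ord0 k - x ord0 k)).
  by apply: pf_sub; [exact: pf_mulmx_col|exact: pf_cst].
have Ex0 v : 0 <= Ex v by rewrite addr_ge0.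
have ExP v : Ex v = 0 -> E v = 0 /\ phi v *m P = x.
  move=> /eqP; rewrite paddr_eq0 // => /andP[/eqP -> ].
  rewrite psumr_eq0 => [/allP h|k _]; last exact: sqr_ge0.
  split=> //; apply/rowP => k; have := h k (mem_index_enum _).
  by rewrite sqrf_eq0 subr_eq0 => /eqP.
have ExA v : Ex v = 0 -> `|v| <= `|A|.
  move=> /ExP[/EA vA _]; apply: rV_norm_le => // j.
  rewrite -ler_sqr ?nnegrE // !real_normK ?num_real // -vA (bigD1 j) //=.
  by rewrite lerDl; apply: sumr_ge0 => l _; exact: sqr_ge0.
have -> : [set a | (p @` (CLam p Lam `&` @eball R n r)) a /\ a *m P = x] =
    phi @` [set v | Ex v = 0].
  apply/seteqP; split => a /=.
    move=> [[y Sy <-] yP]; have [v Ev vy] := E2 y Sy.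
    exists v; last by rewrite /phi vy.
    rewrite /Ex Ev add0r big1 // => k _; by rewrite /phi vy yP subrr expr0n.
  move=> [v /ExP[Ev vP] <-]; split=> //; exists (\row_j v ord0 (io j)) => //.
  exact: E1.
apply: le_trans (b0_zero_set_image pEx Ex0 ExA (row_continuous pphi)) _.
by rewrite NE /lift_dim lee_fin ler_nat mulnA addn1.
Qed.

Lemma hausdorff_image_le n m d (p : 'rV[R]_n -> 'rV[R]_m) (Lam : 'I_m -> R) (r : R) i
    (P : 'M[R]_m) (im : (i <= m)%N) :
  (m <= n)%N -> (0 < i)%N -> poly_map_deg d p -> (forall k, 0 <= Lam k) -> 0 < r ->
  grass_proj i P ->
  (hausdorff i ((fun a => a *m P) @` (p @` (CLam p Lam `&` @eball R n r))) <=
   (omega_ball i * (((32 * lift_deg d m + 9) ^ (lift_dim n m + i + 1))%:R *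
       (i.+1%:R * (18 * n%:R * r) ^+ i) * i%:R ^+ i *
       \prod_(a < i) (4 * n%:R * Lam (widen_ord im a))))%:E)%E.
Proof.
move=> mn i0 dp Lam0 r0 gP.
have [c c0 hc] := image_cover im mn i0 dp Lam0 r0 gP.
apply: ge_ereal_sup => _ [delta [d0 ->]].
set Z := _ * (i.+1%:R * _) * _ in hc *.
have Z0 : 0 <= Z.
  by rewrite !mulr_ge0 // exprn_ge0 // !mulr_ge0 // ltW.
(* As a polynomial in one variable the product is Lipschitz near [0], which controls the passage
   from [c * eta] to [0]. *)
pose h (x : 'rV[R]_1) := \prod_(a < i) (4 * n%:R * Lam (widen_ord im a) + c * x ord0 ord0).
have ph : pf (\sum_(a < i) 1) h.
  apply: pf_prod => a _; apply: pf_add; first exact: pf_cst.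
  by apply: pf_scale; exact: pf_var.
have [M M0 hM] := pf_lipschitz 1 ph.
apply/lee_addgt0Pr => e e0.
set W := omega_ball i * Z.
have W0 : 0 <= W by rewrite mulr_ge0 // omega_ball_ge0.
(* The bounds serve, in order, the two size conditions of the cover, its mesh [delta], and the final
   error [e]. *)
pose eta := Num.min (Num.min 1 r) (Num.min (delta / i.+1%:R) (e / (W * M + 1))).
have WM : 0 < W * M + 1 by rewrite ltr_wpDl // mulr_ge0.
have eta0 : 0 < eta by rewrite !lt_min ltr01 r0 !divr_gt0.
have eta1 : eta <= 1 by rewrite !ge_min lexx.
have etar : eta <= r by rewrite !ge_min lexx orbT.
have etad : eta <= delta / i.+1%:R by rewrite !ge_min lexx !orbT.
have etae : eta <= e / (W * M + 1) by rewrite !ge_min lexx !orbT.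
have ed : i%:R * eta ^+ 2 <= delta.
  apply: (@le_trans _ _ (i.+1%:R * eta)); last by rewrite mulrC -ler_pdivlMr.
  by rewrite ler_pM ?sqr_ge0 // ?ler_nat // expr2 ler_piMl // ltW.
apply: le_trans (hc eta delta eta0 eta1 etar ed) _.
rewrite -EFinD lee_fin [leLHS]mulrA [X in _ <= X + _]mulrA -/W -lerBlDl -mulrBr.
have ne : `|const_mx eta : 'rV[R]_1| <= eta.
  by apply: rV_norm_le => [|j]; [exact: ltW|rewrite mxE gtr0_norm].
have := hM 0 (const_mx eta); rewrite normr0 => /(_ ler01 (le_trans ne eta1)).
rewrite /h !mxE subr0; under [X in _ - X]eq_bigr do rewrite mulr0 addr0.
move=> /ler_normlP[_ H].
apply: (@le_trans _ _ (W * (M * eta))).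
  by rewrite ler_wpM2l //; apply: le_trans H _; rewrite ler_wpM2l.
apply: (@le_trans _ _ ((W * M + 1) * eta)).
  by rewrite mulrA ler_wpM2r ?(ltW eta0) // lerDl.
by rewrite mulrC -ler_pdivlMr.
Qed.

End Final.

(** * Constants and assembly *)

Section Assembly.
Variable R : realType.

Lemma b0_set0 N : (b0 (@set0 'rV[R]_N) <= 0)%E.
Proof.
apply: ge_ereal_sup => _ [k [-> [f [hf _]]]]; case: k f hf => [//|k] f hf.
by have := hf ord0.
Qed.

Lemma fiber_int_ge0 N i (A : set 'rV[R]_N) P : (0 <= fiber_int i A P)%E.
Proof. by apply: integral_ge0 => t _; exact: hausdorff_ge0. Qed.

(** What remains of the measure bound once the powers of [n], the exponential factor and the [Lam k]
    are taken out. *)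
Definition measure_const (m i : nat) (r : R) : R :=
  omega_ball i * (i.+1%:R * (18 * r) ^+ i * i%:R ^+ i * 4 ^+ i).

Lemma measure_const_ge0 m i r : 0 <= r -> 0 <= measure_const m i r.
Proof.
move=> r0; rewrite mulr_ge0 ?omega_ball_ge0 // !mulr_ge0 // exprn_ge0 //.
by rewrite mulr_ge0.
Qed.

(** Bounds the combined exponent of the component and cell counts per unit of [n]; terms in [m]
    alone are multiplied by [n >= 1]. *)
Definition growth_exponent m := (2 * (m * m + 2 * m + 3) + m + 1)%N.

Definition growth_rate d m := ((32 * lift_deg d m + 9) ^ growth_exponent m * 2 ^ m)%N.

Lemma lift_dim_le n m i : (0 < m)%N -> (m <= n)%N -> (i <= m)%N ->
  (lift_dim n m + (lift_dim n m + i + 1) <= growth_exponent m * n)%N.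
Proof. by move=> m0 mn im; rewrite /lift_dim /growth_exponent; nia. Qed.

(** One factor [n ^ i] is kept as [n ^ m]; the other is at most [(2 ^ m) ^ n], the reason for
    [2 ^ m] in [growth_rate]. *)
Lemma growth_le n m i d : (0 < m)%N -> (m <= n)%N -> (i <= m)%N ->
  (n ^ i * n ^ i * ((4 * lift_deg d m + 1) ^ lift_dim n m *
     (32 * lift_deg d m + 9) ^ (lift_dim n m + i + 1)) <= n ^ m * growth_rate d m ^ n)%N.
Proof.
move=> m0 mn im; have n0 : (0 < n)%N by exact: leq_trans mn.
set b := (32 * lift_deg d m + 9)%N.
have h1 : (n ^ i <= n ^ m)%N by exact: leq_pexp2l.
have h2 : (n ^ i <= (2 ^ m) ^ n)%N.
  apply: leq_trans h1 _; rewrite -expnM mulnC expnM; apply: leq_expn.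
  exact/ltnW/ltn_expl.
have h3 : ((4 * lift_deg d m + 1) ^ lift_dim n m * b ^ (lift_dim n m + i + 1) <=
    (b ^ growth_exponent m) ^ n)%N.
  apply: (@leq_trans (b ^ lift_dim n m * b ^ (lift_dim n m + i + 1))).
    by rewrite leq_mul2r; apply/orP; right; apply: leq_expn; rewrite /b; lia.
  rewrite -expnD -expnM; apply: leq_pexp2l; first by rewrite /b addn_gt0 orbT.
  exact: lift_dim_le.
rewrite /growth_rate expnMn -mulnA; apply: leq_mul => //.
by rewrite mulnC; exact: leq_mul.
Qed.

Lemma grass_fiber_int_le n m d (p : 'rV[R]_n -> 'rV[R]_m) (Lam : 'I_m -> R) (r : R) i
    (P : 'M[R]_m) :
  (m <= n)%N -> (0 < i)%N -> (i <= m)%N -> poly_map_deg d p -> (forall k, 0 <= Lam k) ->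
  0 < r -> grass_proj i P ->
  (fiber_int i (p @` (CLam p Lam `&` @eball R n r)) P <=
    (measure_const m i r * (n%:R ^+ m * (growth_rate d m)%:R ^+ n) *
      \prod_(k < m | (k < i)%N) Lam k)%:E)%E.
Proof.
move=> mn i0 im dp Lam0 r0 gP; have m0 : (0 < m)%N by exact: leq_trans im.
have hH := hausdorff_image_le im mn i0 dp Lam0 r0 gP.
set H := (omega_ball i * _) in hH.
set A := p @` _ in hH *.
pose M : R := ((4 * lift_deg d m + 1) ^ (lift_dim n m))%:R.
apply: (@le_trans _ _ (H * M)%:E).
  apply: layer_int_le => //.
  - by move=> B; exact: hausdorff_ge0.
  - exact: hausdorff_set0.
  - by move=> x _; exact: b0_fiber_le.
  (* A positive component count forces a nonempty fibre, so every superlevel set lies in the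
     projection of [A]. *)
  - move=> t t0; apply: le_trans hH; apply: le_hausdorff => x [xP tb].
    have [[a [Aa ax]]|emp] := pselect (exists a, A a /\ a *m P = x); first by exists a.
    exfalso; move: tb; rewrite (_ : [set a | _] = set0); last first.
      by rewrite -subset0 => a [Aa ax]; apply: emp; exists a.
    move=> /lt_le_trans /(_ (b0_set0 _)); rewrite lte_fin ltNge; by rewrite t0.
rewrite lee_fin.
have -> : \prod_(k < m | (k < i)%N) Lam k = \prod_(a < i) Lam (widen_ord im a).
  by rewrite big_ord_narrow.
set L := \prod_(a < i) Lam _.
have L0 : 0 <= L by exact: prodr_ge0.
have -> : H * M = measure_const m i r * ((n ^ i * n ^ i *
    ((4 * lift_deg d m + 1) ^ lift_dim n m *
     (32 * lift_deg d m + 9) ^ (lift_dim n m + i + 1)))%:R) * L.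
  rewrite /H big_split /= prodr_const card_ord -/L /M /measure_const.
  have -> : 18 * n%:R * r = n%:R * (18 * r) :> R by ring.
  rewrite [(n%:R * _) ^+ i]exprMn [(4 * n%:R) ^+ i]exprMn !natrM !natrX.
  ring.
rewrite ler_wpM2r // ler_wpM2l ?measure_const_ge0 ?(ltW r0) //.
by rewrite -!natrX -natrM ler_nat growth_le.
Qed.

(** The sum makes the constant independent of [i]; the leading [1] gives positivity and covers
    [i = 0]. *)
Definition vitushkin_const (m : nat) (r : R) : R :=
  1 + \sum_(i < m.+1) `|cNi m i| * measure_const m i r.

Lemma vitushkin_const_gt0 m r : 0 < r -> 0 < vitushkin_const m r.
Proof.
move=> r0; rewrite ltr_pwDl // sumr_ge0 // => i _.
by rewrite mulr_ge0 // measure_const_ge0 // ltW.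
Qed.

End Assembly.

Theorem theoremG (R : realType) :
  exists cst : nat -> R -> R, (forall (m : nat) (r : R), 0 < r -> 0 < cst m r) /\
  forall d m : nat, exists beta0 : R, 1 < beta0 /\
  forall (n : nat) (p : 'rV[R]_n -> 'rV[R]_m) (Lam : 'I_m -> R) (i : nat) (r : R)
         (gam : nat -> probability (MBorel R m) R),
    (m <= n)%N -> poly_map_deg d p -> (forall k, 0 <= Lam k) -> (i <= m)%N -> 0 < r ->
    (forall k, (1 <= k <= m)%N -> grass_invariant_prob k (gam k)) ->
    (vitushkin gam i (p @` (CLam p Lam `&` @eball R n r))
      <= (cst m r * n%:R ^+ m * beta0 ^+ n * \prod_(k < m | (k < i)%N) Lam k)%:E)%E.
Proof.
exists (@vitushkin_const R); split; first exact: vitushkin_const_gt0.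
move=> d m; exists (growth_rate d m)%:R.
have rate1 : (1 < growth_rate d m)%N.
  rewrite /growth_rate; apply: (@leq_trans ((32 * lift_deg d m + 9) ^ growth_exponent m)).
    by rewrite /growth_exponent addn1 expnS; apply: (@leq_mul 2 1); rewrite ?expn_gt0 //; lia.
  by rewrite leq_pmulr // expn_gt0.
split; first by rewrite ltr1n.
move=> n p Lam i r gam mn dp Lam0 im r0 hgam.
set A := p @` _.
have cst1 : 1 <= vitushkin_const m r :> R.
  rewrite lerDl sumr_ge0 // => j _.
  by rewrite mulr_ge0 // measure_const_ge0 // ltW.
rewrite /vitushkin; case: eqVneq => [i0|i0].
  rewrite big1 ?mulr1 => [|k]; last by rewrite i0.
  (* For [m = 0] the target is a single point. *)
  case: (posnP m) => [m0|m0].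
    subst m; apply: (@le_trans _ _ 1%:E); last first.
      rewrite lee_fin expr0 mulr1; apply: le_trans cst1 _; rewrite ler_peMr //.
        by rewrite ltW // vitushkin_const_gt0.
      by rewrite exprn_ege1 // ler1n ltnW.
    apply: ge_ereal_sup => _ [k [-> [f [_ injf]]]]; rewrite lee_fin lern1.
    case: k f injf => [//|[//|k]] f injf.
    have : (ord0 : 'I_k.+2) = ord_max by apply: injf; congr connected_component; apply/rowP => -[].
    by move=> /(congr1 val).
  (* The whole of [A] is a fibre of the zero projection, so the fibre bound also handles [V_0]. *)
  have -> : A = [set a | A a /\ a *m (0 : 'M[R]_m) = 0].
    by apply/seteqP; split => a; [move=> Aa; split=> //; rewrite mulmx0|move=> []].
  apply: le_trans (b0_fiber_le r 0 0 m0 dp Lam0) _; rewrite lee_fin.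
  apply: (@le_trans _ _ (1 * n%:R ^+ m * (growth_rate d m)%:R ^+ n)); last first.
    by rewrite -!mulrA ler_wpM2r // -natrX -natrX -natrM ler0n.
  rewrite mul1r -!natrX -natrM ler_nat; apply: leq_trans (growth_le d m0 mn (leq0n m)).
  by rewrite mul1n leq_pmulr // expn_gt0 addn_gt0 orbT.
have i_gt0 : (0 < i)%N by rewrite lt0n.
set X := measure_const m i r * (n%:R ^+ m * (growth_rate d m)%:R ^+ n) *
      \prod_(k < m | (k < i)%N) Lam k.
have L0 : 0 <= \prod_(k < m | (k < i)%N) Lam k by exact: prodr_ge0.
have G0 : 0 <= n%:R ^+ m * (growth_rate d m)%:R ^+ n :> R by rewrite -!natrX -natrM ler0n.
have X0 : 0 <= X by rewrite /X mulr_ge0 // mulr_ge0 // measure_const_ge0 // ltW.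
have [gam1 _] : grass_invariant_prob i (gam i) by apply: hgam; rewrite i_gt0.
have := @probability_integral_le R _ _ (gam i) [set P | grass_proj i P]
  (fiber_int i A) X (@measurable_grass R m i) gam1 X0 (fiber_int_ge0 i A)
  (fun P gP => grass_fiber_int_le mn i_gt0 im dp Lam0 r0 gP).
have : (0 <= \int[gam i]_P fiber_int i A P)%E by apply: integral_ge0 => P _; exact: fiber_int_ge0.
case: (\int[gam i]_P fiber_int i A P)%E => [y| |] //=; rewrite !lee_fin => y0 yX.
apply: (@le_trans _ _ (`|cNi m i| * X)).
  apply: (@le_trans _ _ (`|cNi m i| * y)); first by rewrite ler_wpM2r // ler_norm.
  by rewrite ler_wpM2l.
rewrite -[X in _ <= X * _]mulrA /X [leLHS]mulrA ler_wpM2r // [leLHS]mulrA ler_wpM2r //.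
rewrite /vitushkin_const (bigD1 (Ordinal (im : (i < m.+1)%N))) //=.
rewrite addrCA lerDl addr_ge0 // sumr_ge0 // => j _.
by rewrite mulr_ge0 // measure_const_ge0 // ltW.
Qed.
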